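(* Fix integers $k\ge\theta\ge 1$ and consider the decision problem $DEC$-$SCTM$ restricted to hypergraphs all of whose hyperedges have size $k$ and adoption threshold $\theta$. The hardness of $DEC$-$SCTM$ depends on $k$ and $\theta$ as follows. (1) If $\theta=1$ and $k\ge 1$, then $DEC$-$SCTM$ is in P. (2) If $\theta=2$ and $k\ge 2$, then $DEC$-$SCTM$ is in P. (3) If $\theta\ge 3$ and $k\ge\theta$, then $DEC$-$SCTM$ is NP-hard.
   Context: Let $G$ be a connected hypergraph with node set $N_F=\{1,\dots,n\}$ and hyperedges $e_1,\dots,e_m\subseteq N_F$. In general, each pair of a node $i$ and a hyperedge $e_j$ with $i\in e_j$ has a benefit $r_{ji}\ge 0$, each node $i$ has an adoption cost $c_i$ and a seeding cost $w_i$, and each hyperedge $e_j$ has an adoption threshold $\theta_j$. It is assumed that $c_i>0$ and $\sum_{j:\,i\in e_j}r_{ji}\ge c_i$ for all $i$ (so every node lies in some hyperedge). SCTM activation process: for a seed set $S_0\subseteq N_F$, define for $t=0,1,2,\dots$ $$\mathcal B_i(S_t)=\{j: i\in e_j,\ |S_t\cap e_j|\ge \theta_j-1\},\quad b_i(S_t)=\sum_{j\in\mathcal B_i(S_t)}r_{ji},\quad S_{t+1}=S_t\cup\{i\in N_F\setminus S_t: b_i(S_t)\ge c_i\}.$$ The sequence stabilizes after finitely many steps; its limit is $S_\infty$. The seed set $S_0$ leads to full activation of $G$ if $S_\infty=N_F$. $DEC$-$SCTM$. Input: an integer $h$; a connected hypergraph $G$ with node set $N_F=\{1,\dots,n\}$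 and hyperedges $e_1,\dots,e_m\subseteq N_F$, in which every node lies in some hyperedge, with benefits $r_{ji}=1$, adoption costs $c_i=1$, hyperedge sizes $|e_j|=k$, adoption thresholds $\theta_j=\theta$ for all $i,j$, and rational seeding costs $w_i$. Question: is there a seed set $S_0\subseteq N_F$ with $\sum_{i\in S_0}w_i\le h$ leading to full activation of $G$? *)

(* Defs.v *)
From mathcomp Require Import all_boot all_order all_algebra.
Set Implicit Arguments.
Unset Strict Implicit.
Unset Printing Implicit Defensive.
Import Order.TTheory GRing.Theory Num.Theory.
Local Open Scope ring_scope.

Inductive move := MoveLeft | MoveStay | MoveRight.

(* A two-way infinite tape, blank almost everywhere; [tape_left] lists the    *)
(* cells to the left of the head, nearest first, and both lists are           *)
(* implicitly padded with blanks ([None]).                                    *)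
Record tape (A : Type) := Tape {
  tape_left : seq (option A);
  tape_head : option A;
  tape_right : seq (option A) }.

Definition tape_of_seq (A : Type) (s : seq A) : tape A :=
  Tape [::] (ohead s) (map Some (behead s)).

Definition tape_write (A : Type) (a : option A) (t : tape A) : tape A :=
  Tape (tape_left t) a (tape_right t).

Definition tape_move (A : Type) (d : move) (t : tape A) : tape A :=
  match d with
  | MoveLeft =>
      Tape (behead (tape_left t)) (head None (tape_left t))
           (tape_head t :: tape_right t)
  | MoveStay => t
  | MoveRight =>
      Tape (tape_head t :: tape_left t) (head None (tape_right t))
           (behead (tape_right t))
  end.

(* The tape alphabet consists of the blank [None], the two input symbols      *)
(* [Some (inl b)] and finitely many auxiliary symbols [Some (inr a)].         *)
(* There are [tm_extra.+1] tapes, so at least one.                            *)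
Record tm := TM {
  tm_aux : finType;
  tm_state : finType;
  tm_extra : nat;
  tm_start : tm_state;
  tm_halt : pred tm_state;
  tm_accept : pred tm_state;
  tm_trans : tm_state -> {ffun 'I_tm_extra.+1 -> option (bool + tm_aux)} ->
    tm_state * {ffun 'I_tm_extra.+1 -> option (bool + tm_aux) * move} }.

Definition tm_sym (M : tm) : Type := (bool + tm_aux M)%type.

Record tm_config (M : tm) := Config {
  cfg_state : tm_state M;
  cfg_tape : {ffun 'I_(tm_extra M).+1 -> tape (tm_sym M)} }.

Definition tm_init (M : tm) (x : seq bool) : tm_config M :=
  Config (tm_start M)
    [ffun i => tape_of_seq (if i == ord0 then [seq inl b | b <- x] else [::])].

Definition tm_step (M : tm) (c : tm_config M) : tm_config M :=
  if tm_halt (cfg_state c) then c else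
  let act := tm_trans (cfg_state c) [ffun i => tape_head (cfg_tape c i)] in
  Config act.1
    [ffun i => tape_move (act.2 i).2 (tape_write (act.2 i).1 (cfg_tape c i))].

Definition tm_run (M : tm) (x : seq bool) (t : nat) : tm_config M :=
  iter t (@tm_step M) (tm_init M x).

Fixpoint leading_bits (A : Type) (s : seq (option (bool + A))) : seq bool :=
  if s is Some (inl b) :: s' then b :: leading_bits s' else [::].

(* The output is the maximal block of bits on the first tape that starts at   *)
(* the head position.                                                         *)
Definition tm_output (M : tm) (c : tm_config M) : seq bool :=
  let t := cfg_tape c ord0 in leading_bits (tape_head t :: tape_right t).

Definition language := seq bool -> Prop.

Definition tm_decides_in_time (M : tm) (T : nat -> nat) (L : language) : Prop :=
  forall x : seq bool, let c := tm_run M x (T (size x)) in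
    tm_halt (cfg_state c) /\ (tm_accept (cfg_state c) <-> L x).

Definition tm_computes_in_time (M : tm) (T : nat -> nat)
    (f : seq bool -> seq bool) : Prop :=
  forall x : seq bool, let c := tm_run M x (T (size x)) in
    tm_halt (cfg_state c) /\ tm_output c = f x.

Definition in_P (L : language) : Prop :=
  exists (M : tm) (p : {poly nat}), tm_decides_in_time M (fun n => p.[n]) L.

Definition polytime_computable (f : seq bool -> seq bool) : Prop :=
  exists (M : tm) (p : {poly nat}), tm_computes_in_time M (fun n => p.[n]) f.

(* Every bit of [x] is doubled and the separator is 01, so that the pair can  *)
(* be recovered from its code.                                                *)
Definition pair_code (x y : seq bool) : seq bool :=
  flatten [seq [:: b; b] | b <- x] ++ [:: false; true] ++ y.

Definition in_NP (L : language) : Prop :=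
  exists (V : language) (p : {poly nat}), in_P V /\
    forall x, L x <->
      exists y : seq bool, (size y <= p.[size x])%N /\ V (pair_code x y).

Definition polytime_reducible (L1 L2 : language) : Prop :=
  exists f : seq bool -> seq bool,
    polytime_computable f /\ forall x, L1 x <-> L2 (f x).

Definition NP_hard (L : language) : Prop :=
  forall L' : language, in_NP L' -> polytime_reducible L' L.

(* Hyperedges form an indexed family, as in e_1, ..., e_m.                    *)
Record hypergraph := Hypergraph {
  hnodes : nat;
  hedges : nat;
  hedge : {ffun 'I_hedges -> {set 'I_hnodes}} }.

Definition hadjacent (G : hypergraph) : rel 'I_(hnodes G) :=
  fun u v => [exists j, (u \in hedge G j) && (v \in hedge G j)].

Definition hconnected (G : hypergraph) : Prop :=
  (0 < hnodes G)%N /\ forall u v, connect (@hadjacent G) u v.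

Record sctm := SCTM {
  sctm_graph :> hypergraph;
  benefit : 'I_(hedges sctm_graph) -> 'I_(hnodes sctm_graph) -> rat;
  adoption_cost : 'I_(hnodes sctm_graph) -> rat;
  seeding_cost : 'I_(hnodes sctm_graph) -> rat;
  threshold : 'I_(hedges sctm_graph) -> nat }.

(* The set B_i(S). The truncated subtraction is harmless, even for a zero     *)
(* threshold, because the right-hand side is a cardinality.                   *)
Definition open_edges (N : sctm) (S : {set 'I_(hnodes N)}) (i : 'I_(hnodes N)) :
    {set 'I_(hedges N)} :=
  [set j | (i \in hedge N j) && (threshold j - 1 <= #|S :&: hedge N j|)%N].

Definition total_benefit (N : sctm) (S : {set 'I_(hnodes N)})
    (i : 'I_(hnodes N)) : rat :=
  \sum_(j in open_edges S i) benefit j i.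

Definition activation_step (N : sctm) (S : {set 'I_(hnodes N)}) :
    {set 'I_(hnodes N)} :=
  S :|: [set i in ~: S | adoption_cost i <= total_benefit S i].

(* [Sinf] is the eventual value of S_0, S_1, S_2, ...                         *)
Definition activation_limit (N : sctm) (S0 Sinf : {set 'I_(hnodes N)}) : Prop :=
  exists T : nat, forall t : nat, (T <= t)%N ->
    iter t (@activation_step N) S0 = Sinf.

Definition full_activation (N : sctm) (S0 : {set 'I_(hnodes N)}) : Prop :=
  activation_limit S0 [set: 'I_(hnodes N)].

Record dec_instance := DecInstance {
  dec_budget : int;
  dec_graph : hypergraph;
  dec_cost : 'I_(hnodes dec_graph) -> rat }.

Definition dec_wf (k : nat) (I : dec_instance) : Prop :=
  [/\ hconnected (dec_graph I),
      forall i, exists j, i \in hedge (dec_graph I) j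
    & forall j, #|hedge (dec_graph I) j| = k].

Definition dec_sctm (theta : nat) (I : dec_instance) : sctm :=
  @SCTM (dec_graph I) (fun _ _ => 1) (fun _ => 1) (@dec_cost I)
    (fun _ => theta).

Definition dec_question (theta : nat) (I : dec_instance) : Prop :=
  let N := dec_sctm theta I in
  exists S0 : {set 'I_(hnodes N)},
    \sum_(i in S0) @seeding_cost N i <= (dec_budget I)%:~R /\
    full_activation S0.

(* Each item is announced by the bit 1 and the list is closed by the bit 0,   *)
(* so that the code is self-delimiting as soon as [enc] is.                   *)
Definition enc_seq (A : Type) (enc : A -> seq bool) (s : seq A) : seq bool :=
  flatten [seq true :: enc a | a <- s] ++ [:: false].

(* Binary digits, least significant first, without superfluous zeros.         *)
Definition binary (n : nat) : seq bool :=
  mkseq (fun i => odd (n %/ 2 ^ i)%N) (trunc_log 2 n).+1.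

Definition enc_nat (n : nat) : seq bool :=
  enc_seq (fun b => [:: b]) (binary n).

Definition enc_int (z : int) : seq bool := (z < 0) :: enc_nat `|z|%N.

Definition enc_frac (q : int * nat) : seq bool := enc_int q.1 ++ enc_nat q.2.

Definition enc_hypergraph (G : hypergraph) : seq bool :=
  enc_seq (enc_seq enc_nat)
    [seq [seq val i | i <- enum (hedge G j)] | j <- enum 'I_(hedges G)].

(* Rational costs are written as fractions of binary integers, not            *)
(* necessarily in lowest terms. The number of nodes is the number of costs.   *)
Definition dec_encoded_by (I : dec_instance) (s : seq bool) : Prop :=
  exists frac : 'I_(hnodes (dec_graph I)) -> int * nat,
    (forall i, (0 < (frac i).2)%N /\
               dec_cost i = (frac i).1%:~R / (frac i).2%:R) /\
    s = enc_int (dec_budget I) ++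
        enc_seq enc_frac [seq frac i | i <- enum 'I_(hnodes (dec_graph I))] ++
        enc_hypergraph (dec_graph I).

(* The language of the encodings of the yes-instances of DEC-SCTM with        *)
(* hyperedge size [k] and threshold [theta].                                  *)
Definition DEC_SCTM (k theta : nat) : language :=
  fun s => exists I : dec_instance,
    [/\ dec_wf k I, dec_encoded_by I s & dec_question theta I].

(* Main.v *)
(* For theta <= 2 the activation process is trivial: with theta = 1 every seed
   set activates everything, and with theta = 2 (by connectedness) exactly the
   nonempty ones do. The cheapest seed set thus consists of the nodes of negative
   cost, or of a single cheapest node.

   For theta >= 3, free seeds put into every hyperedge reduce its threshold to 3,
   and then hyperedges simulate Horn rules a /\ b -> c without leaking activation
   backwards: {a, b, s}, {a, b, s'} and {c, s, s'} with nodes s, s' private to the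
   rule. Here s and s' become active only once both a and b are, so c alone or
   together with a triggers nothing. The run of a Turing machine on a fixed input
   is the least model of polynomially many Horn rules, and the bits of an NP
   certificate are seeds chosen under a budget that allows exactly one choice per
   group. Accepting derives a goal, from which everything else is derived.

   Polynomial-time computability is established for functions on binary trees,
   written in preorder on a stack; such functions are closed under composition,
   pairing, case analysis and iteration with polynomially bounded intermediate
   results, and four-stack programs are Turing machines. *)

Require Import Defs.
From mathcomp Require Import all_boot all_order all_algebra.
From mathcomp Require Import zify ring.

Set Implicit Arguments.
Unset Strict Implicit.
Unset Printing Implicit Defensive.

(** * Stack programs and Turing machines *)

(** Horn rules have no negation, so nothing may be derived from the absence of a head or of a
    symbol. Tapes are therefore renumbered so that every head stays at one fixed cell: a move shifts
    the contents, the local configuration alone tells where each cell comes from, and blanks are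
    facts like all other symbols.

    The certificate may have any length up to a bound [L], which gives [L + 1] groups of choices:
    one for the length and one for each bit position. The costs alone do not forbid two choices in
    one group. But the goal also depends on a chain of facts that passes through every group, so a
    seed set within the budget [L + 1] must meet all groups and hence meets each of them exactly
    once. *)

Inductive instr (Q : Type) :=
  | Push of 'I_4 & bool & option Q
  | Pop of 'I_4 & option Q & option Q & option Q.

(* A flow graph over four stacks of bits; the next node [None] is the exit,
   and [Pop i qe q0 q1] branches on the popped bit, or to [qe] on an empty stack. *)
Record prog := Prog {
  pst : finType;
  pentry : option pst;
  pcode : pst -> instr pst }.

Definition stacks := seq (seq bool).

Definition exec Q (c : instr Q) (S : stacks) : option Q * stacks :=
  match c with
  | Push i b q => (q, set_nth [::] S i (b :: nth [::] S i))
  | Pop i qe q0 q1 =>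
      if nth [::] S i is b :: s then (if b then q1 else q0, set_nth [::] S i s)
      else (qe, S)
  end.

Inductive runs (P : prog) : option (pst P) -> stacks -> nat -> stacks -> Prop :=
  | runs_exit S : runs None S 0 S
  | runs_step q S t S' :
      runs (exec (pcode q) S).1 (exec (pcode q) S).2 t S' ->
      runs (Some q) S t.+1 S'.

Definition within (P : prog) (S : stacks) (n : nat) (S' : stacks) :=
  exists2 t, t <= n & runs (pentry P) S t S'.

Definition instr_map Q Q' (f : option Q -> option Q') (c : instr Q) : instr Q' :=
  match c with
  | Push i b q => Push i b (f q)
  | Pop i qe q0 q1 => Pop i (f qe) (f q0) (f q1)
  end.

(** The common core of all combinators: a copy of [P] inside [P'] whose exit is redirected to
    [f None] runs as before until it leaves through that exit. *)
Lemma runs_embed (P P' : prog) (f : option (pst P) -> option (pst P'))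
    (g : pst P -> pst P') q S t S' t' S'' :
  (forall p, f (Some p) = Some (g p)) ->
  (forall p, pcode (g p) = instr_map f (pcode p)) ->
  runs q S t S' -> runs (f None) S' t' S'' -> runs (f q) S (t + t') S''.
Proof.
move=> fE gE; elim=> {q S t S'} [S //|q S t S' _ IH] /IH {}IH.
rewrite fE addSn; apply: runs_step; rewrite gE.
case: (pcode q) IH => [i b q'|i qe q0 q1] //=.
by case: nth => [|[] s].
Qed.

Definition skip : prog :=
  @Prog void None (fun x => match x with end).

Definition push (i : 'I_4) (b : bool) : prog :=
  @Prog unit (Some tt) (fun _ => Push i b None).

Section Combinators.

Variables P Q : prog.

Definition pseq : prog :=
  let k := omap (@inr (pst P) _) (pentry Q) in
  @Prog (pst P + pst Q)%type
    (oapp (fun p => Some (inl p)) k (pentry P))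
    (fun x => match x with
      | inl p => instr_map (oapp (fun p => Some (inl p)) k) (pcode p)
      | inr q => instr_map (omap inr) (pcode q)
      end).

Lemma within_seq S n S' n' S'' :
  within P S n S' -> within Q S' n' S'' -> within pseq S (n + n') S''.
Proof.
move=> [t le_t rP] [t' le_t' rQ]; exists (t + t'); first exact: leq_add.
pose k := omap (@inr (pst P) _) (pentry Q).
apply: (@runs_embed P pseq (oapp (fun p => Some (inl p)) k) inl) rP _ => //=.
rewrite -[t']addn0.
by apply: (@runs_embed Q pseq (omap inr) inr) rQ _ => //=; constructor.
Qed.

Variables (i : 'I_4) (R : prog).

(* [P] on the empty stack, [Q] after popping 0 and [R] after popping 1. *)
Definition pcase : prog :=
  let eP := omap (fun p => Some (inl p : pst P + (pst Q + pst R))) in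
  let eQ := omap (fun p => Some (inr (inl p) : pst P + (pst Q + pst R))) in
  let eR := omap (fun p => Some (inr (inr p) : pst P + (pst Q + pst R))) in
  @Prog (option (pst P + (pst Q + pst R))) (Some None)
    (fun x => match x with
      | None => Pop i (eP (pentry P)) (eQ (pentry Q)) (eR (pentry R))
      | Some (inl p) => instr_map eP (pcode p)
      | Some (inr (inl p)) => instr_map eQ (pcode p)
      | Some (inr (inr p)) => instr_map eR (pcode p)
      end).

Lemma within_case S n S' :
  match nth [::] S i with
  | [::] => within P S n S'
  | false :: s => within Q (set_nth [::] S i s) n S'
  | true :: s => within R (set_nth [::] S i s) n S'
  end -> within pcase S n.+1 S'.
Proof.
case E: nth => [|[] s] [t le_t r]; exists t.+1 => //;
  apply: runs_step; rewrite /= E /= -[t]addn0.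
- by apply: (@runs_embed P pcase (omap (fun p => Some (inl p)))
    (fun p => Some (inl p))) r _ => //; constructor.
- by apply: (@runs_embed R pcase (omap (fun p => Some (inr (inr p))))
    (fun p => Some (inr (inr p)))) r _ => //; constructor.
- by apply: (@runs_embed Q pcase (omap (fun p => Some (inr (inl p))))
    (fun p => Some (inr (inl p)))) r _ => //; constructor.
Qed.

Definition pwhile : prog :=
  let eP := oapp (fun p => Some (Some (inl p : pst P + pst Q))) (Some None) in
  let eQ := oapp (fun p => Some (Some (inr p : pst P + pst Q))) (Some None) in
  @Prog (option (pst P + pst Q)) (Some None)
    (fun x => match x with
      | None => Pop i None (eP (pentry P)) (eQ (pentry Q))
      | Some (inl p) => instr_map eP (pcode p)
      | Some (inr p) => instr_map eQ (pcode p)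
      end).

Lemma within_while0 S : nth [::] S i = [::] -> within pwhile S 1 S.
Proof.
by move=> E; exists 1 => //; apply: runs_step; rewrite /= E; constructor.
Qed.

Lemma within_while S b s n S' n' S'' :
  nth [::] S i = b :: s ->
  within (if b then Q else P) (set_nth [::] S i s) n S' ->
  within pwhile S' n' S'' -> within pwhile S (n + n').+1 S''.
Proof.
move=> E [t le_t r] [t' le_t' r']; exists (t + t').+1.
  by rewrite ltnS leq_add.
apply: runs_step; rewrite /= E /=.
case: b E r => E r.
- exact: (@runs_embed Q pwhile (oapp (fun p => Some (Some (inr p))) (Some None))
    (fun p => Some (inr p))) r r'.
- exact: (@runs_embed P pwhile (oapp (fun p => Some (Some (inl p))) (Some None))
    (fun p => Some (inl p))) r r'.
Qed.

End Combinators.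

Lemma within_leq P S n n' S' : n <= n' -> within P S n S' -> within P S n' S'.
Proof. by move=> le_n [t le_t r]; exists t => //; apply: leq_trans le_n. Qed.

Lemma within_skip S : within skip S 0 S.
Proof. by exists 0 => //; constructor. Qed.

Lemma within_push S i b :
  within (push i b) S 1 (set_nth [::] S i (b :: nth [::] S i)).
Proof. by exists 1 => //; apply: runs_step; constructor. Qed.

(** A step adds at most one bit, so a time bound is also a bound on the size of the result; [PT_sz]
    rests on this. *)
Lemma within_size P S n S' :
  within P S n S' -> size (nth [::] S' 0) <= size (nth [::] S 0) + n.
Proof.
move=> [t le_t r]; apply: leq_trans (leq_add (leqnn _) le_t).
elim: r => {S t S' le_t} [S|q S t S' _ IH]; first by rewrite addn0.
apply: leq_trans IH _; rewrite addnS -addSn leq_add2r.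
case: (pcode q) => [i b q'|i qe q0 q1] /=.
  by rewrite nth_set_nth /=; case: eqP => //= <-.
case E: (nth [::] S i) => [|b s] //=.
by rewrite nth_set_nth /=; case: eqP => //= ->; rewrite E /= ltnW.
Qed.

(* A stack lives on a tape with its top under the head. *)
Definition on_tape A (t : tape (bool + A)) (s : seq bool) :=
  nth None (tape_head t :: tape_right t) =1 nth None [seq Some (inl b) | b <- s].

(** * Simulation of stack programs by four-tape machines *)

Section Simulation.

Variable P : prog.

(* The boolean of a left state tells that the head has already been moved for
   a push; the right states are final and record whether the top bit is 1. *)
Let state := (option (pst P) * bool + bool)%type.
Let symbol := option (bool + void).
Let no_action (r : {ffun 'I_4 -> symbol}) : {ffun 'I_4 -> symbol * move} :=
  [ffun i => (r i, MoveStay)].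
Let action i (a : symbol * move) (r : {ffun 'I_4 -> symbol}) :
    {ffun 'I_4 -> symbol * move} :=
  [ffun j => if j == i then a else (r j, MoveStay)].

Definition tm_of_prog : tm :=
  @TM void state 3 (inl (pentry P, false))
    (fun s => if s is inr _ then true else false)
    (fun s => if s is inr b then b else false)
    (fun s r => match s with
      | inr b => (inr b, no_action r)
      | inl (None, _) => (inr (r ord0 == Some (inl true)), no_action r)
      | inl (Some q, ph) =>
          match pcode q with
          | Push i b q' =>
              if ph then (inl (q', false), action i (Some (inl b), MoveStay) r)
              else (inl (Some q, true), action i (r i, MoveLeft) r)
          | Pop i qe q0 q1 =>
              match r i with
              | Some (inl b) =>
                  (inl (if b then q1 else q0, false), action i (r i, MoveRight) r)
              | _ => (inl (qe, false), no_action r)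
              end
          end
      end).


Lemma on_tape_head A (t : tape (bool + A)) s :
  on_tape t s -> tape_head t = if s is b :: _ then Some (inl b) else None.
Proof. by move/(_ 0) => /= ->; case: s. Qed.

Let tapes_of (c : tm_config tm_of_prog) (S : stacks) :=
  forall i, on_tape (cfg_tape c i) (nth [::] S i).

(** Popped bits stay behind to the left of the head, and a machine writes before it moves. A push
    therefore takes two steps: move left, then overwrite the cell found there. *)
Lemma tm_of_prog_step (q : pst P) (c : tm_config tm_of_prog) S :
  cfg_state c = inl (Some q, false) -> tapes_of c S ->
  exists2 u, u <= 2 & let c' := iter u (@tm_step _) c in
    cfg_state c' = inl ((exec (pcode q) S).1, false) /\
    tapes_of c' (exec (pcode q) S).2.
Proof.
case: c => s tp /= -> tE.
case E: (pcode q) => [i b q'|i qe q0 q1] /=.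
  exists 2 => //=; rewrite /tm_step /= E /= E /=; split=> // j.
  rewrite /= /action !ffunE /= nth_set_nth /=.
  have [->|ne] := eqVneq j i.
    by rewrite eqxx; case=> [|k] //=; exact: (tE i k).
  rewrite /= ifN ?(inj_eq val_inj) //.
  by move: (tE j); case: (tp j).
exists 1 => //=; rewrite /tm_step /= E /= !ffunE (on_tape_head (tE i)).
case Ei: (nth [::] S i) => [|b s'] /=.
  split=> // j; rewrite /= !ffunE /=.
  by move: (tE j); case: (tp j).
split=> // j; rewrite /= /action !ffunE /= nth_set_nth /=.
have [->|ne] := eqVneq j i; last first.
  by rewrite /= ifN ?(inj_eq val_inj) //; move: (tE j); case: (tp j).
rewrite eqxx /=.
move=> k; have := tE i k.+1; rewrite Ei /= => <-.
by case: (tape_right (tp i)) k => [|x r] [|k] /=; rewrite ?nth_nil.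
Qed.

Lemma tm_of_prog_runs q S t S' (c : tm_config tm_of_prog) :
  runs q S t S' -> cfg_state c = inl (q, false) -> tapes_of c S ->
  exists2 u, u <= t.*2 & let c' := iter u (@tm_step _) c in
    cfg_state c' = inl (None, false) /\ tapes_of c' S'.
Proof.
move=> r; elim: r c => {q S t S'} [S|q S t S' _ IH] c cq cS; first by exists 0.
have [u le_u [cq' cS']] := tm_of_prog_step cq cS.
have [v le_v vP] := IH _ cq' cS'.
exists (v + u); last by rewrite iterD.
by rewrite doubleS -addn2 leq_add.
Qed.

Lemma leading_bits_map A (t : seq (option (bool + A))) s :
  nth None t =1 nth None [seq Some (inl b) | b <- s] -> leading_bits t = s.
Proof.
elim: s t => [|b s IH] [|a t] tE //=.
- by have := tE 0 => /= ->.
- by have := tE 0.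
- by have /= -> := tE 0; rewrite (IH t) // => k; exact: (tE k.+1).
Qed.

Lemma tm_halted_iter (M : tm) (c : tm_config M) u :
  tm_halt (cfg_state c) -> iter u (@tm_step M) c = c.
Proof. by move=> h; elim: u => //= u ->; rewrite /tm_step h. Qed.

Lemma tm_of_prog_run x n s T :
  within P [:: x; [::]; [::]; [::]] n [:: s; [::]; [::]; [::]] -> n.*2 < T ->
  let c := tm_run tm_of_prog x T in
  [/\ tm_halt (cfg_state c), tm_accept (cfg_state c) = head false s
    & tm_output c = s].
Proof.
move=> [t le_t r] ltT; rewrite /tm_run.
set c0 := tm_init _ _.
have c0S : tapes_of c0 [:: x; [::]; [::]; [::]].
  move=> i; rewrite /c0 /= ffunE; case: eqP => [->|ne].
    by case: x {r c0} => [|b x] [|k] //=; rewrite ?nth_nil // -map_comp.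
  by move: ne; case: i => [[|[|[|[|i]]]]] //= hi ne [|k] //=; rewrite ?nth_nil //;
    case: ne; apply: val_inj.
have [u le_u []] := tm_of_prog_runs r (erefl (cfg_state c0)) c0S.
set c := iter u _ _ => cq cS.
have ltu : u < T by apply: leq_ltn_trans le_u _; apply: leq_ltn_trans ltT; rewrite leq_double.
(* One further step leads from the exit to a final state that records the top bit. Nothing changes
   afterwards, so every later time is as good. *)
rewrite -(subnK ltu) iterD -/c iterS.
set c1 := tm_step _.
have c1E : cfg_state c1 = inr (head false s).
  rewrite /c1 /tm_step cq /= ffunE (on_tape_head (cS ord0)) /=.
  by case: (s) => [|[]].
have c1S : tapes_of c1 [:: s; [::]; [::]; [::]].
  rewrite /c1 /tm_step cq => i /=; rewrite !ffunE /=.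
  by move: (cS i); case: (cfg_tape c i).
rewrite tm_halted_iter ?c1E //; split=> //.
exact: leading_bits_map (c1S ord0).
Qed.

End Simulation.

(** * Programs on trees *)

Inductive tree := Leaf | Node of tree & tree.

(* Preorder: on a stack of trees, pushing 1 is pairing the two topmost trees. *)
Fixpoint ser (t : tree) : seq bool :=
  if t is Node a b then true :: ser a ++ ser b else [:: false].

Definition tree_size (t : tree) := size (ser t).

Lemma tree_size_Node a b : tree_size (Node a b) = (tree_size a + tree_size b).+1.
Proof. by rewrite /tree_size /= size_cat. Qed.

Lemma tree_size_gt0 t : 0 < tree_size t. Proof. by case: t. Qed.

(** Preorder codes are prefix-free: a tree can be read off the top of a stack without an end
    marker. *)
Lemma ser_cat_inj t t' r r' : ser t ++ r = ser t' ++ r' -> t = t' /\ r = r'.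
Proof.
elim: t t' r r' => [|a IHa b IHb] [|a' b'] r r' //=; first by case=> ->.
by case; rewrite -!catA => /IHa[-> /IHb[-> ->]].
Qed.

Notation r0 := (@Ordinal 4 0 isT).
Notation r1 := (@Ordinal 4 1 isT).
Notation r2 := (@Ordinal 4 2 isT).
Notation r3 := (@Ordinal 4 3 isT).

(** Here [st s a] is the whole configuration when [s] is left on the driving stack and [a] describes
    the rest, so a draining loop is a fold over the drained bits. *)
Lemma within_while_foldl (A : Type) (st : seq bool -> A -> stacks) (i : 'I_4) P Q n
    (g : A -> bool -> A) s a :
  (forall s a, nth [::] (st s a) i = s) ->
  (forall b s a,
     within (if b then Q else P) (set_nth [::] (st (b :: s) a) i s) n
       (st s (g a b))) ->
  within (pwhile P Q i) (st s a) (n.+1 * size s).+1 (st [::] (foldl g a s)).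
Proof.
move=> stE stS; elim: s a => [|b s IH] a /=.
  by apply: within_leq (within_while0 _ _ (stE _ _)); rewrite muln0.
apply: within_leq (within_while (stE _ _) (stS _ _ _) (IH _)); lia.
Qed.

Lemma foldl_cons A (s a : seq A) : foldl (fun a b => b :: a) a s = catrev s a.
Proof. by elim: s a => //= x s IH a; rewrite IH. Qed.

Lemma catrev_catrev (A : Type) (s a : seq A) : catrev (catrev s [::]) a = s ++ a.
Proof. by rewrite catrevE -/(rev s) revK. Qed.

Lemma size_catrev (A : Type) (s a : seq A) : size (catrev s a) = size s + size a.
Proof. by rewrite catrevE size_cat size_rev. Qed.

Definition pmove (i j : 'I_4) := pwhile (push j false) (push j true) i.

Lemma within_pmove10 m x y c :
  within (pmove r1 r0) [:: m; x; y; c] (2 * size x).+1 [:: catrev x m; [::]; y; c].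
Proof.
rewrite -foldl_cons.
by apply: (within_while_foldl (st := fun s a => [:: a; s; y; c])) => // -[] s a;
  apply: within_push.
Qed.

Lemma within_pmove20 m x y c :
  within (pmove r2 r0) [:: m; x; y; c] (2 * size y).+1 [:: catrev y m; x; [::]; c].
Proof.
rewrite -foldl_cons.
by apply: (within_while_foldl (st := fun s a => [:: a; x; s; c])) => // -[] s a;
  apply: within_push.
Qed.

Lemma within_pmove21 m x y c :
  within (pmove r2 r1) [:: m; x; y; c] (2 * size y).+1 [:: m; catrev y x; [::]; c].
Proof.
rewrite -foldl_cons.
by apply: (within_while_foldl (st := fun s a => [:: m; a; s; c])) => // -[] s a;
  apply: within_push.
Qed.

Lemma within_pmove01 m x y c :
  within (pmove r0 r1) [:: m; x; y; c] (2 * size m).+1 [:: [::]; catrev m x; y; c].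
Proof.
rewrite -foldl_cons.
by apply: (within_while_foldl (st := fun s a => [:: s; a; y; c])) => // -[] s a;
  apply: within_push.
Qed.

Lemma within_clear1 m x y c :
  within (pwhile skip skip r1) [:: m; x; y; c] (size x).+1 [:: m; [::]; y; c].
Proof.
have := @within_while_foldl unit (fun s _ => [:: m; s; y; c]) r1 skip skip 0
  (fun a _ => a) x tt.
rewrite mul1n; apply=> // -[] s a; exact: within_skip.
Qed.

(* The fourth stack counts, in unary, the trees that remain to be read. *)
Definition take_loop (b : bool) : prog :=
  let j := if b then r1 else r2 in
  pwhile skip (pcase skip (push j false) r0
    (pseq (push j true) (pseq (push r3 true) (push r3 true)))) r3.

Definition ptake (b : bool) : prog := pseq (push r3 true) (take_loop b).

(** The stack called [x] is always the one that receives the tree, so one statement covers both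
    targets. *)
Definition swapped (b : bool) m x y c : stacks :=
  if b then [:: m; x; y; c] else [:: m; y; x; c].

(** An arbitrary continuation is built in because the loop does not stop between two subtrees: a
    node replaces one pending tree by two, and the two induction hypotheses are chained. *)
Lemma within_take_loop b t m x y c n S :
  within (take_loop b) (swapped b m (catrev (ser t) x) y c) n S ->
  within (take_loop b) (swapped b (ser t ++ m) x y (true :: c))
    (5 * tree_size t + n) S.
Proof.
elim: t m x y c n S => [|t1 IH1 t2 IH2] m x y c n S rS.
  case: b rS => rS.
    apply: (@within_leq _ _ (2 + n).+1); first by rewrite /tree_size /=; lia.
    apply: (within_while (b := true) (s := c)) rS => //.
    by apply: within_case => /=; apply: within_push.
  apply: (@within_leq _ _ (2 + n).+1); first by rewrite /tree_size /=; lia.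
  apply: (within_while (b := true) (s := c)) rS => //.
  by apply: within_case => /=; apply: within_push.
apply: (@within_leq _ _ (4 + (5 * tree_size t1 + (5 * tree_size t2 + n))).+1).
  by rewrite tree_size_Node; lia.
have {}rS : within (take_loop b)
    (swapped b (ser t1 ++ ser t2 ++ m) (true :: x) y [:: true, true & c])
    (5 * tree_size t1 + (5 * tree_size t2 + n)) S.
  apply/IH1/IH2; move: rS.
  by rewrite /= !catrevE rev_cat -!catA.
case: b rS {IH1 IH2} => rS.
  rewrite /= -catA; apply: (within_while (b := true) (s := c)) rS => //.
  apply: within_case; apply: (@within_seq _ _ _ 1 _ 2).
    exact: within_push.
  by apply: (@within_seq _ _ _ 1 _ 1); apply: within_push.
rewrite /= -catA; apply: (within_while (b := true) (s := c)) rS => //.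
apply: within_case; apply: (@within_seq _ _ _ 1 _ 2).
  exact: within_push.
by apply: (@within_seq _ _ _ 1 _ 1); apply: within_push.
Qed.

Lemma within_take b t m x y :
  within (ptake b) (swapped b (ser t ++ m) x y [::]) (5 * tree_size t + 2)
    (swapped b m (catrev (ser t) x) y [::]).
Proof.
have -> : 5 * tree_size t + 2 = 1 + (5 * tree_size t + 1) by lia.
apply: within_seq (within_take_loop (c := [::]) _); first by case: b; apply: within_push.
by apply: within_while0; case: b.
Qed.

Definition pdrop := pseq (ptake true) (pwhile skip skip r1).

Definition main (s : seq bool) : stacks := [:: s; [::]; [::]; [::]].

Lemma within_drop t m :
  within pdrop (main (ser t ++ m)) (6 * tree_size t + 3) (main m).
Proof.
apply: within_leq (within_seq (within_take true t m [::] [::]) (within_clear1 _ _ _ _)).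
rewrite size_catrev /tree_size /=; lia.
Qed.

(** Pouring reverses. The tree is reversed onto the second stack and poured from there onto the
    first and the third at once; the copy on the third returns by way of the second, which restores
    its order. *)
Definition pdup :=
  pseq (ptake true)
    (pseq (pwhile (pseq (push r0 false) (push r2 false))
                  (pseq (push r0 true) (push r2 true)) r1)
      (pseq (pmove r2 r1) (pmove r1 r0))).

Lemma within_dup t m :
  within pdup (main (ser t ++ m)) (12 * tree_size t + 5) (main (ser t ++ ser t ++ m)).
Proof.
apply: (@within_leq _ _ ((5 * tree_size t + 2) +
  ((3 * tree_size t).+1 + ((2 * tree_size t).+1 + (2 * tree_size t).+1)))); first by lia.
apply: within_seq (within_take true t m [::] [::]) _.
have sz : size (catrev (ser t) [::]) = tree_size t by rewrite size_catrev addn0.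
apply: (@within_seq _ _ _ _ [:: ser t ++ m; [::]; ser t; [::]]).
  have := @within_while_foldl _ (fun s a => [:: a.1; s; a.2; [::]]) r1
    (pseq (push r0 false) (push r2 false)) (pseq (push r0 true) (push r2 true)) 2
    (fun a b => (b :: a.1, b :: a.2)) (catrev (ser t) [::]) (m, [::]).
  rewrite sz; have -> s a :
    foldl (fun a b => (b :: a.1, b :: a.2)) a s = (catrev s a.1, catrev s a.2).
    by elim: s a => [|b s IH] [u v] //=; rewrite IH.
  rewrite /= !catrev_catrev cats0; apply=> // -[] s a;
    by apply: (@within_seq _ _ _ 1 _ 1); apply: within_push.
apply: within_seq (within_pmove21 _ _ _ _) _.
rewrite -sz -(catrev_catrev (ser t) (ser t ++ m)); exact: within_pmove10.
Qed.

Definition pswap :=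
  pseq (ptake true) (pseq (ptake false) (pseq (pmove r1 r0) (pmove r2 r0))).

Lemma within_swap t u m :
  within pswap (main (ser t ++ ser u ++ m)) (7 * (tree_size t + tree_size u) + 6)
    (main (ser u ++ ser t ++ m)).
Proof.
apply: (@within_leq _ _ ((5 * tree_size t + 2) + ((5 * tree_size u + 2) +
  ((2 * tree_size t).+1 + (2 * tree_size u).+1)))); first by lia.
have sz v : size (catrev (ser v) [::]) = tree_size v by rewrite size_catrev addn0.
apply: within_seq (within_take true t (ser u ++ m) [::] [::]) _.
apply: within_seq (within_take false u m [::] _) _.
rewrite -!sz -(catrev_catrev (ser t)) -(catrev_catrev (ser u)).
by apply: within_seq (within_pmove10 _ _ _ _) (within_pmove20 _ _ _ _).
Qed.

Fixpoint ppushes (s : seq bool) : prog :=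
  if s is b :: s then pseq (ppushes s) (push r0 b) else skip.

Lemma within_pushes s m S : within (ppushes s) (m :: S) (size s) ((s ++ m) :: S).
Proof.
elim: s => [|b s IH] /=; first exact: within_skip.
by rewrite -[(size s).+1]addn1; apply: within_seq IH _; apply: within_push.
Qed.

Definition ppop : prog := pcase skip skip r0 skip.

Lemma within_pop b m S : within ppop ((b :: m) :: S) 1 (m :: S).
Proof. by apply: within_case; case: b; apply: within_skip. Qed.

(** Differences are counted in unary on the fourth stack instead of stopping at the first one: both
    trees have to be drained anyway, since auxiliary stacks must end empty. *)
Definition peqtest : prog :=
  pseq (ptake true) (pseq (ptake false)
   (pseq (pwhile (pcase (push r3 true) skip r2 (push r3 true))
                 (pcase (push r3 true) (push r3 true) r2 skip) r1)
   (pseq (pwhile (push r3 true) (push r3 true) r2)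
         (pseq (pcase (ppushes (ser (Node Leaf Leaf))) (ppushes (ser Leaf)) r3
                      (ppushes (ser Leaf)))
               (pwhile skip skip r3))))).

Fixpoint mismatches (x y : seq bool) : nat :=
  match x, y with
  | a :: x, b :: y => (a != b) + mismatches x y
  | [::], _ => size y
  | _, [::] => size x
  end.

Lemma mismatches0 x y : (mismatches x y == 0) = (x == y).
Proof.
elim: x y => [|a x IH] [|b y] //=.
by rewrite addn_eq0 IH eqseq_cons; case: (a == b).
Qed.

Lemma mismatches_leq x y : mismatches x y <= size x + size y.
Proof.
elim: x y => [|a x IH] [|b y] //=; first by rewrite addn0.
by have := IH y; case: (a == b) => /=; lia.
Qed.

Lemma within_eqtest t u m :
  within peqtest (main (ser t ++ ser u ++ m)) (16 * (tree_size t + tree_size u) + 16)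
    (main (ser (if ser t == ser u then Node Leaf Leaf else Leaf) ++ m)).
Proof.
apply: (@within_leq _ _ ((5 * tree_size t + 2) + ((5 * tree_size u + 2) +
  ((3 * tree_size t).+1 + ((2 * tree_size u).+1 + (4 + (tree_size t + tree_size u).+1))))));
  first by lia.
have sz v : size (catrev (ser v) [::]) = tree_size v by rewrite size_catrev addn0.
apply: within_seq (within_take true t (ser u ++ m) [::] [::]) _.
apply: within_seq (within_take false u m [::] _) _.
have -> : (ser t == ser u) = (catrev (ser t) [::] == catrev (ser u) [::]).
  by apply/eqP/eqP=> [-> //|/(congr1 rev)]; rewrite /= !revK.
rewrite -!sz; move: (catrev _ _) (catrev _ _) => x y /=.
pose loop1 s (a : seq bool * seq bool) := [:: m; s; a.1; a.2].
pose g (a : seq bool * seq bool) b := (behead a.1,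
  if a.1 is c :: _ then (if b == c then a.2 else true :: a.2) else true :: a.2).
apply: within_seq.
  apply: (@within_while_foldl _ loop1 r1 _ _ 2 g x (y, [::])) => //.
  move=> b s [a a'] /=; case: b; apply: within_case; rewrite /loop1 /g /=;
  by case: a => [|[] a] /=; (exact: within_push) || (apply: within_leq (within_skip _)).
set a := foldl _ _ _; pose loop2 s a := [:: m; [::]; s; a].
apply: within_seq.
  apply: (@within_leq _ _ (2 * size a.1).+1).
    rewrite ltnS leq_mul2l /= /a -[size y]/(size (y, @nil bool).1).
    elim: (x) (_, _) => //= b s IH a'.
    by apply: leq_trans (IH _) _; rewrite size_behead leq_pred.
  apply: (@within_while_foldl _ loop2 r2 _ _ 1 (fun a _ => true :: a)) => //.
  by move=> b s a'; case: b; apply: within_push.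
set c := foldl _ _ _.
have cE : c = nseq (mismatches x y) true.
  rewrite /c /a -[nseq _ _]cats0.
  have nseqS n e : nseq n true ++ true :: e = nseq n.+1 true ++ e.
    by elim: n => //= n ->.
  elim: x y [::] {a c} => [|b x IH] [|d y] e //=.
  - by elim: y e => [|b' y IH] e //=; rewrite IH nseqS.
  - by rewrite IH nseqS; case: x {IH}.
  - by rewrite IH; case: (b == d) => //=; rewrite nseqS.
apply: (@within_leq _ _ (4 + (size x + size y).+1)) => //.
have : size c <= size x + size y by rewrite cE size_nseq mismatches_leq.
rewrite -mismatches0 /loop2 cE size_nseq.
case: (mismatches x y) => [|n] /= le_n.
  apply: within_seq; first by apply: within_case; exact: (within_pushes [:: true; false; false] _ _).
  by apply: within_leq (within_while0 _ _ _).
apply: within_seq.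
  by apply: within_case; apply: within_leq (within_pushes [:: false] _ _).
have := @within_while_foldl unit (fun s _ => [:: false :: m; [::]; [::]; s]) r3 skip skip 0
  (fun a _ => a) (nseq n true) tt.
rewrite mul1n size_nseq => H; apply: within_leq (H _ _) => //; first by lia.
by case=> *; apply: within_skip.
Qed.

(** * Polynomial-time functions *)

(** Injectivity is what lets a comparison of codes decide equality of values. *)
Class Enc (A : Type) := { code : A -> tree; code_inj : injective code }.

Instance unit_Enc : Enc unit.
Proof. by exists (fun _ => Leaf) => -[] []. Defined.

Instance bool_Enc : Enc bool.
Proof. by exists (fun b => if b then Node Leaf Leaf else Leaf) => -[] []. Defined.

Instance prod_Enc A B (eA : Enc A) (eB : Enc B) : Enc (A * B).
Proof.
exists (fun p => Node (code p.1) (code p.2)) => -[a b] [a' b'] /= [].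
by move=> /(@code_inj A eA) -> /(@code_inj B eB) ->.
Defined.

Instance seq_Enc A (eA : Enc A) : Enc (seq A).
Proof.
exists (foldr (fun a t => Node (code a) t) Leaf).
by elim=> [|a s IH] [|a' s'] //= [/(@code_inj A eA) -> /IH ->].
Defined.

(** Unary, with the code of a list of units. Binary numbers are handled as lists of bits. *)
Instance nat_Enc : Enc nat.
Proof.
exists (fun n => iter n (Node Leaf) Leaf).
by elim=> [|m IH] [|n] //= [/IH ->].
Defined.

Definition sz A {eA : Enc A} (a : A) := tree_size (code a).

Lemma sz_pair A B {eA : Enc A} {eB : Enc B} (p : A * B) :
  sz p = (sz p.1 + sz p.2).+1.
Proof. by rewrite /sz tree_size_Node. Qed.

Lemma sz_cons A {eA : Enc A} (a : A) s : sz (a :: s) = (sz a + sz s).+1.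
Proof. by rewrite /sz tree_size_Node. Qed.

Lemma sz_nil A {eA : Enc A} : sz (@nil A) = 1. Proof. by []. Qed.

Lemma sz_nat n : sz n = n.*2.+1.
Proof.
elim: n => // n IH.
by rewrite -[LHS]/(tree_size (Node Leaf (@code _ nat_Enc n))) tree_size_Node
  -/(@sz _ nat_Enc n) IH.
Qed.

Lemma sz_bool (b : bool) : 0 < sz b <= 3. Proof. by case: b. Qed.

Lemma sz_gt0 A {eA : Enc A} (a : A) : 0 < sz a. Proof. exact: tree_size_gt0. Qed.

Lemma sz_cat A {eA : Enc A} (s t : seq A) : (sz (s ++ t)).+1 = sz s + sz t.
Proof. by elim: s => [|a s IH] /=; rewrite ?sz_cons ?sz_nil // -addSn; lia. Qed.

Lemma sz_rev A {eA : Enc A} (s : seq A) : sz (rev s) = sz s.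
Proof.
elim: s => //= a s IH; rewrite rev_cons -cats1; have := @sz_cat A eA (rev s) [:: a].
by rewrite !sz_cons sz_nil IH; lia.
Qed.

Lemma size_sz A {eA : Enc A} (s : seq A) : size s < sz s.
Proof. elim: s => //= a s IH; rewrite sz_cons; have := @sz_gt0 A eA a; lia. Qed.

Lemma sz_bits (s : seq bool) : sz s <= 4 * size s + 1.
Proof. elim: s => //= b s IH; rewrite sz_cons; have := sz_bool b; lia. Qed.

Section Bounds.

Context {X : Type} {eX : Enc X}.

Definition pbounded (b : X -> nat) :=
  exists p : {poly nat}, forall x, b x <= p.[sz x]%R.

(** Natural coefficients make all bounds monotone, so they can be composed. *)
Lemma horner_nat_mono (p : {poly nat}) m n : m <= n -> p.[m]%R <= p.[n]%R.
Proof.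
move=> le_mn; elim/poly_ind: p => [|p c IH]; first by rewrite !hornerE.
by rewrite !hornerE leq_add2r leq_mul.
Qed.

Lemma pb_const n : pbounded (fun _ => n).
Proof. by exists n%:P%R => x; rewrite hornerC. Qed.

Lemma pb_sz : pbounded (fun x => sz x).
Proof. by exists 'X%R => x; rewrite hornerX. Qed.

Lemma pb_leq b b' : (forall x, b x <= b' x) -> pbounded b' -> pbounded b.
Proof. by move=> le_b [p pb]; exists p => x; apply: leq_trans (le_b x) _. Qed.

Lemma pb_add b b' : pbounded b -> pbounded b' -> pbounded (fun x => b x + b' x).
Proof. by case=> p pb [q qb]; exists (p + q)%R => x; rewrite hornerD leq_add. Qed.

Lemma pb_mul b b' : pbounded b -> pbounded b' -> pbounded (fun x => b x * b' x).
Proof. by case=> p pb [q qb]; exists (p * q)%R => x; rewrite hornerM leq_mul. Qed.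

Lemma pb_horner p b : pbounded b -> pbounded (fun x => p.[b x]%R).
Proof.
case=> q qb; exists (p \Po q)%R => x; rewrite horner_comp.
exact: horner_nat_mono.
Qed.

End Bounds.

Lemma pb_comp X Y {eX : Enc X} {eY : Enc Y} (g : X -> Y) b :
  pbounded (fun x => sz (g x)) -> pbounded b -> pbounded (fun x => b (g x)).
Proof.
by move=> gb [p pb]; apply: pb_leq (pb_horner p gb) => x.
Qed.

(* The rest [m] of the stack is left alone, so that programs compose. *)
Definition PT A B {eA : Enc A} {eB : Enc B} (f : A -> B) :=
  exists P b, pbounded b /\ forall x m,
    within P (main (ser (code x) ++ m)) (b x) (main (ser (code (f x)) ++ m)).

Lemma PT_sz A B {eA : Enc A} {eB : Enc B} (f : A -> B) :
  PT f -> pbounded (fun x => sz (f x)).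
Proof.
case=> P [b [pb Pf]]; apply: pb_leq (pb_add pb_sz pb) => x.
by have := within_size (Pf x [::]); rewrite /= !cats0.
Qed.

Ltac pb := repeat first
  [ assumption | apply: pb_sz | apply: pb_const
  | apply: pb_add | apply: pb_mul | apply: pb_horner
  | match goal with H : PT ?f |- _ => exact (PT_sz H) end ].

Section Closure.

Context {X A B : Type} {eX : Enc X} {eA : Enc A} {eB : Enc B}.

Lemma PT_cast (f : A -> B) : (forall x, code (f x) = code x) -> PT f.
Proof.
move=> fE; exists skip, (fun _ => 0); split; first exact: pb_const.
by move=> x m; rewrite fE; apply: within_skip.
Qed.

Lemma PT_comp (g : A -> B) (f : X -> A) : PT g -> PT f -> PT (fun x => g (f x)).
Proof.
move=> [Q [c [pc Qg]]] Pf; have szf := PT_sz Pf; case: Pf => P [b [pb Pf]].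
exists (pseq P Q), (fun x => b x + c (f x)); split.
  by apply: pb_add => //; apply: pb_comp.
by move=> x m; apply: within_seq.
Qed.

Lemma PT_const (c : A) : PT (fun _ : X => c).
Proof.
exists (pseq pdrop (ppushes (ser (code c)))), (fun x => 6 * sz x + 3 + sz c).
split; first by pb.
by move=> x m; apply: within_seq (within_drop _ _) (within_pushes _ _ _).
Qed.

Lemma PT_pair (f : X -> A) (g : X -> B) : PT f -> PT g -> PT (fun x => (f x, g x)).
Proof.
move=> Pf Pg; have szf := PT_sz Pf; have szg := PT_sz Pg.
case: Pf Pg => P [b [pb Pf]] [Q [c [pc Qg]]].
exists (pseq pdup (pseq Q (pseq pswap (pseq P (push r0 true))))),
  (fun x => 12 * sz x + 5 + (c x + (7 * (sz (g x) + sz x) + 6 + (b x + 1)))).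
split; first by pb.
move=> x m; apply: within_seq (within_dup _ _) _.
apply: within_seq (Qg _ _) _; apply: within_seq (within_swap _ _ _) _.
by apply: within_seq (Pf _ _) _; rewrite /= -catA; apply: within_push.
Qed.

End Closure.

Section DataClosure.

Context {X A B : Type} {eX : Enc X} {eA : Enc A} {eB : Enc B}.

Lemma PT_fst (f : X -> A * B) : PT f -> PT (fun x => (f x).1).
Proof.
apply: PT_comp; exists (pseq ppop (pseq pswap pdrop)),
  (fun x => 1 + ((7 * (sz x + sz x) + 6) + (6 * sz x + 3))).
split; first by pb.
move=> [a b] m; rewrite /= -catA; apply: within_seq (within_pop _ _ _) _.
apply: within_seq.
  apply: within_leq (within_swap _ _ _).
  by rewrite sz_pair /= /sz; lia.
by apply: within_leq (within_drop _ _); rewrite sz_pair /= /sz; lia.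
Qed.

Lemma PT_snd (f : X -> A * B) : PT f -> PT (fun x => (f x).2).
Proof.
apply: PT_comp; exists (pseq ppop pdrop), (fun x => 1 + (6 * sz x + 3)).
split; first by pb.
move=> [a b] m; rewrite /= -catA; apply: within_seq (within_pop _ _ _) _.
by apply: within_leq (within_drop _ _); rewrite sz_pair /= /sz; lia.
Qed.

(** A nonempty list has the same code as the pair of its head and tail. *)
Lemma PT_cons (f : X -> A) (g : X -> seq A) :
  PT f -> PT g -> PT (fun x => f x :: g x).
Proof.
move=> Pf Pg; have [P [b [pb PP]]] := PT_pair Pf Pg.
by exists P, b.
Qed.

Lemma PT_if (c : X -> bool) (f g : X -> A) :
  PT c -> PT f -> PT g -> PT (fun x => if c x then f x else g x).
Proof.
case=> R [d [pd Rd]] [P [b [pb Pf]]] [Q [e [pe Qg]]].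
(* [true] is a node with two leaves: after the branch has popped its first bit, two bits of it still
   lie above the argument. *)
exists (pseq pdup (pseq R (pcase skip Q r0 (pseq ppop (pseq ppop P))))),
  (fun x => 12 * sz x + 5 + (d x + (e x + (1 + (1 + b x)) + 1))).
split; first by pb.
move=> x m; apply: within_seq (within_dup _ _) _; apply: within_seq (Rd _ _) _.
rewrite addn1; apply: within_case; case: (c x) => /=.
  apply: within_leq (leq_addl _ _) _.
  by do 2![apply: within_seq (within_pop _ _ _) _]; apply: Pf.
exact: within_leq (leq_addr _ _) (Qg _ _).
Qed.

Lemma PT_case (l : X -> seq B) (f : X -> A) (g : X -> B -> seq B -> A) :
  PT l -> PT f -> PT (fun p : X * (B * seq B) => g p.1 p.2.1 p.2.2) ->
  PT (fun x => if l x is b :: s then g x b s else f x).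
Proof.
move=> Pl; have szl := PT_sz Pl; case: Pl => R [d [pd Rd]].
case=> [P [b [pb Pf]]] [Q [e [pe Qg]]].
case: pe => p pe.
(* The branch pops the first bit of a nonempty list. Pushing it back yields the pair of head and
   tail, which has the same code; after the swap, one more 1 pairs it with [x]. *)
exists (pseq pdup (pseq R (pcase skip P r0
   (pseq (push r0 true) (pseq pswap (pseq (push r0 true) Q)))))),
  (fun x => 12 * sz x + 5 + (d x + (b x + (1 + (7 * (sz (l x) + sz x) + 6 +
    (1 + p.[(sz (l x) + sz x + 1)%N]%R))) + 1))).
split; first by pb.
move=> x m; apply: within_seq (within_dup _ _) _; apply: within_seq (Rd _ _) _.
rewrite addn1; case E: (l x) => [|y s].
  by apply: within_case; exact: within_leq (leq_addr _ _) (Pf _ _).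
pose r := ser (@code _ eB y) ++ ser (@code _ (seq_Enc eB) s) ++ ser (@code _ eX x) ++ m.
have -> : ser (code (y :: s)) ++ ser (code x) ++ m = true :: r by rewrite /= -catA.
apply: within_case; apply: within_leq (leq_addl _ _) _.
apply: (@within_seq _ _ _ _ (main (true :: r))); first exact: within_push.
have := within_swap (@code _ (prod_Enc eB (seq_Enc eB)) (y, s)) (@code _ eX x) m.
rewrite -[ser (code (y, s))]/(true :: ser (@code _ eB y) ++ ser (@code _ (seq_Enc eB) s)).
rewrite /= -!catA -/r => H; apply: within_seq; first by exact: H.
apply: within_seq; first exact: within_push.
have := Qg (x, (y, s)) m; rewrite /= -!catA /= -!catA => {}H.
apply: within_leq H; apply: leq_trans (pe _) _; apply: horner_nat_mono.
by rewrite sz_pair addn1 ltnS addnC.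
Qed.

Lemma PT_eqcode (f g : X -> A) :
  PT f -> PT g -> PT (fun x => ser (code (f x)) == ser (code (g x))).
Proof.
move=> Pf Pg; have [P [b [pb PP]]] := PT_pair Pf Pg.
have szf := PT_sz Pf; have szg := PT_sz Pg.
exists (pseq P (pseq ppop peqtest)),
  (fun x => b x + (1 + (16 * (sz (f x) + sz (g x)) + 16))).
split; first by pb.
move=> x m; apply: within_seq (PP _ _) _.
have -> : ser (code (f x, g x)) ++ m =
  true :: ser (code (f x)) ++ ser (code (g x)) ++ m by rewrite /= -catA.
apply: within_seq (within_pop _ _ _) _.
have := within_eqtest (@code _ eA (f x)) (@code _ eA (g x)) m.
by case: eqP.
Qed.

(* The loop flag on the fourth stack is popped before the body runs. *)
Definition piter (P : prog) : prog :=
  pseq (push r3 true)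
    (pwhile skip (pcase skip skip r0
      (pseq pdrop (pseq pswap (pseq P (pseq pswap (push r3 true)))))) r3).

(** The list is only a clock. A bound on the intermediate results has to be assumed, since a body
    that doubles the size of its argument is polynomial while its iterates are not. *)
Lemma PT_iter_size (f : B -> B) (g : X -> seq A * B) b :
  PT f -> PT g -> pbounded b ->
  (forall x i, i <= size (g x).1 -> sz (iter i f (g x).2) <= b x) ->
  PT (fun x => iter (size (g x).1) f (g x).2).
Proof.
case=> P [c [[p cp] Pf]] Pg pb fb; have szg := PT_sz Pg.
case: Pg => Q [d [pd Qg]].
pose N x := @sz _ (prod_Enc (seq_Enc eA) eB) (g x).
pose K x := 6 * N x + 3 + (7 * (N x + b x) + 6 + (p.[b x]%R +
   (7 * (b x + N x) + 6 + 1))).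
exists (pseq Q (pseq ppop (piter P))),
  (fun x => d x + (1 + (1 + ((K x + 2) * N x + 3)))).
split; first by rewrite /K /N; pb.
move=> x m; apply: within_seq (Qg _ _) _; case E: (g x) => [l s] /=; rewrite -catA.
apply: within_seq (within_pop _ _ _) _.
apply: within_seq; first exact: within_push.
rewrite /= -[foldr _ _ l]/(@code _ (seq_Enc eA) l).
have szK i : i <= size l -> sz (iter i f s) <= b x by move: (fb x i); rewrite E.
have [szl0 szl] : size l < N x /\ sz l <= N x.
  by rewrite /N E sz_pair /=; have := @size_sz _ eA l; lia.
apply: (@within_leq _ _ ((K x + 2) * size l + 3)).
  by rewrite leq_add2r leq_mul2l (ltnW szl0) orbT.
clear E szl0.
elim: l s szl szK => [|a l IH] s szl szK.
  apply: (@within_leq _ _ (1 + 1).+1); first by lia.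
  apply: (within_while (b := true) (s := [::])) => //.
    by apply: within_case; apply: within_leq (within_skip _).
  exact: within_while0.
apply: (@within_leq _ _ ((K x).+1 + ((K x + 2) * size l + 3)).+1).
  by rewrite /= mulnS; lia.
have [sza szl'] : sz a <= N x /\ sz l <= N x.
  by move: szl; rewrite sz_cons; lia.
apply: (within_while (b := true) (s := [::])) => //; last first.
  rewrite iterSr; apply: IH => // i le_i; rewrite -iterSr; exact: szK.
apply: within_case => /=.
have := szK 0 isT; have := szK 1 isT; rewrite /= => s1 s0.
rewrite -!catA; apply: within_seq.
  by apply: within_leq (within_drop _ _); rewrite leq_add2r leq_mul2l /= -/(sz a).
apply: within_seq.
  by apply: within_leq (within_swap _ _ _); rewrite leq_add2r leq_mul2l /= leq_add.
apply: within_seq.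
  by apply: within_leq (Pf _ _); apply: leq_trans (cp _) (horner_nat_mono _ _).
apply: within_seq.
  by apply: within_leq (within_swap _ _ _); rewrite leq_add2r leq_mul2l /= leq_add.
exact: within_push.
Qed.

End DataClosure.

Lemma PT_id X {eX : Enc X} : PT (fun x : X => x).
Proof. exact: PT_cast. Qed.

Lemma PT_ext X A {eX : Enc X} {eA : Enc A} (f g : X -> A) :
  f =1 g -> PT f -> PT g.
Proof.
move=> fg [P [b [pb Pf]]]; exists P, b; split=> // x m; rewrite -fg; exact: Pf.
Qed.

Section Application.

Context {X A B C D : Type} {eX : Enc X} {eA : Enc A} {eB : Enc B} {eC : Enc C}
  {eD : Enc D}.

Lemma PT_app2 (F : A -> B -> D) f g :
  PT (fun p : A * B => F p.1 p.2) -> PT f -> PT g ->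
  PT (fun x : X => F (f x) (g x)).
Proof. by move=> PF Pf Pg; exact: PT_comp PF (PT_pair Pf Pg). Qed.

Lemma PT_app3 (F : A -> B -> C -> D) f g h :
  PT (fun p : A * (B * C) => F p.1 p.2.1 p.2.2) -> PT f -> PT g -> PT h ->
  PT (fun x : X => F (f x) (g x) (h x)).
Proof. by move=> PF Pf Pg Ph; exact: PT_comp PF (PT_pair Pf (PT_pair Pg Ph)). Qed.

End Application.

(* [pt_more] and [pt_user] are redefined as closure lemmas become available. *)
Ltac pt_user := fail.
Ltac pt_more := fail.
Ltac pt_step :=
  first [ assumption | lazymatch goal with
  | |- PT (fun _ => ?c) => apply (PT_const c)
  | |- PT (fun x => x) => apply PT_id
  | |- PT (fun x => (@?f x, @?g x)) => apply (PT_pair (f := f) (g := g))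
  | |- PT (fun x => (@?f x).1) => apply (PT_fst (f := f))
  | |- PT (fun x => (@?f x).2) => apply (PT_snd (f := f))
  | |- PT fst => apply (PT_fst (f := fun x => x))
  | |- PT snd => apply (PT_snd (f := fun x => x))
  | |- PT (fun x => @?f x :: @?g x) => apply (PT_cons (f := f) (g := g))
  | |- PT (fun x => match _ with _ => _ end) => first [ apply PT_if | apply PT_case ]
  | H : PT (fun p => ?F p.1 p.2.1 p.2.2)
    |- PT (fun x => ?F (@?f x) (@?g x) (@?h x)) =>
      apply (PT_app3 (f := f) (g := g) (h := h) H)
  | H : PT (fun p => ?F p.1 p.2) |- PT (fun x => ?F (@?f x) (@?g x)) =>
      apply (PT_app2 (f := f) (g := g) H)
  | H : PT ?F |- PT (fun x => ?F (@?f x)) => apply (PT_comp (f := f) H)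
  | |- _ => pt_more
  end ]; cbv beta.
Ltac pt := cbv beta; repeat pt_step.

Section Folds.

Context {X A S : Type} {eX : Enc X} {eA : Enc A} {eS : Enc S}.

Lemma PT_foldl (F : X -> S -> A -> S) (l : X -> seq A) (s0 : X -> S) b :
  PT (fun p : X * (S * A) => F p.1 p.2.1 p.2.2) -> PT l -> PT s0 -> pbounded b ->
  (forall x i, i <= size (l x) -> sz (foldl (F x) (s0 x) (take i (l x))) <= b x) ->
  PT (fun x => foldl (F x) (s0 x) (l x)).
Proof.
move=> PF Pl Ps pb Fb.
(* The iterated function must be closed, so the parameter and the unread items travel with the
   state. *)
pose step (p : X * (S * seq A)) : X * (S * seq A) :=
  if p.2.2 is a :: l then (p.1, (F p.1 p.2.1 a, l)) else p.
have stepE x s t i :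
    iter i step (x, (s, t)) = (x, (foldl (F x) s (take i t), drop i t)).
  elim: i s t => [|i IH] s t; first by rewrite take0 drop0.
  by rewrite iterSr; case: t => [|a t] //=; rewrite ?IH //; elim: i {IH} => //= i ->.
pose N x := @sz _ eX x + (b x + @sz _ (seq_Enc eA) (l x)) + 2.
have Pg : PT (fun x => (l x, (x, (s0 x, l x)))) by pt.
have Pstep : PT step.
  rewrite /step; pt.
have pN : pbounded N by rewrite /N; pb.
apply: PT_ext (PT_fst (PT_snd (PT_iter_size Pstep Pg pN _))) => x /=.
  by rewrite stepE take_size.
move=> i le_i /=; rewrite stepE !sz_pair /=.
have := Fb x _ le_i; rewrite /N.
have := @sz_cat _ eA (take i (l x)) (drop i (l x)); rewrite cat_take_drop.
have := @sz_gt0 _ (seq_Enc eA) (take i (l x)); lia.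
Qed.

(** Meant for binary arithmetic. A 1 has a larger code than a 0, so a single operation may enlarge
    [sz] by a constant factor, and iterating that estimate would be exponential. The length [mu]
    grows additively and controls [sz] up to constants. *)
Lemma PT_foldl_measure (mu : S -> nat) (F : X -> S -> A -> S) (l : X -> seq A)
    (s0 : X -> S) b :
  PT (fun p : X * (S * A) => F p.1 p.2.1 p.2.2) -> PT l -> PT s0 -> pbounded b ->
  (forall s, sz s <= 8 * mu s + 8) -> (forall s, mu s <= sz s) ->
  (forall x s a, sz a <= sz (l x) -> mu (F x s a) <= mu s + b x) ->
  PT (fun x => foldl (F x) (s0 x) (l x)).
Proof.
move=> PF Pl Ps pb szmu musz Fb.
have szl := PT_sz Pl; have szs := PT_sz Ps.
apply: (@PT_foldl F _ _
  (fun x => 8 * (sz (s0 x) + sz (l x) * b x) + 8)) => //; first by pb.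
move=> x i le_i; apply: leq_trans (szmu _) _; rewrite leq_add2r leq_mul2l /=.
apply: (@leq_trans (mu (s0 x) + i * b x)); last first.
  by rewrite leq_add // leq_mul2r (leq_trans le_i) ?orbT // ltnW // size_sz.
have: all (fun a => sz a <= sz (l x)) (take i (l x)).
  rewrite -[X in all _ X]cats0; move: (l x) => l'.
  have: sz l' <= sz l' by []. move: {2 3}(sz l') => n.
  elim: l' i {le_i} => [|a l' IH] [|i] //=; rewrite sz_cons => le_n.
  by rewrite IH ?andbT; have := @sz_gt0 _ eA a; have := @sz_gt0 _ (seq_Enc eA) l'; lia.
move: (take i _) (size_takel le_i) (s0 x) => t <-; elim: t => [|a t IH] s /=.
  by move=> _; rewrite leq_addr.
case/andP=> sza /IH{}IH; apply: leq_trans (IH _) _.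
by rewrite mulSn addnA leq_add2r Fb.
Qed.

Lemma PT_foldl_grow (F : X -> S -> A -> S) (l : X -> seq A) (s0 : X -> S) b :
  PT (fun p : X * (S * A) => F p.1 p.2.1 p.2.2) -> PT l -> PT s0 -> pbounded b ->
  (forall x s a, sz a <= sz (l x) -> sz (F x s a) <= sz s + b x) ->
  PT (fun x => foldl (F x) (s0 x) (l x)).
Proof.
move=> PF Pl Ps pb Fb; apply: (PT_foldl_measure (mu := fun s => sz s) (b := b)) => //.
by move=> s; lia.
Qed.

Lemma PT_foldl_fin (F : X -> S -> A -> S) (l : X -> seq A) (s0 : X -> S) n :
  (forall s : S, sz s <= n) ->
  PT (fun p : X * (S * A) => F p.1 p.2.1 p.2.2) -> PT l -> PT s0 ->
  PT (fun x => foldl (F x) (s0 x) (l x)).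
Proof. by move=> szS PF Pl Ps; apply: PT_foldl (pb_const n) _. Qed.

End Folds.

Lemma PT_rev X A {eX : Enc X} {eA : Enc A} (l : X -> seq A) :
  PT l -> PT (fun x => rev (l x)).
Proof.
move=> Pl; apply: (@PT_ext _ _ _ _ (fun x => foldl (fun s a => a :: s) [::] (l x))).
  by move=> x; rewrite foldl_cons.
have szl := PT_sz Pl.
apply: (PT_foldl_grow (b := fun x => sz (l x) + 1) (F := fun _ s a => a :: s)) => //.
- by pt.
- by pt.
- by pb.
- by move=> x s a; rewrite sz_cons; lia.
Qed.

Lemma PT_foldr_grow X A S {eX : Enc X} {eA : Enc A} {eS : Enc S}
    (F : X -> A -> S -> S) (l : X -> seq A) (s0 : X -> S) b :
  PT (fun p : X * (A * S) => F p.1 p.2.1 p.2.2) -> PT l -> PT s0 -> pbounded b ->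
  (forall x s a, sz a <= sz (l x) -> sz (F x a s) <= sz s + b x) ->
  PT (fun x => foldr (F x) (s0 x) (l x)).
Proof.
move=> PF Pl Ps pb Fb.
apply: (@PT_ext _ _ _ _ (fun x => foldl (fun s a => F x a s) (s0 x) (rev (l x)))).
  by move=> x; rewrite foldl_rev.
apply: (PT_foldl_grow (b := b) (F := fun x s a => F x a s)) => //.
- by pt.
- exact: PT_rev.
- by move=> x s a; rewrite sz_rev => /Fb.
Qed.

Lemma PT_cat X A {eX : Enc X} {eA : Enc A} (f g : X -> seq A) :
  PT f -> PT g -> PT (fun x => f x ++ g x).
Proof.
move=> Pf Pg; have szf := PT_sz Pf.
apply: (@PT_ext _ _ _ _ (fun x => foldr cons (g x) (f x))).
  by move=> x; elim: (f x) => //= a s ->.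
apply: (PT_foldr_grow (b := fun x => sz (f x) + 1) (F := fun _ => cons)) => //.
- by pt.
- by pb.
- by move=> x s a; rewrite sz_cons; lia.
Qed.

Lemma PT_map X A B {eX : Enc X} {eA : Enc A} {eB : Enc B} (F : X -> A -> B)
    (l : X -> seq A) :
  PT (fun p : X * A => F p.1 p.2) -> PT l -> PT (fun x => map (F x) (l x)).
Proof.
move=> PF Pl; have szl := PT_sz Pl; have [p Fp] := PT_sz PF.
apply: (@PT_ext _ _ _ _ (fun x => foldr (fun a s => F x a :: s) [::] (l x))).
  by move=> x; elim: (l x) => //= a s ->.
apply: (PT_foldr_grow (b := fun x => p.[(sz x + sz (l x) + 1)%N]%R + 1)
   (F := fun x a s => F x a :: s)) => //.
- by pt.
- by pt.
- by pb.
- move=> x s a sza; rewrite sz_cons.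
  rewrite -addSn [X in X <= _]addnC leq_add2l addn1 ltnS.
  apply: leq_trans (Fp (x, a)) _; apply: horner_nat_mono.
  by rewrite sz_pair /= addn1 ltnS leq_add2l.
Qed.

Lemma PT_filter X A {eX : Enc X} {eA : Enc A} (F : X -> A -> bool) (l : X -> seq A) :
  PT (fun p : X * A => F p.1 p.2) -> PT l -> PT (fun x => filter (F x) (l x)).
Proof.
move=> PF Pl; have szl := PT_sz Pl.
apply: (@PT_ext _ _ _ _
  (fun x => foldr (fun a s => if F x a then a :: s else s) [::] (l x))).
  by move=> x; elim: (l x) => //= a s ->.
apply: (PT_foldr_grow (b := fun x => sz (l x) + 1)
   (F := fun x a s => if F x a then a :: s else s)) => //.
- by pt.
- by pt.
- by pb.
- by move=> x s a; case: ifP; rewrite ?sz_cons; lia.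
Qed.

Lemma PT_flatten X A {eX : Enc X} {eA : Enc A} (l : X -> seq (seq A)) :
  PT l -> PT (fun x => flatten (l x)).
Proof.
move=> Pl; have szl := PT_sz Pl.
apply: (PT_foldr_grow (b := fun x => sz (l x)) (F := fun _ => cat)) => //.
- by apply: PT_cat; pt.
- by pt.
- move=> x s a; have := @sz_cat _ eA a s; lia.
Qed.

Lemma PT_has X A {eX : Enc X} {eA : Enc A} (F : X -> A -> bool) (l : X -> seq A) :
  PT (fun p : X * A => F p.1 p.2) -> PT l -> PT (fun x => has (F x) (l x)).
Proof.
move=> PF Pl.
apply: (@PT_ext _ _ _ _
  (fun x => foldl (fun c a => if c then true else F x a) false (l x))).
  move=> x; rewrite -[RHS]/(false || _); elim: (l x) false => [|a s IH] c /=.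
    by rewrite orbF.
  by rewrite IH orbA.
apply: (PT_foldl_fin (n := 3) (F := fun x c a => if c then true else F x a)) => //.
- by case.
- by pt.
- by pt.
Qed.

Lemma PT_neg X {eX : Enc X} (f : X -> bool) : PT f -> PT (fun x => ~~ f x).
Proof. by move=> Pf; rewrite /negb; pt. Qed.

Lemma PT_and X {eX : Enc X} (f g : X -> bool) : PT f -> PT g -> PT (fun x => f x && g x).
Proof. by move=> Pf Pg; rewrite /andb; pt. Qed.

Lemma PT_or X {eX : Enc X} (f g : X -> bool) : PT f -> PT g -> PT (fun x => f x || g x).
Proof. by move=> Pf Pg; rewrite /orb; pt. Qed.

Lemma PT_all X A {eX : Enc X} {eA : Enc A} (F : X -> A -> bool) (l : X -> seq A) :
  PT (fun p : X * A => F p.1 p.2) -> PT l -> PT (fun x => all (F x) (l x)).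
Proof.
move=> PF Pl; apply: (@PT_ext _ _ _ _ (fun x => ~~ has (fun a => ~~ F x a) (l x))).
  by move=> x; rewrite -all_predC; apply: eq_all => a /=; rewrite negbK.
by apply: PT_neg; apply: PT_has => //; apply: PT_neg; pt.
Qed.

(** The pair of [tt] and a number already has the code of the successor. *)
Lemma PT_succ X {eX : Enc X} (f : X -> nat) : PT f -> PT (fun x => (f x).+1).
Proof.
move=> Pf; apply: (@PT_comp _ _ _ _ _ _ (fun p : unit * nat => p.2.+1) (fun x => (tt, f x))).
  by apply: PT_cast => -[[] n].
by pt.
Qed.

Lemma PT_nseq X {eX : Enc X} (f : X -> nat) : PT f -> PT (fun x => nseq (f x) tt).
Proof. by apply: PT_comp; apply: PT_cast; elim=> //= n ->. Qed.

Lemma PT_size X A {eX : Enc X} {eA : Enc A} (l : X -> seq A) :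
  PT l -> PT (fun x => size (l x)).
Proof.
move=> Pl; have szl := PT_sz Pl.
apply: (@PT_ext _ _ _ _ (fun x => foldl (fun n _ => n.+1) 0 (l x))).
  move=> x; rewrite -[RHS]addn0; elim: (l x) 0 => //= a s IH n.
  by rewrite IH addnS.
apply: (PT_foldl_grow (b := fun _ => 2) (F := fun _ n _ => n.+1)) => //.
- by apply: PT_succ; pt.
- by pt.
- by pb.
- by move=> x s a _; rewrite !sz_nat; lia.
Qed.

Lemma PT_iter X A {eX : Enc X} {eA : Enc A} (F : X -> A -> A) (n : X -> nat)
    (s0 : X -> A) b :
  PT (fun p : X * A => F p.1 p.2) -> PT n -> PT s0 -> pbounded b ->
  (forall x i, i <= n x -> sz (iter i (F x) (s0 x)) <= b x) ->
  PT (fun x => iter (n x) (F x) (s0 x)).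
Proof.
move=> PF Pn Ps pb Fb.
have it x s k : foldl (fun s (_ : unit) => F x s) s (nseq k tt) = iter k (F x) s.
  by elim: k s => // k IH s; rewrite iterSr -IH.
apply: (@PT_ext _ _ _ _
  (fun x => foldl (fun s (_ : unit) => F x s) (s0 x) (nseq (n x) tt))).
  by move=> x; rewrite it.
apply: (PT_foldl (b := b) (F := fun x s _ => F x s)) => //.
- by pt.
- exact: PT_nseq.
- by move=> x i; rewrite size_nseq => le_i; rewrite take_nseq // it Fb.
Qed.

Lemma PT_addn X {eX : Enc X} (f g : X -> nat) : PT f -> PT g -> PT (fun x => f x + g x).
Proof.
move=> Pf Pg.
apply: (@PT_ext _ _ _ _ (fun x => size (nseq (f x) tt ++ nseq (g x) tt))).
  by move=> x; rewrite size_cat !size_nseq.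
by apply: PT_size; apply: PT_cat; apply: PT_nseq.
Qed.

Lemma PT_muln X {eX : Enc X} (f g : X -> nat) : PT f -> PT g -> PT (fun x => f x * g x).
Proof.
move=> Pf Pg.
apply: (@PT_ext _ _ _ _
  (fun x => size (flatten [seq nseq (g x) tt | _ <- nseq (f x) tt]))).
  move=> x; elim: (f x) => //= n IH.
  by rewrite size_cat size_nseq IH mulSn.
apply: PT_size; apply: PT_flatten.
apply: (PT_map (F := fun x _ => nseq (g x) tt)); last exact: PT_nseq.
by apply: PT_nseq; pt.
Qed.

Lemma PT_horner X {eX : Enc X} (p : {poly nat}) (f : X -> nat) :
  PT f -> PT (fun x => p.[f x]%R).
Proof.
move=> Pf; rewrite /horner; elim: (polyseq p) => [|c s IH] /=; first by pt.
by apply: PT_addn; [apply: PT_muln | pt].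
Qed.

Lemma PT_iota X {eX : Enc X} (f : X -> nat) : PT f -> PT (fun x => iota 0 (f x)).
Proof.
move=> Pf; have szf := PT_sz Pf.
have itE k : iter k (fun s => s ++ [:: size s]) [::] = iota 0 k.
  by elim: k => // k IH; rewrite iterS IH size_iota -[k.+1]addn1 iotaD.
apply: (@PT_ext _ _ _ _ (fun x => iter (f x) (fun s => s ++ [:: size s]) [::])).
  by move=> x; rewrite itE.
apply: (PT_iter (b := fun x => sz (f x) * (sz (f x) + 1) + 1)
  (F := fun _ s => s ++ [:: size s])) => //.
- apply: PT_cat; first by pt.
  by apply: PT_cons; [apply: PT_size|]; pt.
- by pt.
- by pb.
- move=> x i le_i; rewrite itE sz_nat.
  have: sz (iota 0 i) <= i * (i.*2.+2) + 1.
    have : forall m n, m + n <= i -> sz (iota m n) <= n * i.*2.+2 + 1.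
      move=> m n; elim: n m => //= n IH m le_mn.
      by have := IH m.+1; rewrite sz_cons sz_nat mulSn; lia.
    by apply.
  by move/leq_trans; apply; rewrite leq_add2r leq_mul //; lia.
Qed.


Lemma PT_eq X (A : eqType) {eX : Enc X} {eA : Enc A} (f g : X -> A) :
  PT f -> PT g -> PT (fun x => f x == g x).
Proof.
move=> Pf Pg; apply: PT_ext (PT_eqcode Pf Pg) => x.
apply/eqP/eqP => [|-> //]; rewrite -[ser _]cats0 -[RHS]cats0.
by case/ser_cat_inj => /(@code_inj A eA).
Qed.

Lemma PT_mem X (A : eqType) {eX : Enc X} {eA : Enc A} (a : X -> A) (l : X -> seq A) :
  PT a -> PT l -> PT (fun x => a x \in l x).
Proof.
move=> Pa Pl; apply: (@PT_ext _ _ _ _ (fun x => has (fun b => b == a x) (l x))).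
  by move=> x; rewrite -has_pred1.
apply: (PT_has (F := fun x b => b == a x)) => //.
by apply: PT_eq; pt.
Qed.

Lemma PT_undup X (A : eqType) {eX : Enc X} {eA : Enc A} (l : X -> seq A) :
  PT l -> PT (fun x => undup (l x)).
Proof.
move=> Pl; have szl := PT_sz Pl.
apply: (@PT_ext _ _ _ _
  (fun x => foldr (fun a s => if a \in s then s else a :: s) [::] (l x))).
  move=> x; elim: (l x) => //= a s ->; by rewrite mem_undup.
apply: (PT_foldr_grow (b := fun x => sz (l x) + 1)
  (F := fun _ a (s : seq A) => if a \in s then s else a :: s)) => //.
- by apply: PT_if; [apply: PT_mem| |]; pt.
- by pt.
- by pb.
- by move=> x s a; case: ifP; rewrite ?sz_cons; lia.
Qed.

Lemma PT_zip X A B {eX : Enc X} {eA : Enc A} {eB : Enc B}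
    (l : X -> seq A) (l' : X -> seq B) :
  PT l -> PT l' -> PT (fun x => zip (l x) (l' x)).
Proof.
move=> Pl Pl'; have szl := PT_sz Pl; have szl' := PT_sz Pl'.
pose step (p : seq B * seq (A * B)) a :=
  if p.1 is b :: s then (s, (a, b) :: p.2) else p.
have stepE s s' t : (foldl step (s', t) s).2 = catrev (zip s s') t.
  by elim: s s' t => [|a s IH] [|b s'] t //=; rewrite /step /= ?IH //; elim: s {IH}.
apply: (@PT_ext _ _ _ _ (fun x => rev (foldl step (l' x, [::]) (l x)).2)).
  by move=> x; rewrite stepE -/(rev _) revK.
apply/PT_rev/PT_snd.
apply: (PT_foldl_grow (b := fun x => sz (l x) + 3) (F := fun _ => step)) => //.
- by rewrite /step; pt.
- by pt.
- by pb.
- move=> x [[|b s] t] a sza; rewrite /step /=; first by lia.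
  by rewrite !sz_pair /= !sz_cons sz_pair /=; lia.
Qed.

Ltac pt_more ::=
  lazymatch goal with
  | |- PT (fun x => rev (@?l x)) => apply (PT_rev (l := l))
  | |- PT (fun x => @?f x ++ @?g x) => apply (PT_cat (f := f) (g := g))
  | |- PT (fun x => map (@?F x) (@?l x)) => apply (PT_map (F := F) (l := l))
  | |- PT (fun x => filter (@?F x) (@?l x)) => apply (PT_filter (F := F) (l := l))
  | |- PT (fun x => flatten (@?l x)) => apply (PT_flatten (l := l))
  | |- PT (fun x => has (@?F x) (@?l x)) => apply (PT_has (F := F) (l := l))
  | |- PT (fun x => all (@?F x) (@?l x)) => apply (PT_all (F := F) (l := l))
  | |- PT (fun x => size (@?l x)) => apply (PT_size (l := l))
  | |- PT (fun x => iota 0 (@?l x)) => apply (PT_iota (f := l))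
  | |- PT (fun x => ~~ @?f x) => apply (PT_neg (f := f))
  | |- PT (fun x => @?f x && @?g x) => apply (PT_and (f := f) (g := g))
  | |- PT (fun x => @?f x || @?g x) => apply (PT_or (f := f) (g := g))
  | |- PT (fun x => S (@?f x)) => apply (PT_succ (f := f))
  | |- PT (fun x => addn (@?f x) (@?g x)) => apply (PT_addn (f := f) (g := g))
  | |- PT (fun x => muln (@?f x) (@?g x)) => apply (PT_muln (f := f) (g := g))
  | |- PT (fun x => horner ?p (@?f x)) => apply (PT_horner p (f := f))
  | |- PT (fun x => @?f x == @?g x) => apply (PT_eq (f := f) (g := g))
  | |- PT (fun x => @?a x \in @?l x) => apply (PT_mem (a := a) (l := l))
  | |- PT (fun x => undup (@?l x)) => apply (PT_undup (l := l))
  | |- PT (fun x => zip (@?l x) (@?l' x)) => apply (PT_zip (l := l) (l' := l'))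
  | |- PT (fun x => behead (@?l x)) => rewrite /behead
  | |- PT (fun x => head (@?a x) (@?l x)) => rewrite /head
  | |- PT size => apply (PT_size (l := fun x => x))
  | |- PT rev => apply (PT_rev (l := fun x => x))
  | |- PT flatten => apply (PT_flatten (l := fun x => x))
  | |- _ => pt_user
  end.

(** The bit 1 becomes 1100 and the bit 0 becomes 10: a list cell followed by the code of the bit.
    The input is reversed first because the code is built from its end. *)
Definition pread : prog :=
  pseq (pmove r0 r1) (pseq (push r0 false)
    (pwhile (ppushes [:: true; false]) (ppushes [:: true; true; false; false]) r1)).

Lemma within_read x : within pread (main x) (7 * size x + 3) (main (ser (code x))).
Proof.
apply: (@within_leq _ _ ((2 * size x).+1 + (1 + (5 * size x).+1))); first by lia.
apply: within_seq (within_pmove01 _ _ _ _) _.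
apply: within_seq; first exact: within_push.
have := @within_while_foldl _ (fun s a => [:: a; s; [::]; [::]]) r1
  (ppushes [:: true; false]) (ppushes [:: true; true; false; false]) 4
  (fun a b => (if b then [:: true; true; false; false] else [:: true; false]) ++ a)
  (rev x) [:: false].
rewrite size_rev foldl_rev.
have -> : foldr (fun b a =>
    (if b then [:: true; true; false; false] else [:: true; false]) ++ a)
    [:: false] x = ser (code x).
  by elim: x => //= b x ->; case: b.
apply=> // -[] s a; first exact: (within_pushes [:: true; true; false; false]).
exact: within_leq (within_pushes [:: true; false] _ _).
Qed.

Definition pwrite : prog :=
  pseq (push r3 true) (pseq
    (pwhile skip (pcase skip skip r0
      (pcase skip (pseq (push r1 false) (push r3 true)) r0
        (pseq ppop (pseq ppop (pseq (push r1 true) (push r3 true)))))) r3)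
    (pmove r1 r0)).

Lemma within_write y :
  within pwrite (main (ser (code y))) (9 * size y + 5) (main y).
Proof.
apply: (@within_leq _ _ (1 + ((7 * size y + 3) + (2 * size y).+1))); first by lia.
apply: within_seq; first exact: within_push.
apply: (@within_seq _ _ _ _ [:: [::]; catrev y [::]; [::]; [::]]); last first.
  rewrite -[X in main X]cats0 -catrev_catrev.
  by apply: within_leq (within_pmove10 _ _ _ _); rewrite size_catrev addn0.
rewrite -[set_nth _ _ _ _]/[:: _; [::]; [::]; [:: true]].
suff H a : within (pwhile skip (pcase skip skip r0
      (pcase skip (pseq (push r1 false) (push r3 true)) r0
        (pseq ppop (pseq ppop (pseq (push r1 true) (push r3 true)))))) r3)
    [:: ser (@code _ (seq_Enc bool_Enc) y); a; [::]; [:: true]] (7 * size y + 3)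
    [:: [::]; catrev y a; [::]; [::]] by exact: H.
elim: y a => [|b y IH] a.
  apply: (@within_leq _ _ (1 + 1).+1) => //.
  apply: (within_while (b := true) (s := [::])) => //.
    by apply: within_case; apply: within_leq (within_skip _).
  exact: within_while0.
apply: (@within_leq _ _ (6 + (7 * size y + 3)).+1); first by rewrite /=; lia.
apply: (within_while (b := true) (s := [::])) (IH _) => //.
apply: within_case => /=; case: b; apply: within_case => /=.
  do 2![apply: (@within_seq _ _ _ 1) (within_pop _ _ _) _].
  by apply: (@within_seq _ _ _ 1 _ 1); apply: within_push.
by apply: (@within_leq _ _ 2) => //; apply: (@within_seq _ _ _ 1 _ 1); apply: within_push.
Qed.

(** Converts bounds in the size of the code into bounds in the length of the input, in which machine
    time is measured. *)
Lemma pbounded_bits (b : seq bool -> nat) :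
  pbounded b -> exists p : {poly nat}, forall x, b x <= p.[size x]%R.
Proof.
case=> p pb; exists (p \Po (4%:P * 'X + 1%:P))%R => x.
rewrite horner_comp !hornerE; apply: leq_trans (pb x) _; apply: horner_nat_mono.
exact: sz_bits.
Qed.

Lemma in_P_PT (f : seq bool -> bool) (L : language) :
  PT f -> (forall x, f x <-> L x) -> in_P L.
Proof.
case=> P [b [pb Pf]] fL.
have [p bp] := pbounded_bits pb.
exists (tm_of_prog (pseq pread P)), ((7%:P * 'X + 3%:P + p) * 2%:P + 1%:P)%R => x.
set T := horner _ _.
have rP : within (pseq pread P) (main x) (7 * size x + 3 + p.[size x]%R)
    (main (ser (code (f x)))).
  apply: within_seq (within_read x) _; rewrite -[ser (code x)]cats0.
  by apply: within_leq (bp x) _; have := Pf x [::]; rewrite !cats0.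
have [|h a _] := tm_of_prog_run (T := T) rP.
  rewrite /T !(hornerD, hornerM, hornerC, hornerX) -muln2.
  by rewrite -[X in _ < X]/(_ * 2 + 1) addn1.
by split=> //; rewrite a -fL; case: (f x).
Qed.

Lemma polytime_computable_PT (f : seq bool -> seq bool) :
  PT f -> polytime_computable f.
Proof.
move=> Pf; have szf := PT_sz Pf; case: Pf => P [b [pb Pf]].
have [p bp] := pbounded_bits pb; have [q fq] := pbounded_bits szf.
exists (tm_of_prog (pseq pread (pseq P pwrite))),
  ((7%:P * 'X + 3%:P + (p + (9%:P * q + 5%:P))) * 2%:P + 1%:P)%R => x.
set T := horner _ _.
have rP : within (pseq pread (pseq P pwrite)) (main x)
    (7 * size x + 3 + (p.[size x]%R + (9 * q.[size x]%R + 5))) (main (f x)).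
  apply: within_seq (within_read x) _; rewrite -[ser (code x)]cats0.
  apply: (@within_seq _ _ _ _ (main (ser (code (f x))))).
    by apply: within_leq (bp x) _; have := Pf x [::]; rewrite !cats0.
  apply: within_leq (within_write _); rewrite leq_add2r leq_mul2l /=.
  by apply: leq_trans (fq x); apply: ltnW; apply: size_sz.
have [|h _ o] := tm_of_prog_run (T := T) rP.
  rewrite /T !(hornerD, hornerM, hornerC, hornerX) -muln2.
  by rewrite -[X in _ < X]/(_ * 2 + 1) addn1.
by split.
Qed.

(** * Activation *)

Section Activation.

Variables (theta : nat) (I : dec_instance).
Let G := dec_graph I.
Let N := dec_sctm theta I.

Definition edge_closed (X : {set 'I_(hnodes G)}) :=
  forall j, theta - 1 <= #|X :&: hedge G j| -> hedge G j \subset X.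

(** With unit benefits the total benefit of a node counts its open hyperedges, and with unit costs a
    single one suffices. *)
Lemma in_activation_step (S : {set 'I_(hnodes G)}) i :
  i \in @activation_step N S <->
  i \in S \/ exists2 j, i \in hedge G j & theta - 1 <= #|S :&: hedge G j|.
Proof.
rewrite !inE.
have -> : (adoption_cost (s := N) i <= total_benefit (N := N) S i)%R =
    (0 < #|open_edges (N := N) S i|).
  by rewrite /total_benefit /= GRing.sumr_const (Num.Theory.ler_nat _ 1).
case: (i \in S) => /=; first by split=> // _; left.
split=> [/card_gt0P[j]|[//|[j ij jS]]].
  by rewrite inE => /andP[ij jS]; right; exists j.
by apply/card_gt0P; exists j; rewrite inE ij.
Qed.

(** The limit is the least closed set containing the seeds. In this form the process disappears:
    activation is proved for an arbitrary closed set, and refuted by one that is not everything. *)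
Lemma full_activationP (S0 : {set 'I_(hnodes G)}) :
  full_activation (N := N) S0 <->
  forall X : {set 'I_(hnodes G)}, S0 \subset X -> edge_closed X -> X = [set: _].
Proof.
pose St t := iter t (@activation_step N) S0.
have sub t : St t \subset St t.+1 by apply: subsetUl.
have closedP S : @activation_step N S \subset S <-> edge_closed S.
  split=> [/subsetP sS j le_j|cS].
    by apply/subsetP => i ij; apply/sS/in_activation_step; right; exists j.
  apply/subsetP => i /in_activation_step[//|[j ij /cS/subsetP]]; exact.
split=> [[T TE] X S0X cX|H].
  apply/eqP; rewrite -subTset -(TE T) //.
  elim: T {TE} => // T IH /=; apply/subsetP => i /in_activation_step[iS|[j ij le_j]].
    exact: (subsetP IH).
  apply: (subsetP (cX j _)) => //; apply: leq_trans le_j _.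
  by apply/subset_leq_card/setSI.
(* With [n] nodes, a chain growing strictly in each of its first [n + 1] steps would have more than
   [n] elements. *)
have [t tE] : exists t, St t.+1 \subset St t.
  have [/existsP[t ?]|none] :=
    boolP [exists t : 'I_#|[set: 'I_(hnodes G)]|.+1, St t.+1 \subset St t].
    by exists t.
  have grow t : t <= #|[set: 'I_(hnodes G)]|.+1 -> t <= #|St t|.
    elim: t => // t IH le_t; apply: (@leq_trans #|St t|.+1); first by rewrite ltnS IH // ltnW.
    apply: proper_card; rewrite properE sub /=.
    by move: none; rewrite negb_exists => /forallP/(_ (Ordinal le_t)).
  by have := grow _ (leqnn _); rewrite leqNgt ltnS subset_leq_card // subsetT.
have St_sub u : S0 \subset St u.
  by elim: u => // u IH; apply: subset_trans IH (sub _).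
exists t => u /subnK <-; elim: (u - t) => [|v IH].
  by apply: H; [exact: (St_sub t) | exact: (iffLR (closedP (St t)))].
rewrite addSn -/(St _.+1); apply/eqP; rewrite -subTset.
by apply: subset_trans (sub _); rewrite /St IH.
Qed.

End Activation.

(** * Binary arithmetic *)

Definition bval (l : seq bool) : nat := foldr (fun (b : bool) n => b + n.*2) 0 l.

(** The last digit is the most significant one, so it must be 1; zero is a single digit 0 and not
    the empty list. *)
Definition canonical (l : seq bool) := (l == [:: false]) || last false l.

Lemma binaryE n : binary n = odd n :: (if n < 2 then [::] else binary n./2).
Proof.
rewrite /binary /mkseq /=; congr (_ :: _); first by rewrite expn0 divn1.
case: ltnP => le_n; first by case: n le_n => [|[|n]].
rewrite trunc_log2S //= -(addn1 0) iotaDl -map_comp; congr (_ :: _).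
  by rewrite expn0 divn1 expn1 divn2.
rewrite -[in LHS](addn1 1) iotaDl -map_comp; apply: eq_map => i /=.
by rewrite expnS divnMA divn2.
Qed.

Lemma bval_binary n : bval (binary n) = n.
Proof.
elim/ltn_ind: n => n IH; rewrite binaryE /=.
case: ltnP => le_n; first by case: n le_n {IH} => [|[|n]].
by rewrite IH ?odd_double_half //; lia.
Qed.

Lemma canonical_binary n : canonical (binary n).
Proof.
elim/ltn_ind: n => n IH; rewrite binaryE.
case: ltnP => le_n; first by case: n le_n {IH} => [|[|n]].
have := IH n./2; rewrite {IH} => IH; have {}IH : canonical (binary n./2) by apply: IH; lia.
move: IH; rewrite /canonical; case/orP; first last.
  by rewrite binaryE /= => ->; rewrite orbT.
move/eqP/(congr1 bval); rewrite bval_binary /=; lia.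
Qed.

Lemma binary_bval l : canonical l -> binary (bval l) = l.
Proof.
elim: l => [|b [|c l] IH] //; first by case: b {IH}; rewrite binaryE.
move=> can; have lt : last c l by move: can; rewrite /canonical eqseq_cons andbF.
have {}IH : binary (bval (c :: l)) = c :: l by apply: IH; rewrite /canonical /= lt orbT.
have gt0 : 0 < bval (c :: l).
  rewrite lt0n; apply/eqP => v0; move: IH lt; rewrite v0 binaryE /= => -[<- <-].
  by [].
rewrite (_ : bval [:: b, c & l] = b + (bval (c :: l)).*2) // binaryE oddD odd_double addbF oddb.
rewrite half_bit_double IH ifF //.
by apply/negbTE; rewrite -leqNgt; move: gt0; case: (b); lia.
Qed.

Lemma size_binary n : size (binary n) <= n.+1.
Proof.
rewrite size_mkseq ltnS.
case: n => // n; apply: ltnW; apply: leq_trans (trunc_logP (isT : 1 < 2) (ltn0Sn n)).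
exact: ltn_expl.
Qed.

Definition bits2 := seq (bool * bool).

Definition maj (x y z : bool) := if z then x || y else x && y.

Fixpoint adder (c : bool) (zs : bits2) : seq bool :=
  if zs is (x, y) :: zs then (x (+) y (+) c) :: adder (maj x y c) zs
  else if c then [:: true] else [::].

Definition adder_step (p : bool * seq bool) (z : bool * bool) :=
  (maj z.1 z.2 p.1, (z.1 (+) z.2 (+) p.1) :: p.2).

Lemma adder_foldl c zs s :
  let p := foldl adder_step (c, s) zs in
  catrev s (adder c zs) = rev (if p.1 then true :: p.2 else p.2).
Proof.
elim: zs c s => [|[x y] zs IH] c s /=.
  by case: c => //=; rewrite catrevE rev_cons cats1.
by rewrite -IH.
Qed.

Lemma PT_addb X {eX : Enc X} (f g : X -> bool) :
  PT f -> PT g -> PT (fun x => f x (+) g x).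
Proof.
move=> Pf Pg; apply: (@PT_ext _ _ _ _ (fun x => if f x then ~~ g x else g x)); last by pt.
by move=> x; case: (f x).
Qed.

Lemma PT_adder X {eX : Enc X} (c : X -> bool) (zs : X -> bits2) :
  PT c -> PT zs -> PT (fun x => adder (c x) (zs x)).
Proof.
move=> Pc Pz.
have PF : PT (fun x => foldl adder_step (c x, [::]) (zs x)).
  apply: (PT_foldl_grow (b := fun _ => 9) (F := fun _ => adder_step)).
  - apply: PT_pair; first by rewrite /maj; pt.
    by apply: PT_cons; [apply: PT_addb; [apply: PT_addb|]|]; pt.
  - by pt.
  - by pt.
  - by pb.
  - move=> x [d s] [u v] _; rewrite /adder_step !sz_pair /= sz_cons.
    have := sz_bool (maj u v d); have := sz_bool (u (+) v (+) d); lia.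
apply: (@PT_ext _ _ _ _
  (fun x => let p := foldl adder_step (c x, [::]) (zs x) in
     rev (if p.1 then true :: p.2 else p.2))).
  by move=> x; exact: esym (adder_foldl (c x) (zs x) [::]).
by cbv zeta; pt.
Qed.

Lemma bval_adder c zs : bval (adder c zs) = c + bval (unzip1 zs) + bval (unzip2 zs).
Proof.
elim: zs c => [|[x y] zs IH] c /=; first by case: c.
by rewrite IH; case: x; case: y; case: c => /=; lia.
Qed.

Lemma size_adder c zs : size (adder c zs) <= (size zs).+1.
Proof. by elim: zs c => [|[x y] zs IH] c /=; [case: c | rewrite ltnS IH]. Qed.

(** Zeros that bring [a] to the length of [b], so that [zip] loses no digit. *)
Definition fills (a b : seq bool) := [seq false | _ <- foldl (fun s _ => behead s) b a].

Lemma size_fills a b : size (fills a b) = size b - size a.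
Proof.
rewrite size_map; elim: a b => [|x a IH] b /=; first by rewrite subn0.
by rewrite IH size_behead; lia.
Qed.

Definition zipb (a b : seq bool) : bits2 := zip (a ++ fills a b) (b ++ fills b a).

Lemma zipb_sizes a b : size (a ++ fills a b) = size (b ++ fills b a).
Proof. by rewrite !size_cat !size_fills; lia. Qed.

Lemma bval_fills a b c : bval (a ++ fills b c) = bval a.
Proof.
elim: a => [|x a /= -> //]; rewrite /fills /=.
by elim: (foldl _ _ _) => //= _ s ->.
Qed.

Lemma unzip1_zipb a b : bval (unzip1 (zipb a b)) = bval a.
Proof. by rewrite /zipb unzip1_zip ?bval_fills // zipb_sizes. Qed.

Lemma unzip2_zipb a b : bval (unzip2 (zipb a b)) = bval b.
Proof. by rewrite /zipb unzip2_zip ?bval_fills // zipb_sizes. Qed.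

Lemma size_zipb a b : size (zipb a b) = maxn (size a) (size b).
Proof. by rewrite size_zip !size_cat !size_fills; lia. Qed.

Lemma PT_fills X {eX : Enc X} (a b : X -> seq bool) :
  PT a -> PT b -> PT (fun x => fills (a x) (b x)).
Proof.
move=> Pa Pb; rewrite /fills; pt.
apply: (PT_foldl_grow (b := fun _ => 0) (F := fun _ s _ => behead s)) => //.
- by rewrite /behead; pt.
- by pb.
- by move=> x [|c s] y _ //=; rewrite sz_cons; lia.
Qed.

Lemma PT_zipb X {eX : Enc X} (a b : X -> seq bool) :
  PT a -> PT b -> PT (fun x => zipb (a x) (b x)).
Proof. by move=> Pa Pb; rewrite /zipb; pt; apply: PT_fills. Qed.

Definition badd a b := adder false (zipb a b).

Lemma bval_badd a b : bval (badd a b) = bval a + bval b.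
Proof. by rewrite bval_adder unzip1_zipb unzip2_zipb. Qed.

Lemma size_badd a b : size (badd a b) <= (maxn (size a) (size b)).+1.
Proof. by apply: leq_trans (size_adder _ _) _; rewrite size_zipb. Qed.

Lemma PT_badd X {eX : Enc X} (a b : X -> seq bool) :
  PT a -> PT b -> PT (fun x => badd (a x) (b x)).
Proof. by move=> Pa Pb; apply: PT_adder; [pt | apply: PT_zipb]. Qed.

Definition bmul (a b : seq bool) : seq bool :=
  foldr (fun x s => if x then badd b (false :: s) else false :: s) [::] a.

Lemma bval_bmul a b : bval (bmul a b) = bval a * bval b.
Proof.
elim: a => [|x a IH] //=.
case: x; rewrite ?bval_badd /= IH; lia.
Qed.

(** The coefficient 1 of [size b] matters: the second factor is the one that accumulates in
    [negsum_step]. *)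
Lemma size_bmul a b : size (bmul a b) <= size b + (size a).*2.
Proof.
elim: a => [|x a IH] //=; case: x; last by rewrite /=; lia.
by apply: leq_trans (size_badd _ _) _ => /=; lia.
Qed.

Lemma bits_sz (s : seq bool) : size s <= sz s.
Proof. exact/ltnW/size_sz. Qed.

Lemma PT_bmul X {eX : Enc X} (a b : X -> seq bool) :
  PT a -> PT b -> PT (fun x => bmul (a x) (b x)).
Proof.
move=> Pa Pb; have szb := PT_sz Pb.
apply: (@PT_ext _ _ _ _ (fun x => foldl (fun s (c : bool) =>
    if c then badd (b x) (false :: s) else false :: s) [::] (rev (a x)))).
  by move=> x; rewrite foldl_rev.
apply: (@PT_foldl_measure _ _ _ _ _ _ size (fun x s (c : bool) =>
  if c then badd (b x) (false :: s) else false :: s) _ _ (fun x => sz (b x) + 2)).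
- by apply: PT_if; [pt|apply: PT_badd|]; pt.
- by pt.
- by pt.
- by pb.
- by move=> s; have := sz_bits s; lia.
- exact: bits_sz.
- move=> x s [] _; have := bits_sz (b x); last by rewrite /=; lia.
  by have := size_badd (b x) (false :: s); rewrite /=; lia.
Qed.

(** Digits come least significant first, so the last position at which the numbers differ
    decides. *)
Definition bleq (a b : seq bool) : bool :=
  foldl (fun c z => if z.1 == z.2 then c else z.2) true (zipb a b).

Lemma bleqE a b : bleq a b = (bval a <= bval b).
Proof.
rewrite -(unzip1_zipb a b) -(unzip2_zipb a b) /bleq.
(* A false flag means that the digits already read favour the first number, which is worth one unit
   on its side. *)
suff H c zs : foldl (fun c (z : bool * bool) => if z.1 == z.2 then c else z.2) c zs =
    (bval (unzip1 zs) + ~~ c <= bval (unzip2 zs)) by rewrite H addn0.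
elim: zs c => [|[x y] zs IH] c /=; first by case: c.
by rewrite IH; case: x; case: y; case: c => /=; lia.
Qed.

Lemma PT_bleq X {eX : Enc X} (a b : X -> seq bool) :
  PT a -> PT b -> PT (fun x => bleq (a x) (b x)).
Proof.
move=> Pa Pb; apply: (PT_foldl_fin (n := 3)
  (F := fun _ c (z : bool * bool) => if z.1 == z.2 then c else z.2)).
- by case.
- by pt; apply: PT_eq; pt.
- exact: PT_zipb.
- by pt.
Qed.

Definition bits0 (l : seq bool) : bits2 := [seq (b, false) | b <- l].

Lemma binaryS n : binary n.+1 = adder true (bits0 (binary n)).
Proof.
have v : bval (adder true (bits0 (binary n))) = n.+1.
  have [u1 u2] : bval (unzip1 (bits0 (binary n))) = bval (binary n) /\
      bval (unzip2 (bits0 (binary n))) = 0.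
    by elim: (binary n) => //= b s [-> ->].
  by rewrite bval_adder u1 u2 bval_binary addn0.
rewrite -{1}v binary_bval // /canonical; have := canonical_binary n.
rewrite /canonical => /orP[/eqP -> //|lt]; apply/orP; right.
elim: (binary n) lt {v} true => [|b [|d s] IH] //= lt c.
  by rewrite lt; case: c.
by have := IH lt (maj b false c).
Qed.

(** The argument is given in unary, so counting up from zero is affordable. *)
Lemma PT_binary X {eX : Enc X} (f : X -> nat) : PT f -> PT (fun x => binary (f x)).
Proof.
move=> Pf; have szf := PT_sz Pf.
have it n : iter n (fun s => adder true (bits0 s)) (binary 0) = binary n.
  by elim: n => // n IH; rewrite iterS IH binaryS.
apply: (@PT_ext _ _ _ _
  (fun x => iter (f x) (fun s => adder true (bits0 s)) (binary 0))).
  by move=> x; rewrite it.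
apply: (PT_iter (b := fun x => 4 * sz (f x) + 1) (F := fun _ s => adder true (bits0 s))).
- by apply: PT_adder; rewrite /bits0; pt.
- by pt.
- by pt.
- by pb.
- move=> x i le_i; rewrite it; apply: leq_trans (sz_bits _) _.
  have := size_binary i; rewrite sz_nat; lia.
Qed.

Lemma PT_enc_seq X A {eX : Enc X} {eA : Enc A} (e : X -> A -> seq bool) l :
  PT (fun p : X * A => e p.1 p.2) -> PT l -> PT (fun x => enc_seq (e x) (l x)).
Proof. by move=> Pe Pl; rewrite /enc_seq; pt. Qed.

Definition enc_bits := enc_seq (fun b : bool => [:: b]).

Lemma PT_enc_bits X {eX : Enc X} (f : X -> seq bool) :
  PT f -> PT (fun x => enc_bits (f x)).
Proof. by move=> Pf; apply: (PT_enc_seq (e := fun _ b => [:: b])); pt. Qed.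

Ltac pt_user ::=
  lazymatch goal with
  | |- PT (fun x => badd (@?a x) (@?b x)) => apply (PT_badd (a := a) (b := b))
  | |- PT (fun x => bmul (@?a x) (@?b x)) => apply (PT_bmul (a := a) (b := b))
  | |- PT (fun x => bleq (@?a x) (@?b x)) => apply (PT_bleq (a := a) (b := b))
  | |- PT (fun x => binary (@?f x)) => apply (PT_binary (f := f))
  | |- PT (fun x => enc_bits (@?f x)) => apply (PT_enc_bits (f := f))
  | |- PT (fun x => enc_seq (@?e x) (@?l x)) => apply (PT_enc_seq (e := e) (l := l))
  end.

(** * Decoding instances *)

Definition decoder A := seq bool -> A * seq bool.

Definition decodes A (enc : A -> seq bool) (dec : decoder A) :=
  forall a r, dec (enc a ++ r) = (a, r).

Section DecodeSeq.

Variables (A : Type) (dec : decoder A).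

(** The flag falls at the closing 0 or when the input runs out, which keeps decoding total. *)
Definition dec_step (p : bool * (seq A * seq bool)) : bool * (seq A * seq bool) :=
  if p.1 then
    if p.2.2 is b :: r then
      if b then (true, ((dec r).1 :: p.2.1, (dec r).2)) else (false, (p.2.1, r))
    else (false, p.2)
  else p.

Definition dec_seq (s : seq bool) : seq A * seq bool :=
  let p := iter (size s) dec_step (true, ([::], s)) in (rev p.2.1, p.2.2).

Lemma dec_seqP enc : decodes enc dec -> decodes (enc_seq enc) dec_seq.
Proof.
move=> decP l r; rewrite /dec_seq.
(* The announcing bits and the closing bit alone make the input long enough to clock one step per
   item and a last one. *)
set n := size _; have : size l < n.
  rewrite /n /enc_seq !size_cat /=.
  suff : size l <= size (flatten [seq true :: enc a | a <- l]) by lia.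
  by elim: l {n} => //= a l IH; rewrite size_cat; lia.
suff H acc m : size l < m ->
    iter m dec_step (true, (acc, enc_seq enc l ++ r)) = (false, (catrev l acc, r)).
  by move/H => ->; rewrite /= -/(rev l) revK.
elim: l acc m {n} => [|a l IH] acc [|m] //= lt_m; rewrite -iterS iterSr.
  by elim: m {lt_m} => //= m ->.
rewrite -(IH (a :: acc) m) //; congr (iter _ _ _).
by rewrite /enc_seq /= -!catA /dec_step /= decP.
Qed.

Hypothesis dec_shrinks : forall s, sz (dec s).2 <= sz s.

Lemma dec_step_shrinks p : sz (dec_step p).2.2 <= sz p.2.2.
Proof.
case: p => -[] [acc [|b r]] //; rewrite /dec_step /=.
case: b; rewrite sz_cons /=; last by lia.
by have := dec_shrinks r; lia.
Qed.

Lemma dec_seq_shrinks s : sz (dec_seq s).2 <= sz s.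
Proof.
rewrite /dec_seq /=; elim: (size s) => // n IH.
exact: leq_trans (dec_step_shrinks _) IH.
Qed.

Lemma PT_dec_seq {eA : Enc A} : PT dec -> PT dec_seq.
Proof.
move=> Pd; have [q qb] := PT_sz (PT_fst Pd).
apply: (@PT_comp _ _ _ _ _ _ (fun p => (rev p.2.1, p.2.2))
  (fun s => iter (size s) dec_step (true, ([::], s)))); first by pt.
apply: (PT_iter (b := fun s => sz s * (q.[sz s]%R + 1) + sz s + 6)
  (F := fun _ => dec_step)).
- rewrite /dec_step; pt.
- by pt.
- by pt.
- by pb.
- move=> s i le_i.
  have le_rest j : sz (iter j dec_step (true, ([::], s))).2.2 <= sz s.
    by elim: j => // j IH; apply: leq_trans (dec_step_shrinks _) IH.
  have le_acc : sz (iter i dec_step (true, ([::], s))).2.1 <= i * (q.[sz s]%R + 1) + 1.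
    elim: i {le_i} => // i IH; rewrite iterS mulSn -addnA.
    apply: leq_trans (leq_add (leqnn _) IH); have := le_rest i.
    case: (iter i _ _) => -[] [acc [|b r]] le_r; rewrite /dec_step /= ?leq_addl //.
    case: b le_r; rewrite /= ?leq_addl // !sz_cons => le_r.
    rewrite -addSn leq_add2r addn1 ltnS; apply: leq_trans (qb r) (horner_nat_mono _ _).
    by move: le_r; have := sz_gt0 true; lia.
  have := sz_bool (iter i dec_step (true, ([::], s))).1.
  have := le_rest i; rewrite !sz_pair; move: le_acc.
  set B := (q.[_]%R + 1); have : i * B <= sz s * B.
    by rewrite leq_mul2r (leq_trans le_i (bits_sz s)) orbT.
  lia.
Qed.

End DecodeSeq.

(** The size condition makes the notion pass to lists: no remainder met in the loop outgrows the
    input, so one polynomial bounds all decoded items. *)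
Definition codec A {eA : Enc A} (enc : A -> seq bool) (dec : decoder A) :=
  [/\ decodes enc dec, forall s, sz (dec s).2 <= sz s & PT dec].

Lemma codec_seq A {eA : Enc A} (enc : A -> seq bool) dec :
  codec enc dec -> codec (enc_seq enc) (dec_seq dec).
Proof.
case=> decP shr Pd; split; first exact: dec_seqP.
- exact: dec_seq_shrinks.
- exact: PT_dec_seq.
Qed.

Definition enc_pair A B (enc1 : A -> seq bool) (enc2 : B -> seq bool) (p : A * B) :=
  enc1 p.1 ++ enc2 p.2.

Definition dec_pair A B (d1 : decoder A) (d2 : decoder B) : decoder (A * B) :=
  fun s => (((d1 s).1, (d2 (d1 s).2).1), (d2 (d1 s).2).2).

Lemma codec_pair A B {eA : Enc A} {eB : Enc B} (enc1 : A -> seq bool)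
    (enc2 : B -> seq bool) d1 d2 :
  codec enc1 d1 -> codec enc2 d2 -> codec (enc_pair enc1 enc2) (dec_pair d1 d2).
Proof.
case=> decP1 shr1 P1 [decP2 shr2 P2]; split.
- by move=> [a b] r; rewrite /dec_pair /enc_pair -catA decP1 /= decP2.
- by move=> s; apply: leq_trans (shr2 _) (shr1 _).
- by rewrite /dec_pair; pt.
Qed.

Definition enc_bit (b : bool) := [:: b].

Definition dec_bit : decoder bool := fun s => (head false s, behead s).

Lemma codec_bit : codec enc_bit dec_bit.
Proof.
split=> //; first by move=> [|b s] //=; rewrite sz_cons; lia.
by rewrite /dec_bit; pt; rewrite /head /behead; pt.
Qed.

(* A sign, true for negative numbers, and a magnitude in binary. *)
Definition rint := (bool * seq bool)%type.
Definition rfrac := (rint * seq bool)%type.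
Definition raw := (rint * (seq rfrac * seq (seq (seq bool))))%type.

Definition enc_rint : rint -> seq bool := enc_pair enc_bit enc_bits.
Definition enc_rfrac : rfrac -> seq bool := enc_pair enc_rint enc_bits.
Definition enc_raw : raw -> seq bool :=
  enc_pair enc_rint (enc_pair (enc_seq enc_rfrac) (enc_seq (enc_seq enc_bits))).

Definition dec_bits := dec_seq dec_bit.
Definition dec_rint := dec_pair dec_bit dec_bits.
Definition dec_raw :=
  dec_pair dec_rint (dec_pair (dec_seq (dec_pair dec_rint dec_bits))
    (dec_seq (dec_seq dec_bits))).

Lemma codec_raw : codec enc_raw dec_raw.
Proof.
have cb : codec enc_bits dec_bits by exact: codec_seq codec_bit.
have ci : codec enc_rint dec_rint by exact: codec_pair codec_bit cb.
apply: (codec_pair ci (codec_pair _ (codec_seq (codec_seq cb)))).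
exact: codec_seq (codec_pair ci cb).
Qed.

Lemma PT_enc_rint X {eX : Enc X} (f : X -> rint) :
  PT f -> PT (fun x => enc_rint (f x)).
Proof. by move=> Pf; rewrite /enc_rint /enc_pair /enc_bit; pt. Qed.

Lemma PT_enc_rfrac X {eX : Enc X} (f : X -> rfrac) :
  PT f -> PT (fun x => enc_rfrac (f x)).
Proof. by move=> Pf; rewrite /enc_rfrac /enc_pair; pt; apply: PT_enc_rint; pt. Qed.

Lemma PT_enc_raw X {eX : Enc X} (f : X -> raw) :
  PT f -> PT (fun x => enc_raw (f x)).
Proof.
move=> Pf; rewrite /enc_raw /enc_pair; apply: PT_cat.
  by apply: PT_enc_rint; pt.
apply: PT_cat.
  by apply: (PT_enc_seq (e := fun _ => enc_rfrac)); [apply: PT_enc_rfrac|]; pt.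
apply: (PT_enc_seq (e := fun _ => enc_seq enc_bits)); last by pt.
by apply: (PT_enc_seq (e := fun _ => enc_bits)); pt.
Qed.

Definition rint_of (z : int) : rint := ((z < 0)%R, binary `|z|%N).
Definition rint_val (q : rint) : int :=
  (if q.1 then - (bval q.2)%:Z else (bval q.2)%:Z)%R.
Definition rfrac_of (q : int * nat) : rfrac := (rint_of q.1, binary q.2).
Definition rfrac_val (q : rfrac) : int * nat := (rint_val q.1, bval q.2).

(** Minus zero is excluded, so that each integer has exactly one valid form. *)
Definition vint (q : rint) := canonical q.2 && ~~ (q.1 && (q.2 == [:: false])).
Definition vfrac (q : rfrac) :=
  [&& vint q.1, canonical q.2 & q.2 != [:: false]].

Lemma binary_eq0 n : (binary n == [:: false]) = (n == 0).
Proof.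
apply/eqP/eqP => [/(congr1 bval)|-> //].
by rewrite bval_binary.
Qed.

Lemma vint_of z : vint (rint_of z).
Proof.
rewrite /vint canonical_binary /= binary_eq0 absz_eq0.
by case: eqP => [->|]; rewrite ?andbF // Order.POrderTheory.ltxx.
Qed.

Lemma rint_ofK z : rint_val (rint_of z) = z.
Proof.
rewrite /rint_val !bval_binary -[(rint_of z).1]/(z < 0)%R; case: (Order.TotalTheory.leP 0%R z) => zs.
  by rewrite gez0_abs.
by rewrite ltz0_abs // GRing.opprK.
Qed.

Lemma bval_eq0 l : canonical l -> (bval l == 0) = (l == [:: false]).
Proof. by move=> cl; rewrite -binary_eq0 binary_bval. Qed.

Lemma rint_valK q : vint q -> rint_of (rint_val q) = q.
Proof.
case: q => s l /andP[/= cl sl]; rewrite /rint_of /rint_val /=.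
case: s sl => /=; last by rewrite binary_bval.
rewrite -bval_eq0 // abszN /= binary_bval // Num.Theory.oppr_lt0.
by rewrite -lt0n => lt0; congr (_, _); lia.
Qed.

Lemma vfrac_of q : 0 < q.2 -> vfrac (rfrac_of q).
Proof. by move=> q0; rewrite /vfrac vint_of canonical_binary binary_eq0 -lt0n. Qed.

Lemma rfrac_valK q : vfrac q -> rfrac_of (rfrac_val q) = q.
Proof.
by case: q => q d /and3P[/= vq cd _]; rewrite /rfrac_of /= rint_valK ?binary_bval.
Qed.

Lemma hadjacent_sym G : connect_sym (@hadjacent G).
Proof.
by apply: sym_connect_sym => u v; apply: eq_existsb => j; rewrite andbC.
Qed.

Lemma enc_seq_map A B (f : A -> B) e l :
  enc_seq e (map f l) = enc_seq (fun a => e (f a)) l.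
Proof. by rewrite /enc_seq -map_comp. Qed.

(** A relation and not a function: costs may be written as unreduced fractions, so one instance has
    many representations. *)
Definition represents (r : raw) (I : dec_instance) : Prop :=
  exists frac : 'I_(hnodes (dec_graph I)) -> int * nat,
    [/\ forall i, 0 < (frac i).2 /\ dec_cost i = ((frac i).1%:~R / (frac i).2%:R)%R,
        r.1 = rint_of (dec_budget I),
        r.2.1 = [seq rfrac_of (frac i) | i <- enum 'I_(hnodes (dec_graph I))]
      & r.2.2 = [seq [seq binary (val i) | i <- enum (hedge (dec_graph I) j)]
                   | j <- enum 'I_(hedges (dec_graph I))]].

Lemma enc_hypergraphE G : enc_hypergraph G = enc_seq (enc_seq enc_bits)
  [seq [seq binary (val i) | i <- enum (hedge G j)] | j <- enum 'I_(hedges G)].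
Proof.
rewrite /enc_hypergraph !enc_seq_map /enc_seq; congr (flatten _ ++ _).
by apply: eq_map => j; rewrite -!map_comp.
Qed.

Lemma encoded_byP I s :
  dec_encoded_by I s <-> exists2 r, represents r I & s = enc_raw r.
Proof.
split=> [[frac [fracP ->]]|[[h [cs es]] [frac [fracP /= -> -> ->]] ->]].
  exists (rint_of (dec_budget I),
    ([seq rfrac_of (frac i) | i <- enum 'I_(hnodes (dec_graph I))],
     [seq [seq binary (val i) | i <- enum (hedge (dec_graph I) j)]
                   | j <- enum 'I_(hedges (dec_graph I))])); first by exists frac.
  by rewrite enc_hypergraphE /enc_raw /enc_pair [_.2.1]/= [_.2.2]/= !enc_seq_map.
by exists frac; split=> //; rewrite enc_hypergraphE /enc_raw /enc_pair [_.2.1]/= [_.2.2]/= !enc_seq_map.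
Qed.

Definition rnodes (r : raw) := [seq binary i | i <- iota 0 (size r.2.1)].

(** The last condition forces each hyperedge to list existing nodes, without repetition and in
    increasing order, as the enumeration of a set does. *)
Definition valid_form (r : raw) :=
  [&& vint r.1, all vfrac r.2.1
    & all (fun e : seq (seq bool) => e == [seq v <- rnodes r | v \in e]) r.2.2].

(** Nodes of [R] are not retained as such, so [t] rounds yield the ends of walks with exactly [t]
    steps. *)
Definition rgrow (es : seq (seq (seq bool))) (vs R : seq (seq bool)) :=
  [seq v <- vs | has (fun e : seq (seq bool) => (v \in e) && has (fun u => u \in R) e) es].

Definition rreach (r : raw) :=
  iter (size r.2.1) (rgrow r.2.2 (rnodes r)) [:: binary 0].

Definition valid_wf (k : nat) (r : raw) :=
  [&& r.2.1 != [::],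
      all (fun v => v \in rreach r) (rnodes r),
      all (fun v => has (fun e : seq (seq bool) => v \in e) r.2.2) (rnodes r)
    & all (fun e : seq (seq bool) => size e == k) r.2.2].

Lemma PT_rnodes X {eX : Enc X} (f : X -> raw) : PT f -> PT (fun x => rnodes (f x)).
Proof. by move=> Pf; rewrite /rnodes; pt. Qed.

Lemma PT_rreach X {eX : Enc X} (f : X -> raw) : PT f -> PT (fun x => rreach (f x)).
Proof.
move=> Pf; have Pn := PT_rnodes Pf; have szn := PT_sz Pn.
rewrite /rreach.
apply: (PT_iter (b := fun x => sz (rnodes (f x)) + 10)
  (F := fun x R => rgrow (f x).2.2 (rnodes (f x)) R)).
- by rewrite /rgrow; pt; apply: PT_rnodes; pt.
- by pt.
- by pt.
- by pb.
- move=> x [|i] _; first by apply: leq_trans (leq_addl _ _).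
  rewrite iterS /rgrow; move: (iter _ _ _) => R.
  apply: leq_trans (leq_addr _ _); elim: (rnodes _) => //= v vs IH.
  by case: ifP => _; rewrite !sz_cons; lia.
Qed.

Lemma PT_last X A {eX : Enc X} {eA : Enc A} (a : A) (l : X -> seq A) :
  PT l -> PT (fun x => last a (l x)).
Proof.
move=> Pl; have szl := PT_sz Pl.
apply: (@PT_ext _ _ _ _ (fun x => foldl (fun _ b => b) a (l x))).
  by move=> x; elim: (l x) a => //=.
apply: (PT_foldl_grow (b := fun x => sz (l x)) (F := fun _ _ b => b)) => //.
- by pt.
- by pt.
- by move=> x s b /leq_trans; apply; apply: leq_addl.
Qed.

Lemma PT_valid k : PT (fun r : raw => valid_form r && valid_wf k r).
Proof.
by rewrite /valid_form /valid_wf /vfrac /vint /canonical; pt;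
  (apply: PT_last || apply: PT_rnodes || apply: PT_rreach); pt.
Qed.

(* A pair (N, D) stands for the sum - N / D of the negative costs. *)
Definition negsum_step (p : seq bool * seq bool) (q : rfrac) :=
  if q.1.1 then (badd (bmul q.2 p.1) (bmul q.1.2 p.2), bmul q.2 p.2) else p.

Definition negsum (cs : seq rfrac) : seq bool * seq bool :=
  foldl negsum_step ([::], [:: true]) cs.

Definition negsum_leq (r : raw) :=
  if r.1.1 then bleq (bmul r.1.2 (negsum r.2.1).2) (negsum r.2.1).1 else true.

Definition cost_leq (h : rint) (q : rfrac) :=
  if q.1.1 then if h.1 then bleq (bmul h.2 q.2) q.1.2 else true
  else if h.1 then false else bleq q.1.2 (bmul h.2 q.2).

Definition rquestion (theta : nat) (r : raw) :=
  if theta == 1 then negsum_leq r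
  else (has (fun q : rfrac => q.1.1) r.2.1 && negsum_leq r)
    || has (cost_leq r.1) r.2.1.

(** Denominators are multiplied and never reduced, but their lengths only add up. *)
Lemma PT_negsum X {eX : Enc X} (f : X -> seq rfrac) :
  PT f -> PT (fun x => negsum (f x)).
Proof.
move=> Pf; have szf := PT_sz Pf.
pose mu (p : seq bool * seq bool) := maxn (size p.1) (size p.2).
apply: (@PT_foldl_measure _ _ _ _ _ _ mu (fun _ => negsum_step) _ _
    (fun x => 4 * sz (f x) + 1)).
- by rewrite /negsum_step; pt.
- by pt.
- by pt.
- by pb.
- move=> p; rewrite sz_pair /mu.
  by have := sz_bits p.1; have := sz_bits p.2; lia.
- move=> p; rewrite sz_pair /mu.
  by have := bits_sz p.1; have := bits_sz p.2; lia.
- move=> x p [[s n] d]; rewrite !sz_pair /mu /negsum_step; case: s => /=; last by lia.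
  have := size_badd (bmul d p.1) (bmul n p.2).
  have := size_bmul d p.1; have := size_bmul d p.2; have := size_bmul n p.2.
  have := bits_sz d; have := bits_sz n.
  lia.
Qed.

Lemma PT_rquestion theta : PT (rquestion theta).
Proof.
have P1 : PT negsum_leq.
  by rewrite /negsum_leq; pt; apply: PT_negsum; pt.
by rewrite /rquestion /cost_leq; pt.
Qed.

(* Decoding never fails; comparing with the code of the result detects malformed
   input. *)
Definition dec_accepts k theta (s : seq bool) :=
  let r := (dec_raw s).1 in
  [&& enc_raw r == s, valid_form r && valid_wf k r & rquestion theta r].

Lemma PT_dec_accepts k theta : PT (dec_accepts k theta).
Proof.
have [_ _ Pd] := codec_raw; have Pr := PT_fst Pd.
have Pv := PT_valid k; have Pq := PT_rquestion theta.
have -> : dec_accepts k theta = (fun s => (enc_raw (dec_raw s).1 == s) &&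
  ((fun r => valid_form r && valid_wf k r) (dec_raw s).1 && rquestion theta (dec_raw s).1)) by [].
apply: PT_and; first by apply: PT_eq; [apply: PT_enc_raw|]; pt.
by apply: PT_and; [apply: (PT_comp Pv) | apply: (PT_comp Pq)].
Qed.

(** * Correctness of the decision procedures for thresholds 1 and 2 *)

Section DecisionProcedure.

Import Order.TTheory GRing.Theory Num.Theory.
Local Open Scope ring_scope.

Definition fval (q : int * nat) : rat := q.1%:~R / q.2%:R.

Lemma cost_leqP (h : int) q : (0 < q.2)%N ->
  cost_leq (rint_of h) (rfrac_of q) = (fval q <= h%:~R).
Proof.
case: q => z d /= d0; rewrite /fval ler_pdivrMr ?ltr0n // -[d%:R]/(d%:Z%:~R) -intrM ler_int.
rewrite /cost_leq !bleqE !bval_bmul !bval_binary /rfrac_of /=.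
case: ltP => z0; case: ltP => h0; nia.
Qed.

Lemma negsum_foldlP (l : seq (int * nat)) p : all (fun q => 0 < q.2)%N l ->
  (0 < bval p.2)%N ->
  let p' := foldl negsum_step p [seq rfrac_of q | q <- l] in
  (0 < bval p'.2)%N /\
  (bval p'.1)%:R / (bval p'.2)%:R =
    (bval p.1)%:R / (bval p.2)%:R - \sum_(q <- l | q.1 < 0) fval q :> rat.
Proof.
elim: l p => [|[z d] l IH] [N D] /=; first by rewrite big_nil subr0.
case/andP=> d0 /IH{}IH D0; rewrite big_cons /=.
rewrite {2 4 6}/negsum_step -[(rfrac_of _).1.1]/(z < 0); case: ltP => z0; last exact: IH.
have [|-> ->] := IH (badd (bmul (binary d) N) (bmul (binary `|z|%N) D), bmul (binary d) D).
  by rewrite bval_bmul bval_binary muln_gt0 d0.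
split=> //; rewrite bval_badd !bval_bmul !bval_binary natrD !natrM /fval /=.
have dn : d%:R != 0 :> rat by rewrite pnatr_eq0 -lt0n.
have Dn : (bval D)%:R != 0 :> rat by rewrite pnatr_eq0 -lt0n.
have -> : (`|z|%N)%:R = - z%:~R :> rat.
  by rewrite -[LHS]/((`|z|%N : int)%:~R) ltz0_abs // rmorphN.
by field; rewrite dn Dn.
Qed.

Lemma negsumP (l : seq (int * nat)) : all (fun q => 0 < q.2)%N l ->
  let p := negsum [seq rfrac_of q | q <- l] in
  (0 < bval p.2)%N /\
  \sum_(q <- l | q.1 < 0) fval q = - ((bval p.1)%:R / (bval p.2)%:R).
Proof.
move=> lP; have [//|p0 pE] := @negsum_foldlP l ([::], [:: true]) lP _.
by split=> //; rewrite [X in - X]pE mul0r sub0r opprK.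
Qed.

Lemma neg_sum_leq (n : nat) (w : 'I_n -> rat) (S : {set 'I_n}) :
  \sum_(i | w i < 0) w i <= \sum_(i in S) w i.
Proof.
rewrite [X in _ <= X](bigID (fun i => w i < 0)) /=.
rewrite [X in X <= _](bigID (fun i => i \in S)) /=.
rewrite (eq_bigl (fun i => (i \in S) && (w i < 0))); last by move=> i; rewrite andbC.
rewrite lerD2l; apply: (@le_trans _ _ 0); first by apply: sumr_le0 => i /andP[/ltW].
by apply: sumr_ge0 => i /andP[_]; rewrite -leNgt.
Qed.

Section Represents.

Variables (r : raw) (I : dec_instance).
Hypothesis rI : represents r I.
Let n := hnodes (dec_graph I).

Lemma rnodesE : rnodes r = [seq binary (val i) | i <- enum 'I_n].
Proof.
case: rI => frac [_ _ E _]; rewrite /rnodes E size_map size_enum_ord.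
by rewrite -[iota 0 _]val_enum_ord -map_comp.
Qed.

Lemma size_costs : size r.2.1 = n.
Proof. by case: rI => frac [_ _ E _]; rewrite E size_map size_enum_ord. Qed.

Lemma mem_redge (A : {set 'I_n}) i :
  (binary (val i) \in [seq binary (val u) | u <- enum A]) = (i \in A).
Proof.
rewrite (mem_map (f := fun u : 'I_n => binary (val u))) ?mem_enum //.
by move=> u v /(congr1 bval); rewrite !bval_binary => /val_inj.
Qed.

Lemma has_redges (P : seq (seq bool) -> bool) :
  has P r.2.2 <-> exists j, P [seq binary (val u) | u <- enum (hedge (dec_graph I) j)].
Proof.
case: rI => frac [_ _ _ ->]; rewrite has_map; split=> [/hasP[j _ Pj]|[j Pj]].
  by exists j.
by apply/hasP; exists j; rewrite ?mem_enum.
Qed.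

Lemma all_rnodes (P : seq bool -> bool) :
  all P (rnodes r) <-> forall i : 'I_n, P (binary (val i)).
Proof.
rewrite rnodesE all_map; split=> [/allP allP i|H]; last by apply/allP => i _; apply: H.
by apply: (allP i); rewrite mem_enum.
Qed.

Lemma mem_rnodes (i : 'I_n) : binary (val i) \in rnodes r.
Proof. by rewrite rnodesE; apply: map_f; rewrite mem_enum. Qed.

Lemma represents_valid : valid_form r.
Proof.
rewrite /valid_form rnodesE; case: rI => frac [fP -> -> ->].
rewrite vint_of /=; apply/andP; split.
  by apply/allP => q /mapP[i _ ->]; rewrite vfrac_of //; case: (fP i).
apply/allP => e /mapP[j _ ->].
rewrite filter_map; apply/eqP; congr map.
rewrite {1}/enum_mem -enumT; apply: eq_filter => i /=.
by rewrite mem_redge.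
Qed.

Lemma mem_rreach t (n0 : (0 < n)%N) (i : 'I_n) :
  binary (val i) \in iter t (rgrow r.2.2 (rnodes r)) [:: binary 0] <->
  exists p, [/\ size p = t, path (@hadjacent (dec_graph I)) (Ordinal n0) p
    & last (Ordinal n0) p = i].
Proof.
elim: t i => [|t IH] i.
  rewrite inE; split=> [/eqP/(congr1 bval)|[[|a p] [//= _ _ <-]] //].
  rewrite !bval_binary => i0; exists [::]; split=> //; exact/val_inj/esym.
rewrite iterS /rgrow mem_filter mem_rnodes andbT has_redges.
split=> [[j /andP[]]|[p [sp pp lp]]].
  rewrite mem_redge => ij /hasP[_ /mapP[u uj ->] /IH[p [sp pp lp]]].
  rewrite mem_enum in uj.
  exists (rcons p i); rewrite size_rcons sp last_rcons rcons_path pp lp; split=> //=.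
  by apply/existsP; exists j; rewrite uj.
case/lastP: p sp pp lp => // p v; rewrite size_rcons rcons_path last_rcons.
move=> [sp] /andP[pp /existsP[j /andP[uj vj]]] vi; exists j.
rewrite mem_redge -vi vj /=; apply/hasP.
exists (binary (val (last (Ordinal n0) p))); first by rewrite mem_redge.
by apply/IH; exists p.
Qed.

Lemma valid_wfP k : valid_wf k r <-> dec_wf k I.
Proof.
have n0P : (r.2.1 != [::]) = (0 < n)%N by rewrite -size_costs lt0n size_eq0.
have coverP : all (fun v => has (fun e : seq (seq bool) => v \in e) r.2.2) (rnodes r) <->
    forall i, exists j, i \in hedge (dec_graph I) j.
  rewrite all_rnodes; split=> H i; have := H i.
    by case/has_redges => j; rewrite mem_redge; exists j.
  by case=> j ij; apply/has_redges; exists j; rewrite mem_redge.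
have sizeP : all (fun e : seq (seq bool) => size e == k) r.2.2 <->
    forall j, #|hedge (dec_graph I) j| = k.
  case: rI => frac [_ _ _ ->]; rewrite all_map; split=> [/allP H j|H].
    by have := H j; rewrite mem_enum /= size_map -cardE => /(_ isT)/eqP.
  by apply/allP => j _; rewrite /= size_map -cardE H.
have symh := @hadjacent_sym (dec_graph I).
rewrite /valid_wf n0P; split.
  case/and4P => n0 /all_rnodes reach /coverP cover /sizeP sz_k; split=> //; split=> //.
  have c0 v : connect (@hadjacent (dec_graph I)) (Ordinal n0) v.
    have := reach v; rewrite /rreach => /(mem_rreach _ n0)[p [_ pp lp]].
    by apply/connectP; exists p.
  by move=> u v; apply: connect_trans (c0 v); rewrite symh.
case=> [[n0 conn] /coverP cover /sizeP sz_k]; apply/and4P; split=> //.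
apply/all_rnodes => i; rewrite /rreach size_costs.
have /connectP[p0 /shortenP[p pp up _] lp] := conn (Ordinal n0) i.
have le_p : (size p <= n)%N.
  apply: ltnW; rewrite -[n]card_ord -[(size p).+1]/(size (Ordinal n0 :: p)).
  by rewrite -(card_uniqP up) max_card.
(* A simple path has fewer than [n] steps. It is prolonged to exactly [n] by waiting at its end,
   which lies in some hyperedge and is thus adjacent to itself. *)
apply/(mem_rreach _ n0); exists (p ++ nseq (n - size p) i).
rewrite size_cat size_nseq subnKC // cat_path pp last_cat -lp; split=> //=.
  have [j ij] := iffLR coverP cover i.
  have ii : hadjacent i i by apply/existsP; exists j; rewrite ij.
  by elim: (n - _)%N => //= m ->; rewrite ii.
by elim: (n - _)%N.
Qed.

End Represents.

Lemma valid_represents r : valid_form r -> exists I, represents r I.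
Proof.
case: r => h [cs es] /and3P[/= vh vcs ves].
pose n := size cs; pose m := size es.
pose frac (i : 'I_n) := rfrac_val (nth ((false, [::]), [::]) cs i).
pose G := @Hypergraph n m [ffun j : 'I_m =>
  [set i : 'I_n | binary i \in nth [::] es j]].
have vfr (i : 'I_n) : vfrac (nth ((false, [::]), [::]) cs i).
  by apply: (allP vcs); rewrite mem_nth.
exists (@DecInstance (rint_val h) G (fun i => fval (frac i))), frac; split=> /=.
- move=> i; split=> //; rewrite lt0n bval_eq0; first by case/and3P: (vfr i).
  by case/and3P: (vfr i).
- by rewrite rint_valK.
- transitivity [seq nth ((false, [::]), [::]) cs (val i) | i <- enum 'I_n].
    by rewrite -[LHS](mkseq_nth ((false, [::]), [::])) /mkseq -val_enum_ord -map_comp.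
  by apply: eq_map => i; rewrite rfrac_valK.
- transitivity [seq nth [::] es (val j) | j <- enum 'I_m].
    by rewrite -[LHS](mkseq_nth [::]) /mkseq -val_enum_ord -map_comp.
  apply: eq_map => j; rewrite ffunE.
  have /eqP {1}-> := allP ves (nth [::] es j) (mem_nth _ (ltn_ord j)).
  rewrite /rnodes /= -val_enum_ord -map_comp filter_map; congr map.
  rewrite [in RHS]/enum_mem -enumT; apply: eq_filter => i /=.
  by rewrite inE.
Qed.

Section Questions.

Variables (k : nat) (I : dec_instance).
Hypothesis wf : dec_wf k I.
Let n := hnodes (dec_graph I).

Lemma full1 (S : {set 'I_n}) : full_activation (N := dec_sctm 1 I) S.
Proof.
apply/full_activationP => X _ cX; apply/setP => i; rewrite inE.
have [_ cover _] := wf; have [j] := cover i.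
by apply/subsetP; apply: cX.
Qed.

Lemma full2 (S : {set 'I_n}) :
  full_activation (N := dec_sctm 2 I) S <-> S != set0.
Proof.
have [[n0 conn] _ _] := wf; split=> [/full_activationP H|/set0Pn[i iS]].
  apply/eqP => S0; have /setP/(_ (Ordinal n0)) : set0 = [set: 'I_n].
    apply: H; first by rewrite S0.
    by move=> j; rewrite set0I cards0.
  by rewrite !inE.
apply/full_activationP => X SX cX; apply/setP => v; rewrite inE.
have /connectP[p pp ->] := conn i v.
have := subsetP SX _ iS; elim: p i {iS} pp => //= u p IH i /andP[/existsP[j /andP[ij uj]] pp] iX.
apply: IH pp _; apply: (subsetP (cX j _)) => //.
by rewrite card_gt0; apply/set0Pn; exists i; rewrite inE iX.
Qed.

Variable r : raw.
Hypothesis rI : represents r I.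

Lemma negsum_leqP :
  negsum_leq r = (\sum_(i : 'I_n | dec_cost i < 0) dec_cost i <= (dec_budget I)%:~R).
Proof.
case: rI => frac [fP hE csE _]; rewrite /negsum_leq hE csE map_comp.
have lP : all (fun q => 0 < q.2)%N [seq frac i | i <- enum 'I_n].
  by rewrite all_map; apply/allP => i _; case: (fP i).
have [D0 sE] := negsumP lP.
have -> : \sum_(i : 'I_n | dec_cost i < 0) dec_cost i =
    \sum_(q <- [seq frac i | i <- enum 'I_n] | q.1 < 0) fval q.
  rewrite big_map big_enum_cond /=; apply: eq_big => i; last by case: (fP i).
  case: (fP i) => d0 ->; rewrite pmulr_llt0 ?invr_gt0 ?ltr0n // ltrz0.
  by [].
rewrite sE; set p := negsum _; rewrite -[(rint_of _).1]/(dec_budget I < 0).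
have Dr : 0 < (bval p.2)%:R :> rat by rewrite ltr0n.
case: ltP => h0; last first.
  apply/esym; apply: (@le_trans _ _ 0); last by rewrite ler0z.
  by rewrite oppr_le0 divr_ge0 ?ler0n.
rewrite bleqE bval_bmul bval_binary lerNl ler_pdivlMr // -(ler_nat rat) natrM.
congr (_ * _ <= _).
by rewrite -[LHS]/((`|dec_budget I|%N : int)%:~R) ltz0_abs // rmorphN.
Qed.

Lemma has_negP :
  has (fun q : rfrac => q.1.1) r.2.1 = [exists i : 'I_n, dec_cost i < 0].
Proof.
case: rI => frac [fP _ -> _]; rewrite has_map; apply/hasP/existsP => [[i _ neg]|[i neg]].
  exists i; case: (fP i) => d0 ->.
  by rewrite pmulr_llt0 ?invr_gt0 ?ltr0n // ltrz0.
exists i; first by rewrite mem_enum.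
move: neg; case: (fP i) => d0 ->.
by rewrite pmulr_llt0 ?invr_gt0 ?ltr0n // ltrz0.
Qed.

Lemma has_cost_leqP :
  has (cost_leq r.1) r.2.1 = [exists i : 'I_n, dec_cost i <= (dec_budget I)%:~R].
Proof.
case: rI => frac [fP -> -> _]; rewrite has_map; apply/hasP/existsP => [[i _]|[i]].
  by case: (fP i) => d0 cE; rewrite /= cost_leqP // /fval -cE; exists i.
case: (fP i) => d0 cE le_i; exists i; first by rewrite mem_enum.
by rewrite /= cost_leqP // /fval -cE.
Qed.

Lemma rquestion1P : rquestion 1 r <-> dec_question 1 I.
Proof.
rewrite /rquestion /= negsum_leqP; split=> [le_h|[S [le_h _]]].
  exists [set i | dec_cost i < 0]; split; last exact: full1.
  by rewrite (eq_bigl (fun i => dec_cost i < 0)) // => i; rewrite inE.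
exact: le_trans (neg_sum_leq _ _) le_h.
Qed.

Lemma rquestion2P : rquestion 2 r <-> dec_question 2 I.
Proof.
rewrite /rquestion /= negsum_leqP has_negP has_cost_leqP; split.
  case/orP=> [/andP[/existsP[i neg] le_h]|/existsP[i le_h]].
    exists [set i | dec_cost i < 0]; split.
      by rewrite (eq_bigl (fun i => dec_cost i < 0)) // => u; rewrite inE.
    by apply/full2/set0Pn; exists i; rewrite inE.
  exists [set i]; rewrite big_set1; split=> //.
  by apply/full2/set0Pn; exists i; rewrite inE.
case=> S [le_h /full2/set0Pn[i iS]].
set b := [exists u, _]; case: (boolP b) => /= [_|].
  by rewrite (le_trans (neg_sum_leq _ S) le_h).
rewrite /b negb_exists => /forallP nonneg; apply/existsP; exists i.
apply: le_trans le_h; rewrite (bigD1 i) //= lerDl.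
by apply: sumr_ge0 => u _; rewrite leNgt; apply: nonneg.
Qed.

End Questions.

Lemma DEC_SCTM_in_P k theta :
  (forall r I, dec_wf k I -> represents r I ->
     rquestion theta r <-> dec_question theta I) ->
  in_P (DEC_SCTM k theta).
Proof.
move=> qP; apply: (in_P_PT (PT_dec_accepts k theta)) => s; split.
  case/and3P => /eqP sE /andP[vf vw] q.
  have [I rI] := valid_represents vf.
  have wfI := iffLR (valid_wfP rI k) vw.
  exists I; split=> //; last exact/(qP _ _ wfI rI).
  by apply/encoded_byP; exists (dec_raw s).1.
case=> I [wfI /encoded_byP[r rI sE] q].
have [decP _ _] := codec_raw.
have rE : (dec_raw s).1 = r by rewrite sE -[enc_raw r]cats0 decP.
rewrite /dec_accepts rE sE eqxx (represents_valid rI) (iffRL (valid_wfP rI k) wfI) /=.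
exact/(qP _ _ wfI rI).
Qed.

Lemma DEC_SCTM1_in_P k : in_P (DEC_SCTM k 1).
Proof. by apply: DEC_SCTM_in_P => r I wfI rI; exact: (rquestion1P wfI rI). Qed.

Lemma DEC_SCTM2_in_P k : in_P (DEC_SCTM k 2).
Proof. by apply: DEC_SCTM_in_P => r I wfI rI; exact: (rquestion2P wfI rI). Qed.

End DecisionProcedure.

(** * Horn rules as hyperedges *)

Definition name := seq nat.
Definition node := seq (seq nat).
Definition rule := (name * name * name)%type.

Section Gadgets.

Variables (k theta : nat).
Hypotheses (theta3 : 3 <= theta) (le_theta_k : theta <= k).

Definition fact (u : name) : node := [:: u].
Definition pads : seq node := [seq [:: [::]; [:: i]] | i <- iota 0 (theta - 3)].
Definition priv (r : rule) (i : nat) : node := [:: [:: i]; r.1.1; r.1.2; r.2].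

Let w := k - theta + 1.

(* The pads are free seeds, which leaves an effective threshold of 3. The first two
   hyperedges together activate all [k - theta + 2 >= 2] private nodes of a rule,
   which then make the third one fire. *)
Definition edge1 (r : rule) : seq node :=
  fact r.1.1 :: fact r.1.2 :: pads ++ [seq priv r i | i <- iota 0 w].
Definition edge2 (r : rule) : seq node :=
  fact r.1.1 :: fact r.1.2 :: pads ++ [seq priv r i | i <- iota 1 w].
Definition edge3 (r : rule) : seq node :=
  fact r.2 :: pads ++ [seq priv r i | i <- iota 0 (w + 1)].

Definition rule_edges (r : rule) := [:: edge1 r; edge2 r; edge3 r].

Lemma size_edge r e : e \in rule_edges r -> size e = k.
Proof.
rewrite !inE => /or3P[] /eqP ->;
  by rewrite /edge1 /edge2 /edge3 /= !size_cat /pads !size_map !size_iota /w; lia.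
Qed.

Lemma uniq_edge r e : r.1.1 != r.1.2 -> e \in rule_edges r -> uniq e.
Proof.
move=> ne.
have up : uniq pads by rewrite map_inj_uniq ?iota_uniq // => i j [].
have upr m n : uniq [seq priv r i | i <- iota m n].
  by rewrite map_inj_uniq ?iota_uniq // => i j [].
have fp u : fact u \notin pads by apply/mapP => -[].
have fpr u m n : fact u \notin [seq priv r i | i <- iota m n] by apply/mapP => -[].
have ppr m n : ~~ has (mem pads) [seq priv r i | i <- iota m n].
  by apply/hasPn => _ /mapP[i _ ->]; apply/mapP => -[].
have ug m n : uniq (pads ++ [seq priv r i | i <- iota m n]).
  by rewrite cat_uniq up upr ppr.
have fg u m n : fact u \notin pads ++ [seq priv r i | i <- iota m n].
  by rewrite mem_cat negb_or fp fpr.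
rewrite !inE => /or3P[] /eqP ->; rewrite /edge1 /edge2 /edge3 !cons_uniq ?inE;
  by rewrite ?negb_or ?ne !fg ug.
Qed.

Definition saturated (P : pred node) (e : seq node) :=
  theta - 1 <= count P e -> all P e.

(* Nodes of length 1 are facts, those of length 2 are pads, and the others are
   private nodes, which are active exactly when both premises are. *)
Definition ext (T : pred name) (v : node) : bool :=
  if size v == 1 then T (head [::] v)
  else (size v == 2) || (T (nth [::] v 1) && T (nth [::] v 2)).

(** Unless both premises hold, no private node is true. Besides the [theta - 3] pads, at most one
    node then counts in each hyperedge, a premise in the first two and the conclusion in the third:
    one too few. *)
Lemma ext_saturated (T : pred name) r e :
  (T r.1.1 -> T r.1.2 -> T r.2) -> e \in rule_edges r -> saturated (ext T) e.
Proof.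
move=> rT; have ap : all (ext T) pads by apply/allP => _ /mapP[i _ ->].
have cp : count (ext T) pads = theta - 3.
  by move: ap; rewrite all_count => /eqP ->; rewrite size_map size_iota.
have ef u : ext T (fact u) = T u by [].
have cpr m n : count (ext T) [seq priv r i | i <- iota m n] = n * (T r.1.1 && T r.1.2).
  by rewrite count_map; elim: n m => //= n IH m; rewrite IH.
have apr m n : T r.1.1 && T r.1.2 -> all (ext T) [seq priv r i | i <- iota m n].
  by move=> t; apply/allP => _ /mapP[i _ ->].
rewrite !inE /saturated => /or3P[] /eqP ->; rewrite /edge1 /edge2 /edge3 /= !ef !count_cat cp cpr all_cat ap.
- case: (T r.1.1) (T r.1.2) apr => -[] apr /=; rewrite ?apr //; lia.
- case: (T r.1.1) (T r.1.2) apr => -[] apr /=; rewrite ?apr //; lia.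
- have {}rT : T r.1.1 && T r.1.2 -> T r.2 by case/andP.
  case: (T r.1.1 && T r.1.2) apr rT => apr rT; first by rewrite apr ?rT.
  by case: (T r.2); lia.
Qed.

Lemma saturated_rule (P : pred node) r :
  (forall e, e \in rule_edges r -> saturated P e) -> all P pads ->
  P (fact r.1.1) -> P (fact r.1.2) -> forall e, e \in rule_edges r -> all P e.
Proof.
move=> satP ap pa pb.
have cp : count P pads = theta - 3.
  by move: ap; rewrite all_count => /eqP ->; rewrite size_map size_iota.
have a1 : all P (edge1 r).
  apply: satP; first by rewrite inE eqxx.
  by rewrite /= pa pb count_cat cp; lia.
have a2 : all P (edge2 r).
  apply: satP; first by rewrite !inE eqxx orbT.
  by rewrite /= pa pb count_cat cp; lia.
have apr : all P [seq priv r i | i <- iota 0 (w + 1)].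
  apply/allP => _ /mapP[[|i] i_lt ->].
    by apply: (allP a1); rewrite !inE mem_cat map_f ?orbT // mem_iota /w; lia.
  apply: (allP a2); rewrite !inE mem_cat map_f ?orbT //.
  by move: i_lt; rewrite !mem_iota; lia.
have a3 : all P (edge3 r).
  apply: satP; first by rewrite !inE eqxx !orbT.
  rewrite /edge3 /= count_cat cp; move: apr; rewrite all_count => /eqP ->.
  by rewrite size_map size_iota; lia.
by move=> e; rewrite !inE => /or3P[] /eqP ->.
Qed.

Lemma PT_rule_edges X {eX : Enc X} (f : X -> rule) :
  PT f -> PT (fun x => rule_edges (f x)).
Proof. by move=> Pf; rewrite /rule_edges /edge1 /edge2 /edge3 /fact /priv; pt. Qed.

End Gadgets.

(** Dummy premises for rules with fewer than two. Two of them are needed because equal premises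
    would make a hyperedge too small. *)
Definition free1 : name := [:: 0; 0].
Definition free2 : name := [:: 0; 1].
Definition goal : name := [:: 5].

Definition rule_facts (rs : seq rule) : seq name :=
  undup (flatten [seq [:: r.1.1; r.1.2; r.2] | r <- rs]).

(** Besides spreading activation from [goal], the added rules make the hypergraph connected. *)
Definition all_rules (rs : seq rule) : seq rule :=
  rs ++ [seq ((goal, free1), u) | u <- rule_facts rs].

Section Instance.

Variables (k theta : nat).
Hypotheses (theta3 : 3 <= theta) (le_theta_k : theta <= k).

Definition medges (rs : seq rule) : seq (seq node) :=
  flatten [seq rule_edges k theta r | r <- all_rules rs].

Definition nodes (rs : seq rule) : seq node := undup (flatten (medges rs)).

Definition free_nodes : seq node := pads theta ++ [:: fact free1; fact free2].

(* With budget [h], no node outside [free_nodes] and [ch] can be a seed. *)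
Definition node_cost (ch : seq name) (h : nat) (v : node) : nat :=
  if v \in free_nodes then 0
  else if v \in [seq fact u | u <- ch] then 1 else h.+1.

(** A node is numbered by its position in [nodes], and hyperedges are listed in that order, as
    [valid_form] requires. *)
Definition horn_raw (p : seq rule * (seq name * nat)) : raw :=
  ((false, binary p.2.2),
   ([seq ((false, binary (node_cost p.2.1 p.2.2 v)), binary 1) | v <- nodes p.1],
    [seq [seq binary iv.1
            | iv <- [seq iv <- zip (iota 0 (size (nodes p.1))) (nodes p.1) | iv.2 \in e]]
       | e <- medges p.1])).

Lemma PT_horn_raw : PT horn_raw.
Proof.
have Pe X (eX : Enc X) (f : X -> seq rule) : PT f -> PT (fun x => medges (f x)).
  move=> Pf; rewrite /medges /all_rules /rule_facts.
  by pt; apply: PT_rule_edges; pt.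
have Pn X (eX : Enc X) (f : X -> seq rule) : PT f -> PT (fun x => nodes (f x)).
  by move=> Pf; rewrite /nodes; pt; apply: Pe; pt.
by rewrite /horn_raw /node_cost /fact; pt; (apply: Pn || apply: Pe); pt.
Qed.

Variables (rs : seq rule) (ch : seq name) (h : nat).

Hypothesis rs_ne : all (fun r => r.1.1 != r.1.2) rs.
Hypothesis goal_in : goal \in rule_facts rs.
Hypothesis free1_in : free1 \in rule_facts rs.

Let V := nodes rs.
Let r := horn_raw (rs, (ch, h)).

Lemma medgesP e :
  e \in medges rs <-> exists2 r, r \in all_rules rs & e \in rule_edges k theta r.
Proof.
split=> [/flatten_mapP[r' r'_in e_in]|[r' r'_in e_in]]; first by exists r'.
by apply/flatten_mapP; exists r'.
Qed.

Lemma medge_uniq e : e \in medges rs -> uniq e.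
Proof.
case/medgesP => r'; rewrite mem_cat => /orP[r'_in|/mapP[u _ ->]].
  by apply: uniq_edge; apply: (allP rs_ne).
exact: uniq_edge.
Qed.

Lemma mem_nodes e v : e \in medges rs -> v \in e -> v \in V.
Proof. by move=> eM ve; rewrite mem_undup; apply/flattenP; exists e. Qed.

Lemma uniq_nodes : uniq V. Proof. exact: undup_uniq. Qed.

Lemma horn_edgeE (e : seq node) :
  [seq binary iv.1 | iv <- [seq iv <- zip (iota 0 (size V)) V | iv.2 \in e]] =
  [seq binary i | i <- [seq i <- iota 0 (size V) | nth [::] V i \in e]].
Proof.
have -> : zip (iota 0 (size V)) V = [seq (i, nth [::] V i) | i <- iota 0 (size V)].
  rewrite -{2}[V](mkseq_nth [::]) /mkseq.
  by elim: (iota _ _) => //= i s ->.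
by rewrite filter_map -map_comp.
Qed.

Lemma horn_valid : valid_form r.
Proof.
apply/and3P; split.
- by rewrite /vint canonical_binary.
- by apply/allP => _ /mapP[v _ ->]; rewrite /vfrac /vint !canonical_binary binary_eq0.
- apply/allP => _ /mapP[e _ ->]; apply/eqP.
  rewrite /rnodes size_map horn_edgeE filter_map; congr map.
  apply: eq_in_filter => i i_in /=.
  rewrite mem_map ?mem_filter ?i_in ?andbT //.
  by move=> m n /(congr1 bval); rewrite !bval_binary.
Qed.

Section Represented.

Variable I : dec_instance.
Hypothesis rI : represents r I.
Let n := hnodes (dec_graph I).
Let vtx (i : 'I_n) : node := nth [::] V i.

Lemma size_V : size V = n.
Proof. by have := size_costs rI; rewrite size_map. Qed.

Lemma vtxV i : vtx i \in V. Proof. by rewrite mem_nth // size_V. Qed.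

Lemma vtx_inj : injective vtx.
Proof.
move=> i j /eqP; rewrite /vtx nth_uniq ?size_V ?uniq_nodes //.
by move/eqP/val_inj.
Qed.

Lemma vtx_surj v : v \in V -> exists i, v = vtx i.
Proof.
move=> vV; have lt : index v V < n by rewrite -size_V index_mem.
by exists (Ordinal lt); rewrite /vtx nth_index.
Qed.

Lemma map_vtx : [seq vtx i | i <- enum 'I_n] = V.
Proof.
rewrite -[RHS](mkseq_nth [::]) /mkseq size_V -val_enum_ord -map_comp.
exact: eq_map.
Qed.

Lemma mem_hedge (e : seq node) j :
  [seq binary iv.1 | iv <- [seq iv <- zip (iota 0 (size V)) V | iv.2 \in e]] =
    [seq binary (val u) | u <- enum (hedge (dec_graph I) j)] ->
  forall i, (i \in hedge (dec_graph I) j) = (vtx i \in e).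
Proof.
move=> E i; rewrite -mem_redge -E horn_edgeE mem_map ?mem_filter; last first.
  by move=> m m' /(congr1 bval); rewrite !bval_binary.
by rewrite mem_iota leq0n add0n size_V (ltn_ord i) !andbT.
Qed.

Lemma hedge_of_medge e : e \in medges rs ->
  exists j, forall i, (i \in hedge (dec_graph I) j) = (vtx i \in e).
Proof.
case: rI => frac [_ _ _ /= E] eM.
have: [seq binary iv.1 | iv <- [seq iv <- zip (iota 0 (size V)) V | iv.2 \in e]]
  \in r.2.2 by apply: map_f.
by rewrite /= E => /mapP[j _ /mem_hedge]; exists j.
Qed.

Lemma medge_of_hedge j :
  exists2 e, e \in medges rs & forall i, (i \in hedge (dec_graph I) j) = (vtx i \in e).
Proof.
case: rI => frac [_ _ _ /= E].
have: [seq binary (val u) | u <- enum (hedge (dec_graph I) j)] \in r.2.2.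
  by rewrite /= E; apply: map_f; rewrite mem_enum.
by case/mapP => e eM /esym/mem_hedge; exists e.
Qed.

Lemma card_hedge (P : pred node) e j : e \in medges rs ->
  (forall i, (i \in hedge (dec_graph I) j) = (vtx i \in e)) ->
  #|[set i | P (vtx i)] :&: hedge (dec_graph I) j| = count P e.
Proof.
move=> eM jE; rewrite cardE -(size_map vtx) -size_filter.
apply/perm_size/uniq_perm.
- by rewrite map_inj_uniq ?enum_uniq //; exact: vtx_inj.
- by rewrite filter_uniq // medge_uniq.
move=> v; rewrite mem_filter; apply/mapP/andP => [[i]|[Pv ve]].
  by rewrite mem_enum !inE jE => /andP[Pi ie] ->.
have [i vE] := vtx_surj (mem_nodes eM ve).
by exists i; rewrite // mem_enum !inE jE -vE Pv.
Qed.

Lemma connect_edge e i j : e \in medges rs -> vtx i \in e -> vtx j \in e ->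
  connect (@hadjacent (dec_graph I)) i j.
Proof.
move=> eM ie je; have [j' jE] := hedge_of_medge eM.
by apply/connect1/existsP; exists j'; rewrite !jE ie.
Qed.

Lemma edge_rule_fact e : e \in medges rs ->
  exists2 u, u \in rule_facts rs & fact u \in e.
Proof.
have rf r' u : r' \in rs -> u \in [:: r'.1.1; r'.1.2; r'.2] -> u \in rule_facts rs.
  by move=> r'_in u_in; rewrite mem_undup; apply/flatten_mapP; exists r'.
case/medgesP => r' r'_in e_in.
have [f1 f2] : r'.1.1 \in rule_facts rs /\ r'.2 \in rule_facts rs.
  move: r'_in; rewrite mem_cat => /orP[r'_in|/mapP[u u_in ->]] //.
  by split; apply: rf r'_in _; rewrite !inE eqxx ?orbT.
by move: e_in; rewrite !inE => /or3P[] /eqP ->; [exists r'.1.1|exists r'.1.1|exists r'.2];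
  rewrite // inE eqxx.
Qed.

(** Connectedness goes through [goal]: the rule deriving [u] from it has a private node that lies
    both in its first hyperedge, with [goal], and in its third, with [u]. Every other node shares a
    hyperedge with a fact. *)
Lemma horn_wf : dec_wf k I.
Proof.
have goal_rule u : u \in rule_facts rs -> ((goal, free1), u) \in all_rules rs.
  by move=> u_in; rewrite mem_cat map_f ?orbT.
have medge r' e : r' \in all_rules rs -> e \in rule_edges k theta r' -> e \in medges rs.
  by move=> ? ?; apply/medgesP; exists r'.
have symh := @hadjacent_sym (dec_graph I).
have e1 u : edge1 k theta ((goal, free1), u) \in rule_edges k theta ((goal, free1), u).
  by rewrite !inE eqxx.
have e3 u : edge3 k theta ((goal, free1), u) \in rule_edges k theta ((goal, free1), u).
  by rewrite !inE eqxx !orbT.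
have goalV : fact goal \in V.
  by apply: mem_nodes (medge _ _ (goal_rule _ goal_in) (e1 _)) _; rewrite inE eqxx.
have [g gE] := vtx_surj goalV.
have fact_conn u i : u \in rule_facts rs -> vtx i = fact u ->
    connect (@hadjacent (dec_graph I)) g i.
  move=> u_in iE; have eM1 := medge _ _ (goal_rule _ u_in) (e1 u).
  have eM3 := medge _ _ (goal_rule _ u_in) (e3 u).
  have p1 : priv ((goal, free1), u) 0 \in edge1 k theta ((goal, free1), u).
    by rewrite !inE mem_cat map_f ?orbT // mem_iota; lia.
  have p3 : priv ((goal, free1), u) 0 \in edge3 k theta ((goal, free1), u).
    by rewrite !inE mem_cat map_f ?orbT // mem_iota; lia.
  have [p pE] := vtx_surj (mem_nodes eM1 p1).
  apply: (@connect_trans _ _ p).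
    by apply: connect_edge eM1 _ _; rewrite -?gE -?pE // inE eqxx.
  by apply: connect_edge eM3 _ _; rewrite -?pE // iE inE eqxx.
have conn i : connect (@hadjacent (dec_graph I)) g i.
  have := vtxV i; rewrite mem_undup => /flattenP[e eM ie].
  have [u u_in ue] := edge_rule_fact eM; have [j jE] := vtx_surj (mem_nodes eM ue).
  apply: connect_trans (fact_conn u j u_in (esym jE)) _.
  by apply: connect_edge eM _ ie; rewrite -jE.
split.
- split; first exact: leq_ltn_trans (leq0n g) (ltn_ord g).
  by move=> u v; apply: connect_trans (conn v); rewrite symh.
- move=> i; have := vtxV i; rewrite mem_undup => /flattenP[e eM ie].
  by have [j jE] := hedge_of_medge eM; exists j; rewrite jE.
- move=> j; have [e eM jE] := medge_of_hedge j.
  have := card_hedge predT eM jE; rewrite count_predT.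
  have /medgesP[r' _ /size_edge-> //] := eM.
  by rewrite (_ : [set i | _] = setT) ?setTI //; apply/setP => i; rewrite !inE.
Qed.

Lemma dec_costE i : dec_cost i = (node_cost ch h (vtx i))%:R%R.
Proof.
case: rI => frac [fP _ E _].
have := congr1 (fun s => nth ((false, [::]), [::]) s i) E.
rewrite /= (nth_map [::]) ?size_V // (nth_map i) ?size_enum_ord // nth_ord_enum.
case: (fP i) => _ -> /(congr1 rfrac_val).
rewrite {2}/rfrac_val /rfrac_of rint_ofK bval_binary.
rewrite /rfrac_val /rint_val ![_.1]/= !bval_binary -surjective_pairing => <-.
by rewrite GRing.divr1.
Qed.

Lemma dec_budgetE : dec_budget I = h.
Proof.
case: rI => frac [_ E _ _].
by rewrite -[LHS]rint_ofK -E /rint_val bval_binary.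
Qed.

(** Leaves vertex numbers and rational costs behind: from here on seeds are predicates on nodes and
    costs are natural numbers. *)
Lemma horn_question :
  dec_question theta I <-> exists A : pred node,
    \sum_(v <- V | A v) node_cost ch h v <= h /\
    forall P : pred node, (forall v, v \in V -> A v -> P v) ->
      (forall e, e \in medges rs -> saturated theta P e) -> all P V.
Proof.
have sumE (S : {set 'I_n}) A : (forall i, (i \in S) = A (vtx i)) ->
    ((\sum_(i in S) dec_cost i <= (dec_budget I)%:~R)%R =
     (\sum_(v <- V | A v) node_cost ch h v <= h)).
  move=> SA; rewrite dec_budgetE -[((h : int)%:~R)%R]/(h%:R)%R.
  rewrite -map_vtx big_map big_enum_cond -(Num.Theory.ler_nat rat) GRing.natr_sum.
  congr (_ <= _)%R; apply: eq_big => [i|i _]; first exact: SA.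
  exact: dec_costE.
have closedE (P : pred node) : edge_closed theta (I := I) [set i | P (vtx i)] <->
    forall e, e \in medges rs -> saturated theta P e.
  split=> [cl e eM le_e|sat j].
    have [j jE] := hedge_of_medge eM.
    have /subsetP sub : hedge (dec_graph I) j \subset [set i | P (vtx i)].
      by apply: cl; rewrite (card_hedge P eM jE).
    apply/allP => v ve.
    have [i vE] := vtx_surj (mem_nodes eM ve).
    have : i \in [set i | P (vtx i)] by apply: sub; rewrite jE -vE.
    by rewrite inE -vE.
  have [e eM jE] := medge_of_hedge j; rewrite (card_hedge P eM jE) => /(sat _ eM)/allP aP.
  by apply/subsetP => i; rewrite inE jE; apply: aP.
split=> [[S [le_h /full_activationP full]]|[A [le_h full]]].
  pose A v := [exists i : 'I_n, (i \in S) && (vtx i == v)].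
  have SA i : (i \in S) = A (vtx i).
    apply/idP/existsP => [iS|[j /andP[jS /eqP/vtx_inj <-]] //].
    by exists i; rewrite iS eqxx.
  exists A; split; first by rewrite -(sumE S).
  move=> P AP sat; have XT : [set i | P (vtx i)] = [set: 'I_n].
    apply: full; last exact/closedE.
    by apply/subsetP => i; rewrite SA inE; apply/AP/vtxV.
  apply/allP => v /vtx_surj[i ->].
  by have /setP/(_ i) := XT; rewrite !inE.
exists [set i | A (vtx i)]; split.
  by rewrite (sumE _ A) // => i; rewrite inE.
apply/full_activationP => X SX cX; apply/setP => i; rewrite inE.
pose P v := [exists u : 'I_n, (u \in X) && (vtx u == v)].
have XP u : (u \in X) = P (vtx u).
  apply/idP/existsP => [uX|[j /andP[jX /eqP/vtx_inj <-]] //].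
  by exists u; rewrite uX eqxx.
rewrite XP; apply: (allP _ _ (vtxV i)); apply: full.
  move=> v /vtx_surj[u ->] Au; rewrite -XP; apply: (subsetP SX).
  by rewrite inE.
apply/closedE; suff -> : [set u | P (vtx u)] = X by [].
by apply/setP => u; rewrite inE XP.
Qed.

End Represented.

End Instance.

(** * Runs of Turing machines as Horn rules *)

(* Cell [i] of tape [j] at time [t] holds the symbol coded by [s]; the head is
   always at cell [T]. *)
Definition nCell (t j i s : nat) : name := [:: 1; t; j; i; s].
(* At time [t] the state and the symbols under the first [j] heads are those
   of the local configuration coded by [g]. *)
Definition nRead (t j g : nat) : name := [:: 2; t; j; g].
Definition nAcc : name := [:: 3].
(* The length of the certificate and its first [i] bits have been chosen. *)
Definition nChosen (i : nat) : name := [:: 4; i].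
Definition nBit (i b : nat) : name := [:: 6; i; b].
Definition nLen (l : nat) : name := [:: 7; l].

Section Machine.

Variables (M : tm) (time len : {poly nat}).

Let K := tm_extra M.
Definition symbol : finType := option (bool + tm_aux M).
Definition reads : finType := {ffun 'I_K.+1 -> symbol}.
Definition local : finType := (tm_state M * reads)%type.

Definition scode (s : symbol) : nat := enum_rank s.
Definition lcode (g : local) : nat := enum_rank g.
Definition bitcode (b : bool) : nat := scode (Some (inl b)).

(** Halted configurations keep idling, so that the outcome can be read at one fixed time. *)
Definition delta (g : local) : tm_state M * {ffun 'I_K.+1 -> symbol * move} :=
  if tm_halt g.1 then (g.1, [ffun j => (g.2 j, MoveStay)]) else tm_trans g.1 g.2.

(** With the head pinned, the new cell [u + 1] is the old cell [u + shift d]; the offset by one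
    avoids subtraction. *)
Definition shift (d : move) : nat :=
  match d with MoveLeft => 0 | MoveStay => 1 | MoveRight => 2 end.

Definition prefix_code (x : seq bool) : seq bool :=
  flatten [seq [:: b; b] | b <- x] ++ [:: false; true].

Definition certlen (x : seq bool) := len.[size x]%R.
Definition inputlen (x : seq bool) := size (prefix_code x) + certlen x.
(** Computed for the longest admissible certificate, so that it depends on [x] alone. *)
Definition runtime (x : seq bool) := time.[inputlen x]%R.

Section Rules.

Variable x : seq bool.
Let T := runtime x.
Let L := certlen x.
Let off := size (prefix_code x).

(** A transition depends on the state and on all heads, but a rule has two premises only. So
    [RuleStart] and [RuleNext] assert the state together with every possible guess of the symbols
    read, and [RuleRead] confirms a guess head by head. This predicate serves case analysis; the
    lists below serve computation. *)
Inductive is_rule : rule -> Prop :=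
  | RuleStart f : is_rule (free1, free2, nRead 0 0 (lcode (tm_start M, f)))
  | RulePrefix i of i < off :
      is_rule (free1, free2, nCell 0 0 (T + i) (bitcode (nth false (prefix_code x) i)))
  | RuleBlank j i of j < K.+1 & i < (T + T).+1 & (j != 0) || ~~ (T <= i < T + (off + L)) :
      is_rule (free1, free2, nCell 0 j i (scode None))
  | RuleBit l i (b : bool) of l < L.+1 & i < L & i < l :
      is_rule (nLen l, nBit i b, nCell 0 0 (T + off + i) (bitcode b))
  | RuleNoBit l i of l < L.+1 & i < L & l <= i :
      is_rule (nLen l, free1, nCell 0 0 (T + off + i) (scode None))
  | RuleRead t (g : local) (j : 'I_K.+1) of t < T :
      is_rule (nRead t j (lcode g), nCell t j T (scode (g.2 j)), nRead t j.+1 (lcode g))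
  | RuleNext t (g : local) f of t < T :
      is_rule (nRead t K.+1 (lcode g), free1, nRead t.+1 0 (lcode ((delta g).1, f)))
  | RuleHead t (g : local) (j : 'I_K.+1) u of t < T & u < T + T
      & u + shift ((delta g).2 j).2 = T :
      is_rule (nRead t K.+1 (lcode g), free1, nCell t.+1 j u.+1 (scode ((delta g).2 j).1))
  | RuleCell t (g : local) (j : 'I_K.+1) u s of t < T & u < T + T
      & u + shift ((delta g).2 j).2 != T :
      is_rule (nRead t K.+1 (lcode g), nCell t j (u + shift ((delta g).2 j).2) (scode s),
               nCell t.+1 j u.+1 (scode s))
  | RuleAccept (g : local) of tm_accept g.1 :
      is_rule (nRead T 0 (lcode g), free1, nAcc)
  | RuleChosen0 l of l < L.+1 : is_rule (nLen l, free1, nChosen 0)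
  | RuleChosenS i (b : bool) of i < L : is_rule (nChosen i, nBit i b, nChosen i.+1)
  | RuleGoal : is_rule (nChosen L, nAcc, goal).

End Rules.

(** For a fixed machine these finite tables are constants, so no code of a state or symbol has to be
    computed from the input. *)
Definition startT := [seq lcode (tm_start M, f) | f <- enum reads].
Definition readT := [seq (lcode gj.1, (val gj.2, scode (gj.1.2 gj.2)))
  | gj <- enum {: local * 'I_K.+1}].
Definition nextT := [seq (lcode gf.1, lcode ((delta gf.1).1, gf.2))
  | gf <- enum {: local * reads}].
Definition cellT := [seq (lcode gj.1, (val gj.2,
    (shift ((delta gj.1).2 gj.2).2, scode ((delta gj.1).2 gj.2).1)))
  | gj <- enum {: local * 'I_K.+1}].
Definition acceptT := [seq lcode g | g <- enum local & tm_accept g.1].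
Definition symbolT := [seq scode s | s <- enum symbol].
Definition bitT := [:: (0, bitcode false); (1, bitcode true)].

Definition start_rules : seq rule := [seq (free1, free2, nRead 0 0 g) | g <- startT].

Definition prefix_rules x : seq rule :=
  [seq (free1, free2, nCell 0 0 (runtime x + ib.1)
      (if ib.2 then bitcode true else bitcode false))
    | ib <- zip (iota 0 (size (prefix_code x))) (prefix_code x)].

Definition blank_rules x : seq rule :=
  flatten [seq [seq (free1, free2, nCell 0 j i (scode None))
      | i <- [seq i <- iota 0 (runtime x + runtime x).+1 | (j != 0) ||
          (i \notin [seq runtime x + u | u <- iota 0 (inputlen x)])]]
    | j <- iota 0 K.+1].

(** The comparison of [i] with [l] is a membership test because that operation is already known to
    be polynomial. *)
Definition certificate_rules x : seq rule :=
  flatten [seq flatten [seq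
      if i \in iota 0 l then
        [seq (nLen l, nBit i b.1, nCell 0 0 (runtime x + size (prefix_code x) + i) b.2)
          | b <- bitT]
      else [:: (nLen l, free1,
                nCell 0 0 (runtime x + size (prefix_code x) + i) (scode None))]
      | i <- iota 0 (certlen x)]
    | l <- iota 0 (certlen x).+1].

Definition read_rules x : seq rule :=
  flatten [seq
    [seq (nRead t e.2.1 e.1, nCell t e.2.1 (runtime x) e.2.2, nRead t e.2.1.+1 e.1)
      | e <- readT] | t <- iota 0 (runtime x)].

Definition next_rules x : seq rule :=
  flatten [seq [seq (nRead t K.+1 e.1, free1, nRead t.+1 0 e.2) | e <- nextT]
    | t <- iota 0 (runtime x)].

Definition cell_rules x : seq rule :=
  flatten [seq flatten [seq flatten [seq
        if u + e.2.2.1 == runtime x then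
          [:: (nRead t K.+1 e.1, free1, nCell t.+1 e.2.1 u.+1 e.2.2.2)]
        else [seq (nRead t K.+1 e.1, nCell t e.2.1 (u + e.2.2.1) s,
                   nCell t.+1 e.2.1 u.+1 s) | s <- symbolT]
        | e <- cellT]
      | u <- iota 0 (runtime x + runtime x)]
    | t <- iota 0 (runtime x)].

Definition accept_rules x : seq rule :=
  [seq (nRead (runtime x) 0 g, free1, nAcc) | g <- acceptT].

Definition chosen_rules x : seq rule :=
  [seq (nLen l, free1, nChosen 0) | l <- iota 0 (certlen x).+1] ++
  flatten [seq [seq (nChosen i, nBit i b.1, nChosen i.+1) | b <- bitT]
    | i <- iota 0 (certlen x)] ++
  [:: (nChosen (certlen x), nAcc, goal)].

Definition tm_rules (x : seq bool) : seq rule :=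
  start_rules ++ prefix_rules x ++ blank_rules x ++ certificate_rules x ++
  read_rules x ++ next_rules x ++ cell_rules x ++ accept_rules x ++ chosen_rules x.

Definition choices (x : seq bool) : seq name :=
  [seq nLen l | l <- iota 0 (certlen x).+1] ++
  flatten [seq [seq nBit i b.1 | b <- bitT] | i <- iota 0 (certlen x)].

Lemma PT_tm_rules : PT tm_rules.
Proof.
rewrite /tm_rules /prefix_rules /blank_rules /certificate_rules /read_rules /next_rules
  /cell_rules /accept_rules /chosen_rules /inputlen /runtime /inputlen /certlen
  /prefix_code /nCell /nRead /nLen /nBit /nChosen.
by pt.
Qed.

Lemma PT_choices : PT choices.
Proof. by rewrite /choices /certlen /nBit /nLen; pt. Qed.

Lemma PT_certlen : PT certlen.
Proof. by rewrite /certlen; pt. Qed.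

Lemma bitTP b s : (b, s) \in bitT <-> exists c : bool, b = c /\ s = bitcode c.
Proof.
rewrite !inE; split=> [/orP[] /eqP[-> ->]|[[] [-> ->]]]; rewrite ?eqxx ?orbT //.
  by exists false.
by exists true.
Qed.

Lemma mem_tm_rules x r : (r \in tm_rules x) =
  [|| r \in start_rules, r \in prefix_rules x, r \in blank_rules x,
      r \in certificate_rules x, r \in read_rules x, r \in next_rules x,
      r \in cell_rules x, r \in accept_rules x | r \in chosen_rules x].
Proof.
rewrite /tm_rules; move: start_rules (prefix_rules x) (blank_rules x).
move: (certificate_rules x) (read_rules x) (next_rules x) (cell_rules x).
by move: (accept_rules x) (chosen_rules x) => *; rewrite !mem_cat.
Qed.

Lemma tm_rules_is_rule x r : r \in tm_rules x -> is_rule x r.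
Proof.
rewrite mem_tm_rules.
case/orP=> [/mapP[_ /mapP[f _ ->] ->]|]; first by constructor.
case/orP=> [/mapP[[i b] ib ->]|].
  have /andP[i_lt /eqP ->] : (i < size (prefix_code x)) && (b == nth false (prefix_code x) i).
    have /(nthP (0, false))[m] := ib.
    rewrite size_zip size_iota minnn => m_lt.
    by rewrite nth_zip ?size_iota // nth_iota // => -[<- <-]; rewrite m_lt eqxx.
  rewrite (_ : (if _ then _ else _) = bitcode (nth false (prefix_code x) i)).
    by constructor.
  by rewrite /=; case: nth.
case/orP=> [/flatten_mapP[j]|].
  rewrite mem_iota => /andP[_ lt_j] /mapP[i]; rewrite mem_filter mem_iota.
  case/and3P => ji _ lt_i ->; constructor=> //.
  apply: contraTT ji; rewrite negb_or negbK => /andP[/eqP -> /=].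
  rewrite negbK => /andP[le_i lt_i2]; apply/negPn/mapP; exists (i - runtime x); last by lia.
  by rewrite mem_iota /inputlen; lia.
case/orP=> [/flatten_mapP[l]|].
  rewrite mem_iota => /andP[_ lt_l] /flatten_mapP[i]; rewrite mem_iota => /andP[_ lt_i].
  rewrite mem_iota; case: ifP => [il|/negbT il].
    by case/mapP => -[b s] /bitTP[c [-> ->]] ->; constructor; move: il; lia.
  by rewrite inE => /eqP ->; constructor; move: il; lia.
case/orP=> [/flatten_mapP[t]|].
  rewrite mem_iota => /andP[_ lt_t] /mapP[_ /mapP[[g j] _ ->] ->] /=.
  by constructor.
case/orP=> [/flatten_mapP[t]|].
  rewrite mem_iota => /andP[_ lt_t] /mapP[_ /mapP[[g f] _ ->] ->] /=.
  by constructor.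
case/orP=> [/flatten_mapP[t]|].
  rewrite mem_iota => /andP[_ lt_t] /flatten_mapP[u]; rewrite mem_iota => /andP[_ lt_u].
  case/flatten_mapP => _ /mapP[[g j] _ ->] /=; case: eqP => [uT|/eqP uT].
    by rewrite inE => /eqP ->; constructor.
  by case/mapP => _ /mapP[s _ ->] ->; constructor.
case/orP=> [/mapP[c /mapP[g]]|].
  by rewrite mem_filter => /andP[acc _] -> ->; constructor.
rewrite !mem_cat; case/or3P => [/mapP[l]|/flatten_mapP[i]|].
- by rewrite mem_iota => /andP[_ lt_l] ->; constructor.
- rewrite mem_iota => /andP[_ lt_i] /mapP[[b s] /bitTP[c [-> _]] ->].
  by constructor.
- by rewrite inE => /eqP ->; constructor.
Qed.

Lemma is_rule_tm_rules x r : is_rule x r -> r \in tm_rules x.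
Proof.
case=> [f|i lt_i|j i lt_j lt_i ji|l i b lt_l lt_i il|l i lt_l lt_i il|t g j lt_t
  |t g f lt_t|t g j u lt_t lt_u uT|t g j u s lt_t lt_u uT|g acc|l lt_l|i b lt_i|].
- suff H : (free1, free2, nRead 0 0 (lcode (tm_start M, f))) \in start_rules.
    by rewrite mem_tm_rules H.
  by apply/map_f/map_f; rewrite mem_enum.
- suff H : (free1, free2, nCell 0 0 (runtime x + i)
    (bitcode (nth false (prefix_code x) i))) \in prefix_rules x by rewrite mem_tm_rules H !orbT.
  apply/mapP; exists (i, nth false (prefix_code x) i); last by rewrite /=; case: nth.
  apply/(nthP (0, false)); exists i; first by rewrite size_zip size_iota minnn.
  by rewrite nth_zip ?size_iota // nth_iota.
- suff H : (free1, free2, nCell 0 j i (scode None)) \in blank_rules x.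
    by rewrite mem_tm_rules H !orbT.
  apply/flatten_mapP; exists j; first by rewrite mem_iota.
  apply/mapP; exists i => //; rewrite mem_filter mem_iota leq0n add0n lt_i !andbT.
  apply: contraTT ji; rewrite negb_or negbK => /andP[/eqP -> /=].
  by rewrite !negbK => /mapP[u]; rewrite mem_iota /inputlen => u_lt ->; lia.
- suff H : (nLen l, nBit i b, nCell 0 0 (runtime x + size (prefix_code x) + i) (bitcode b))
    \in certificate_rules x by rewrite mem_tm_rules H !orbT.
  apply/flatten_mapP; exists l; first by rewrite mem_iota.
  apply/flatten_mapP; exists i; first by rewrite mem_iota.
  rewrite mem_iota add0n il; apply/mapP; exists (nat_of_bool b, bitcode b) => //.
  by apply/bitTP; exists b.
- suff H : (nLen l, free1, nCell 0 0 (runtime x + size (prefix_code x) + i) (scode None))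
    \in certificate_rules x by rewrite mem_tm_rules H !orbT.
  apply/flatten_mapP; exists l; first by rewrite mem_iota.
  apply/flatten_mapP; exists i; first by rewrite mem_iota.
  by rewrite mem_iota add0n ltnNge il inE.
- suff H : (nRead t j (lcode g), nCell t j (runtime x) (scode (g.2 j)),
    nRead t j.+1 (lcode g)) \in read_rules x by rewrite mem_tm_rules H !orbT.
  apply/flatten_mapP; exists t; first by rewrite mem_iota.
  apply/mapP; exists (lcode g, (val j, scode (g.2 j))) => //.
  by apply/mapP; exists (g, j); rewrite ?mem_enum.
- suff H : (nRead t K.+1 (lcode g), free1, nRead t.+1 0 (lcode ((delta g).1, f)))
    \in next_rules x by rewrite mem_tm_rules H !orbT.
  apply/flatten_mapP; exists t; first by rewrite mem_iota.
  apply/mapP; exists (lcode g, lcode ((delta g).1, f)) => //.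
  by apply/mapP; exists (g, f); rewrite ?mem_enum.
- suff H : (nRead t K.+1 (lcode g), free1,
    nCell t.+1 j u.+1 (scode ((delta g).2 j).1)) \in cell_rules x.
    by rewrite mem_tm_rules H !orbT.
  apply/flatten_mapP; exists t; first by rewrite mem_iota.
  apply/flatten_mapP; exists u; first by rewrite mem_iota.
  apply/flatten_mapP; exists (lcode g, (val j, (shift ((delta g).2 j).2,
    scode ((delta g).2 j).1))); first by apply/mapP; exists (g, j); rewrite ?mem_enum.
  by rewrite /= uT eqxx inE.
- suff H : (nRead t K.+1 (lcode g), nCell t j (u + shift ((delta g).2 j).2) (scode s),
    nCell t.+1 j u.+1 (scode s)) \in cell_rules x by rewrite mem_tm_rules H !orbT.
  apply/flatten_mapP; exists t; first by rewrite mem_iota.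
  apply/flatten_mapP; exists u; first by rewrite mem_iota.
  apply/flatten_mapP; exists (lcode g, (val j, (shift ((delta g).2 j).2,
    scode ((delta g).2 j).1))); first by apply/mapP; exists (g, j); rewrite ?mem_enum.
  rewrite /= (negbTE uT); apply/mapP; exists (scode s) => //.
  by apply: map_f; rewrite mem_enum.
- suff H : (nRead (runtime x) 0 (lcode g), free1, nAcc) \in accept_rules x.
    by rewrite mem_tm_rules H !orbT.
  by apply/mapP; exists (lcode g) => //; apply: map_f; rewrite mem_filter acc mem_enum.
- suff H : (nLen l, free1, nChosen 0) \in chosen_rules x by rewrite mem_tm_rules H !orbT.
  by rewrite mem_cat map_f // mem_iota.
- suff H : (nChosen i, nBit i b, nChosen i.+1) \in chosen_rules x.
    by rewrite mem_tm_rules H !orbT.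
  rewrite !mem_cat; apply/orP; right; apply/orP; left.
  apply/flatten_mapP; exists i; first by rewrite mem_iota.
  by apply/mapP; exists (nat_of_bool b, bitcode b) => //; apply/bitTP; exists b.
- suff H : (nChosen (certlen x), nAcc, goal) \in chosen_rules x.
    by rewrite mem_tm_rules H !orbT.
  by rewrite !mem_cat mem_seq1 eqxx !orbT.
Qed.

Lemma choicesP x u : u \in choices x <->
  (exists2 l, l < (certlen x).+1 & u = nLen l) \/
  (exists i (b : bool), i < certlen x /\ u = nBit i b).
Proof.
rewrite mem_cat; split.
  case/orP => [/mapP[l]|/flatten_mapP[i]]; rewrite mem_iota => /andP[_ lt].
    by move=> ->; left; exists l.
  by case/mapP => -[b s] /bitTP[c [-> _]] ->; right; exists i, c.
case=> [[l lt ->]|[i [b [lt ->]]]]; apply/orP; [left|right].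
  by apply: map_f; rewrite mem_iota.
apply/flatten_mapP; exists i; first by rewrite mem_iota.
by apply/mapP; exists (nat_of_bool b, bitcode b) => //; apply/bitTP; exists b.
Qed.

Lemma rule_premises_neq x : all (fun r : rule => r.1.1 != r.1.2) (tm_rules x).
Proof. by apply/allP => r /tm_rules_is_rule[]. Qed.

Lemma goal_in_facts x : goal \in rule_facts (tm_rules x).
Proof.
rewrite mem_undup; apply/flatten_mapP.
exists (nChosen (certlen x), nAcc, goal); last by rewrite !inE eqxx !orbT.
by apply: is_rule_tm_rules; constructor.
Qed.

Lemma free1_in_facts x : free1 \in rule_facts (tm_rules x).
Proof.
rewrite mem_undup; apply/flatten_mapP.
exists (nLen 0, free1, nChosen 0); last by rewrite !inE eqxx !orbT.
by apply: is_rule_tm_rules; constructor.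
Qed.

End Machine.

(* The cells of a tape numbered so that the head is at cell [c]. *)
Definition tcell A (c : nat) (tp : tape A) (i : nat) : option A :=
  if i < c then nth None (tape_left tp) (c - i.+1)
  else nth None (tape_head tp :: tape_right tp) (i - c).

Lemma tcell_head A c (tp : tape A) : tcell c tp c = tape_head tp.
Proof. by rewrite /tcell ltnn subnn. Qed.

(** The benefit of pinning the head: the source of a cell depends on the move only, and the written
    symbol appears exactly where that source is the head cell. *)
Lemma tcell_step A c (tp : tape A) a d u :
  tcell c (tape_move d (tape_write a tp)) u.+1 =
    if u + shift d == c then a else tcell c tp (u + shift d).
Proof.
case: tp => l h r; case: d; rewrite /tcell /= ?addn0 ?addn1 ?addn2.
- case: eqP => h2.
    by rewrite ifN; [rewrite (_ : u.+1 - c = 1) //; lia | lia].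
  case: (ltnP u c) => h3; case: ltnP => h1; try lia.
  + by rewrite nth_behead; congr nth; lia.
  + rewrite (_ : c - u.+1 = 0); last by lia.
    by rewrite (_ : u.+1 - c = 0); [case: l | lia].
  + rewrite (_ : u.+1 - c = (u - c).+1); last by lia.
    by rewrite (_ : u - c = (u - c).-1.+1) //; lia.
- case: eqP => h2.
    by rewrite ifN; [rewrite (_ : u.+1 - c = 0) //; lia | lia].
  case: ltnP => h1 //.
  by rewrite (_ : u.+1 - c = (u - c).+1) //; lia.
- case: eqP => h2.
    by rewrite ifT; [rewrite (_ : c - u.+2 = 0) //; lia | lia].
  case: (ltnP u.+2 c) => h3; case: ltnP => h1; try lia.
  + by rewrite (_ : c - u.+2 = (c - u.+3).+1) //; lia.
  + rewrite (_ : u.+2 - c = (u.+1 - c).+1); last by lia.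
    by case: r => [|b r]; case: (u.+1 - c) => [|m] /=; rewrite ?nth_nil.
Qed.

Lemma tcell_init A c (s : seq A) i :
  tcell c (tape_of_seq s) i = if i < c then None else nth None [seq Some a | a <- s] (i - c).
Proof.
rewrite /tcell /=; case: ifP => _; first by rewrite nth_nil.
by case: s => [|a s] //=; case: (i - c) => //= n; rewrite nth_nil.
Qed.

(** * Derivable facts and the actual run *)

Section Run.

Variables (M : tm) (time len : {poly nat}) (x y : seq bool).

Let K := tm_extra M.
Let T := runtime time len x.
Let L := certlen len x.
Let off := size (prefix_code x).
Let run t := tm_run M (pair_code x y) t.

Hypothesis le_y : size y <= L.

Definition local_at t : local M :=
  (cfg_state (run t), [ffun j => tape_head (cfg_tape (run t) j)]).

Lemma runS t : run t.+1 = tm_step (run t). Proof. by []. Qed.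

Lemma run_state t : cfg_state (run t.+1) = (delta (local_at t)).1.
Proof. by rewrite runS /tm_step /delta /=; case: (tm_halt _). Qed.

Lemma run_cell t j c u : tcell c (cfg_tape (run t.+1) j) u.+1 =
  let a := (delta (local_at t)).2 j in
  if u + shift a.2 == c then a.1 else tcell c (cfg_tape (run t) j) (u + shift a.2).
Proof.
rewrite runS /tm_step /delta /=; case: (tm_halt _) => /=; last by rewrite ffunE tcell_step.
(* Idling is rewriting the scanned symbol and staying. *)
rewrite !ffunE -(tcell_step c (cfg_tape (run t) j) _ MoveStay) /=.
by case: (cfg_tape _ _).
Qed.

Lemma pair_codeE : pair_code x y = prefix_code x ++ y.
Proof. by rewrite /pair_code /prefix_code -catA. Qed.

Lemma init_cell0 i : tcell T (cfg_tape (run 0) ord0) (T + i) =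
  if i < off then Some (inl (nth false (prefix_code x) i))
  else if i - off < size y then Some (inl (nth false y (i - off))) else None.
Proof.
rewrite /run /= ffunE eqxx tcell_init ltnNge leq_addr /= addKn pair_codeE -map_comp.
have [lt_i|le_i] := ltnP i (size (prefix_code x ++ y)); last first.
  rewrite nth_default ?size_map //; move: le_i; rewrite size_cat -/off => le_i.
  by rewrite ifN ?ifN //; lia.
rewrite (nth_map false) //= nth_cat -/off; case: ltnP => // le_i.
by rewrite ifT //; move: lt_i; rewrite size_cat -/off; lia.
Qed.

Lemma init_cell_blank j i : (nat_of_ord j != 0) || ~~ (T <= i < T + (off + L)) ->
  tcell T (cfg_tape (run 0) j) i = None.
Proof.
have [->|j0] /= := eqVneq j ord0.
  have [lt_i|le_i] := ltnP i T; first by rewrite /run /= ffunE eqxx tcell_init lt_i.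
  rewrite -(subnKC le_i) init_cell0 => out; rewrite ifN; last by lia.
  by rewrite ifN //; lia.
by move=> _; rewrite /run /= ffunE (negbTE j0) tcell_init nth_nil; case: ifP.
Qed.

Section Completeness.

Variable D : pred name.
Hypothesis D_rule : forall r, is_rule M time len x r -> D r.1.1 -> D r.1.2 -> D r.2.
Hypotheses (D1 : D free1) (D2 : D free2) (Dlen : D (nLen (size y))).
Hypothesis Dbit : forall i, i < L -> D (nBit i (nth false y i)).

Lemma derive_init (j : 'I_K.+1) i : i <= T + T ->
  D (nCell 0 j i (scode (tcell T (cfg_tape (run 0) j) i))).
Proof.
move=> le_i.
have [blank|] := boolP ((nat_of_ord j != 0) || ~~ (T <= i < T + (off + L))).
  rewrite init_cell_blank //.
  exact: (D_rule (RuleBlank (M := M) (time := time) (ltn_ord j) (le_i : i < (T + T).+1) blank)).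
rewrite negb_or !negbK => /andP[/eqP j0 /andP[le_Ti lt_i]].
have -> : j = ord0 by apply: val_inj.
rewrite -(subnKC le_Ti) init_cell0.
case: ltnP => [lt_off|le_off]; first exact: (D_rule (RulePrefix M time len lt_off)).
have [m mE] : exists m, i - T = off + m by exists (i - T - off); lia.
have lt_m : m < L by lia.
have lt_yL : size y < L.+1 by rewrite ltnS.
rewrite mE addKn addnA; case: ltnP => [lt_y|ge_y].
  have := @RuleBit M time len x (size y) m (nth false y m) lt_yL lt_m lt_y.
  by move/D_rule; apply; [exact: Dlen | exact: Dbit].
have := @RuleNoBit M time len x (size y) m lt_yL lt_m ge_y.
by move/D_rule; apply.
Qed.

(** A cell depends on its neighbours, so each step loses one cell at either end of the initial
    [2 T + 1]. The head cell [T] is still covered at time [T]. *)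
Lemma derive_run t : t <= T ->
  (forall f, D (nRead t 0 (lcode ((local_at t).1, f)))) /\
  (forall (j : 'I_K.+1) i, t <= i -> i + t <= T + T ->
     D (nCell t j i (scode (tcell T (cfg_tape (run t) j) i)))).
Proof.
elim: t => [|t IH] lt_t.
  split=> [f|j i _ le_i]; last by apply: derive_init; rewrite -[i]addn0.
  exact: (D_rule (RuleStart time len x f)).
have [Dstate Dcell] := IH (ltnW lt_t).
have Dread j : j <= K.+1 -> D (nRead t j (lcode (local_at t))).
  elim: j => [_|j IHj lt_j]; first by rewrite [local_at t]surjective_pairing; apply: Dstate.
  apply: (D_rule (RuleRead (local_at t) (Ordinal lt_j) lt_t)).
    by apply: IHj; apply: ltnW.
  rewrite /= ffunE -(tcell_head T); apply: (Dcell (Ordinal lt_j)); first exact: ltnW.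
  by rewrite leq_add2l ltnW.
have Dfull := Dread _ (leqnn _).
split=> [f|j [//|u] le_t le_u].
  rewrite /local_at run_state; exact: (D_rule (RuleNext (local_at t) f lt_t)).
rewrite run_cell /=; have lt_u : u < T + T by lia.
case: eqP => [uT|/eqP uT].
  exact: (D_rule (RuleHead lt_t lt_u uT)).
apply: (D_rule (RuleCell _ lt_t lt_u uT)) => //.
have shift2 d : shift d <= 2 by case: d.
by apply: Dcell; have := shift2 ((delta (local_at t)).2 j).2; lia.
Qed.

Lemma derive_goal : tm_accept (cfg_state (run T)) -> D goal.
Proof.
move=> acc; have [Dstate _] := derive_run (leqnn T).
have DA : D nAcc.
  by apply: (D_rule (RuleAccept time len x (g := local_at T) acc)) => //;
    rewrite [local_at T]surjective_pairing; apply: Dstate.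
have DC i : i <= L -> D (nChosen i).
  elim: i => [_|i IH lt_i].
    by apply: (D_rule (RuleChosen0 M time _)) Dlen D1; rewrite ltnS.
  exact: (D_rule (RuleChosenS M time (nth false y i) lt_i)) (IH (ltnW lt_i)) (Dbit lt_i).
exact: (D_rule (RuleGoal M time len x)) (DC _ (leqnn _)) DA.
Qed.

End Completeness.

(* The facts that hold in the run on [pair_code x y]. *)
Definition truth (bit : nat -> bool) (u : name) : bool :=
  match u with
  | [:: 1; t; j; i; s] => s == scode (tcell T (cfg_tape (run t) (inord j)) i)
  | [:: 2; t; j; g] => [exists g' : local M, [&& lcode g' == g, g'.1 == (local_at t).1
      & [forall i : 'I_K.+1, (i < j) ==> (g'.2 i == (local_at t).2 i)]]]
  | [:: 3] | [:: 5] => tm_accept (cfg_state (run T))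
  | [:: 6; i; b] => b == bit i
  | [:: 7; l] => l == size y
  | _ => true
  end.

Lemma scode_inj : injective (@scode M).
Proof. by move=> s s' /val_inj/enum_rank_inj. Qed.

Lemma lcode_inj : injective (@lcode M).
Proof. by move=> g g' /val_inj/enum_rank_inj. Qed.

(** Once every head has confirmed it, a guess is the actual local configuration. *)
Lemma truth_full t g : [exists g' : local M, [&& lcode g' == lcode g, g'.1 == (local_at t).1
      & [forall i : 'I_K.+1, (i < K.+1) ==> (g'.2 i == (local_at t).2 i)]]] -> g = local_at t.
Proof.
case/existsP => g' /and3P[/eqP/lcode_inj-> /eqP g1 /forallP g2].
rewrite [g]surjective_pairing [local_at t]surjective_pairing g1; congr pair.
by apply/ffunP => i; apply/eqP; have := g2 i; rewrite ltn_ord.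
Qed.

(** Bits are also chosen at positions beyond the chosen length, but no cell depends on them; hence
    [bit] is tied to [y] only below its size. *)
Lemma truth_rule bit r : (forall i, i < size y -> nth false y i = bit i) ->
  is_rule M time len x r -> truth bit r.1.1 -> truth bit r.1.2 -> truth bit r.2.
Proof.
move=> bitE.
case=> [f|i lt_i|j i lt_j lt_i ji|l i b lt_l lt_i il|l i lt_l lt_i il|t g j lt_t
  |t g f lt_t|t g j u lt_t lt_u uT|t g j u s lt_t lt_u uT|g acc|l lt_l|i b lt_i|] //=.
- move=> _ _; apply/existsP; exists (tm_start M, f); rewrite !eqxx /=.
  exact/forallP.
- move=> _ _; rewrite (_ : inord 0 = ord0); last by apply: val_inj; rewrite /= inordK.
  by rewrite init_cell0 lt_i.
- by move=> _ _; rewrite init_cell_blank // inordK.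
- move=> /eqP lE /eqP bE; rewrite (_ : inord 0 = ord0); last by apply: val_inj; rewrite /= inordK.
  rewrite -addnA init_cell0 ltnNge leq_addr /= addKn; rewrite lE in il *; rewrite il bitE //.
  by apply/eqP; congr scode; move: bE; case: (b) => /=; case: (bit i).
- move=> /eqP lE _; rewrite (_ : inord 0 = ord0); last by apply: val_inj; rewrite /= inordK.
  by rewrite -addnA init_cell0 ltnNge leq_addr /= addKn -lE ltnNge il.
- case/existsP => g' /and3P[/eqP/lcode_inj-> g1 /forallP g2] /eqP/scode_inj.
  rewrite inord_val tcell_head => gj; apply/existsP; exists g; rewrite eqxx g1 /=.
  apply/forallP => i; apply/implyP; rewrite ltnS leq_eqVlt => /orP[/eqP/val_inj ->|lt_i].
    by rewrite gj ffunE.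
  by have := g2 i; rewrite lt_i.
- move=> /truth_full-> _; apply/existsP; exists ((delta (local_at t)).1, f).
  by rewrite eqxx /= run_state eqxx; apply/forallP.
- by move=> /truth_full gE _; rewrite inord_val run_cell -gE /= uT !eqxx.
- move=> /truth_full gE /eqP ->.
  by rewrite !inord_val run_cell -gE /= (negbTE uT).
- by case/existsP => g' /and3P[/eqP/lcode_inj-> /eqP <-].
Qed.

End Run.

Lemma uniq_map_in_inj (S R : eqType) (f : S -> R) s :
  uniq (map f s) -> {in s &, injective f}.
Proof.
elim: s => //= a s IH /andP[fa us] u v; rewrite !inE.
case/orP=> [/eqP ->|us']; case/orP=> [/eqP -> //|vs] fE.
- by rewrite fE map_f in fa.
- by rewrite -fE map_f in fa.
- exact: IH.
Qed.

(** * Accepted certificates and seed sets within the budget *)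

Section Reduction.

Variables (k theta : nat).
Hypotheses (theta3 : 3 <= theta) (le_theta_k : theta <= k).
Variables (M : tm) (time len : {poly nat}) (x : seq bool).

Let T := runtime time len x.
Let L := certlen len x.
Let rs := tm_rules M time len x.
Let ch := choices M len x.
Let V := nodes k theta rs.
Let cost := node_cost theta ch L.+1.

Lemma tm_rule_facts r u : r \in rs -> u \in [:: r.1.1; r.1.2; r.2] -> u \in rule_facts rs.
Proof. by move=> r_in u_in; rewrite mem_undup; apply/flatten_mapP; exists r. Qed.

Lemma fact_in_nodes u : u \in rule_facts rs -> fact u \in V.
Proof.
move=> u_in; have r_in : ((goal, free1), u) \in all_rules rs.
  by rewrite mem_cat map_f ?orbT.
apply: (@mem_nodes _ _ _ (edge3 k theta ((goal, free1), u))); last by rewrite inE eqxx.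
by apply/medgesP; exists ((goal, free1), u); rewrite // !inE eqxx !orbT.
Qed.

Lemma choice_not_free v : v \in [seq fact u | u <- ch] -> v \notin free_nodes theta.
Proof.
case/mapP => u u_in ->; rewrite mem_cat negb_or; apply/andP; split.
  by apply/mapP => -[].
by case/choicesP: u_in => [[l _ ->]|[i [b [_ ->]]]].
Qed.

Definition horn_solution (A : pred node) :=
  \sum_(v <- V | A v) cost v <= L.+1 /\
  forall P : pred node, (forall v, v \in V -> A v -> P v) ->
    (forall e, e \in medges k theta rs -> saturated theta P e) -> all P V.

Lemma certificate_solution y : size y <= L ->
  tm_accept (cfg_state (tm_run M (pair_code x y) T)) -> exists A, horn_solution A.
Proof.
move=> le_y acc.
(* Positions beyond the end of [y] receive the default bit, since the chain to [goal] asks for a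
   choice at each of the [L] positions. *)
pose sel := [seq fact u | u <- nLen (size y) :: [seq nBit i (nth false y i) | i <- iota 0 L]].
have size_sel : size sel = L.+1 by rewrite /= !size_map size_iota.
have sel_ch v : v \in sel -> v \in [seq fact u | u <- ch].
  case/mapP => u u_in ->; apply/map_f/choicesP; move: u_in.
  rewrite inE => /orP[/eqP ->|/mapP[i i_in ->]]; first by left; exists (size y).
  by right; exists i, (nth false y i); move: i_in; rewrite mem_iota.
exists (fun v => (v \in free_nodes theta) || (v \in sel)); split.
  rewrite -size_sel; apply: (@leq_trans (count [in sel] V)); last first.
    rewrite -size_filter; apply: uniq_leq_size; first exact/filter_uniq/uniq_nodes.
    by move=> v; rewrite mem_filter => /andP[].
  rewrite -sum1_count [X in X <= _]big_mkcond [X in _ <= X]big_mkcond /=.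
  apply: leq_sum => v _.
  rewrite /cost /node_cost; case: (v \in free_nodes _) => /=; first by case: ifP.
  by case: ifP => // /sel_ch ->.
move=> P AP sat.
have satr r e : r \in all_rules rs -> e \in rule_edges k theta r -> saturated theta P e.
  by move=> r_in e_in; apply: sat; apply/medgesP; exists r.
have f1V := fact_in_nodes (free1_in_facts M time len x).
have Ppads : all P (pads theta).
  apply/allP => v v_in; apply: AP; last by rewrite mem_cat v_in.
  have r_in : ((goal, free1), free1) \in all_rules rs.
    by rewrite mem_cat map_f ?orbT // (free1_in_facts M time len x).
  apply: (@mem_nodes _ _ _ (edge3 k theta ((goal, free1), free1))).
    by apply/medgesP; exists ((goal, free1), free1); rewrite // !inE eqxx !orbT.
  by rewrite inE mem_cat v_in orbT.
have all_edges r e : r \in all_rules rs -> P (fact r.1.1) -> P (fact r.1.2) ->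
    e \in rule_edges k theta r -> all P e.
  move=> r_in p1 p2; apply: saturated_rule => // e' e'_in; exact: satr r_in e'_in.
have concl r : r \in all_rules rs -> P (fact r.1.1) -> P (fact r.1.2) -> P (fact r.2).
  move=> r_in p1 p2; apply: (allP (all_edges r (edge3 k theta r) r_in p1 p2 _));
    by rewrite !inE eqxx ?orbT.
have Pf1 : P (fact free1) by apply: AP => //; rewrite mem_cat !inE eqxx !orbT.
have ruleP r : is_rule M time len x r -> r \in all_rules rs.
  by move=> /is_rule_tm_rules r_in; rewrite mem_cat r_in.
have start := RuleStart time len x ([ffun=> None] : reads M).
have Pgoal : P (fact goal).
  apply: (@derive_goal M time len x y le_y (fun u => P (fact u))) => //.
  - by move=> r /ruleP; apply: concl.
  - apply: AP; last by rewrite mem_cat !inE eqxx !orbT.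
    apply: fact_in_nodes; apply: tm_rule_facts (is_rule_tm_rules start) _.
    by rewrite !inE eqxx !orbT.
  - apply: AP; last by rewrite inE eqxx orbT.
    apply: fact_in_nodes; have lt_y : size y < L.+1 by [].
    apply: tm_rule_facts (is_rule_tm_rules (RuleChosen0 M time lt_y)) _.
    by rewrite !inE eqxx.
  - move=> i lt_i; apply: AP; last first.
      apply/orP; right; apply: map_f; rewrite inE; apply/orP; right.
      by apply/mapP; exists i => //; rewrite mem_iota.
    apply: fact_in_nodes.
    apply: tm_rule_facts (is_rule_tm_rules (RuleChosenS M time (nth false y i) lt_i)) _.
    by rewrite !inE eqxx orbT.
have Pfact u : u \in rule_facts rs -> P (fact u).
  move=> u_in; apply: (concl ((goal, free1), u)) => //.
  by rewrite mem_cat map_f ?orbT.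
apply/allP => v; rewrite mem_undup => /flattenP[e /medgesP[r r_in e_in] ve].
apply: (allP (all_edges r e r_in _ _ e_in)) => //.
  move: r_in; rewrite mem_cat => /orP[r_in|/mapP[u _ ->] //].
  by apply: Pfact; apply: tm_rule_facts r_in _; rewrite inE eqxx.
move: r_in; rewrite mem_cat => /orP[r_in|/mapP[u _ ->] //].
by apply: Pfact; apply: tm_rule_facts r_in _; rewrite !inE eqxx orbT.
Qed.

(** If [D goal] failed, the rules added for [goal] would hold vacuously, and [ext D] would be a
    saturated set containing the seeds but not [goal]. *)
Lemma sound_valuation (A : pred node) (D : pred name) : horn_solution A ->
  (forall v, v \in V -> A v -> ext D v) ->
  (forall r, is_rule M time len x r -> D r.1.1 -> D r.1.2 -> D r.2) -> D goal.
Proof.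
move=> [_ full] AD rD; apply/negPn/negP => nD.
have satD e : e \in medges k theta rs -> saturated theta (ext D) e.
  case/medgesP => r r_in e_in; apply: ext_saturated e_in => //.
  move: r_in; rewrite mem_cat => /orP[/tm_rules_is_rule/rD //|/mapP[u _ ->] /=].
  by rewrite (negbTE nD).
have := allP (full (ext D) AD satD) _ (fact_in_nodes (goal_in_facts M time len x)).
by rewrite /ext /= (negbTE nD).
Qed.

Definition choice_group (u : name) : nat :=
  match u with [:: 6; i; _] => i.+1 | _ => 0 end.

(* Everything except the consequences of a choice in group [g]. *)
Definition ungrouped (g : nat) (u : name) : bool :=
  match u with
  | [:: 5] => false
  | [:: 4; j] => j < g
  | [:: 6; i; _] => i.+1 != g
  | [:: 7; _] => g != 0
  | _ => true
  end.

Lemma solution_certificate A : horn_solution A ->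
  exists2 y, size y <= L & tm_accept (cfg_state (tm_run M (pair_code x y) T)).
Proof.
move=> sol; have [le_cost _] := sol.
(* Any other seed would cost [L + 2] on its own. *)
have A_cheap v : v \in V -> A v ->
    (v \in free_nodes theta) || (v \in [seq fact u | u <- ch]).
  move=> vV Av; apply: contraLR le_cost; rewrite negb_or => /andP[nf nc].
  rewrite -ltnNge big_mkcond (bigD1_seq v vV (uniq_nodes _ _ _)) /= Av.
  by rewrite /cost {1}/node_cost (negbTE nf) (negbTE nc) leq_addr.
pose chosen := [seq head [::] v | v <- V & A v && (v \in [seq fact u | u <- ch])].
have chosenP u : u \in chosen <-> [/\ fact u \in V, A (fact u) & u \in ch].
  split=> [/mapP[v]|[uV Au u_in]].
    rewrite mem_filter => /andP[/andP[Av /mapP[u' u'_in vE]] vV] ->.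
    by rewrite vE in Av vV *.
  by apply/mapP; exists (fact u) => //; rewrite mem_filter Au map_f.
have size_chosen : size chosen <= L.+1.
  rewrite size_map size_filter; apply: leq_trans le_cost.
  rewrite -sum1_count [X in X <= _]big_mkcond [X in _ <= X]big_mkcond /=; apply: leq_sum => v _.
  case: (A v) => //=; case: ifP => // v_in.
  by rewrite /cost /node_cost (negbTE (choice_not_free v_in)) v_in.
have A_ext (D : pred name) : D free1 -> D free2 -> (forall u, u \in chosen -> D u) ->
    forall v, v \in V -> A v -> ext D v.
  move=> D1 D2 Dch v vV Av; case/orP: (A_cheap v vV Av) => [|/mapP[u u_in vE]].
    by rewrite mem_cat !inE => /or3P[/mapP[i _ ->]|/eqP ->|/eqP ->].
  by rewrite vE; apply: (Dch u); apply/chosenP; rewrite -vE; split.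
(* Without a choice in group [g] the facts [nChosen j] stop at [j < g], whereas [goal] needs
   [nChosen L]. *)
have group_chosen g : g < L.+1 -> g \in [seq choice_group u | u <- chosen].
  move=> lt_g; apply/negPn/negP => /mapP no_g.
  suff : ungrouped g goal by [].
  apply: (sound_valuation sol) => [|r].
    apply: A_ext => // u u_in; have [_ _ /choicesP] := iffLR (chosenP u) u_in.
    case=> [[l _ uE]|[i [b [_ uE]]]]; rewrite uE /=; apply/eqP => gE; apply: no_g; exists u => //.
      by rewrite uE gE.
    by rewrite uE -gE.
  by case=> //= *; lia.
(* At most [L + 1] choices meet all [L + 1] groups, so no group is met twice. *)
have uniq_groups : uniq [seq choice_group u | u <- chosen].
  apply: (@leq_size_uniq _ (iota 0 L.+1)); first exact: iota_uniq.
    by move=> g; rewrite mem_iota => /andP[_]; apply: group_chosen.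
  by rewrite size_map size_iota.
have group_inj := uniq_map_in_inj uniq_groups.
have [l lt_l l_in] : exists2 l, l < L.+1 & nLen l \in chosen.
  have /mapP[u u_in u0] := group_chosen 0 isT.
  have [_ _ /choicesP[[l lt_l uE]|[i [b [_ uE]]]]] := iffLR (chosenP u) u_in.
    by exists l; rewrite -?uE.
  by rewrite uE in u0.
pose bit i := nBit i true \in chosen.
pose y := mkseq bit l; have size_y : size y = l by rewrite size_mkseq.
exists y; first by rewrite size_y.
have := @sound_valuation A (truth M time len x y bit) sol; apply; last first.
  move=> r; apply: truth_rule; first by rewrite size_y.
  by move=> i; rewrite size_y => lt_i; rewrite nth_mkseq.
apply: A_ext => // u u_in; have [_ _ /choicesP] := iffLR (chosenP u) u_in.
case=> [[l' _ uE]|[i [b [_ uE]]]]; rewrite uE in u_in *.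
  by have [->] := group_inj _ _ u_in l_in erefl; rewrite /= size_y.
rewrite /=; case: b u_in {uE} => u_in; first by rewrite /bit u_in.
(* Both bits at position [i] would be two choices in the same group. *)
have [bi|//] := boolP (bit i).
by have := group_inj _ _ u_in bi erefl.
Qed.

End Reduction.

Lemma PT_reduction k theta (M : tm) (time len : {poly nat}) :
  PT (fun x => enc_raw (horn_raw k theta
    (tm_rules M time len x, (choices M len x, (certlen len x).+1)))).
Proof.
have P1 := PT_tm_rules M time len; have P2 := PT_choices M len.
have P3 := PT_certlen len; have P4 := PT_horn_raw k theta.
by apply: PT_enc_raw; pt.
Qed.

Lemma DEC_SCTM_NP_hard k theta : 3 <= theta -> theta <= k -> NP_hard (DEC_SCTM k theta).
Proof.
move=> theta3 le_theta_k L' [V [len [[M [time decV]] L'P]]].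
exists (fun x => enc_raw (horn_raw k theta
    (tm_rules M time len x, (choices M len x, (certlen len x).+1)))).
split; first exact/polytime_computable_PT/PT_reduction.
move=> x; set r := horn_raw _ _ _.
have rne := rule_premises_neq M time len x.
have gin := goal_in_facts M time len x; have fin := free1_in_facts M time len x.
have vr : valid_form r by exact: horn_valid.
have accP y : size y <= certlen len x ->
    tm_accept (cfg_state (tm_run M (pair_code x y) (runtime time len x))) <-> V (pair_code x y).
  move=> le_y; have [h <-] := decV (pair_code x y).
  (* The machine has halted by the bound for its actual input and keeps its state up to the common
     time. *)
  have le_T : time.[size (pair_code x y)]%R <= runtime time len x.
    apply: horner_nat_mono.
    by rewrite pair_codeE size_cat /inputlen leq_add2l.
  by rewrite /tm_run -(subnK le_T) iterD tm_halted_iter.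
have questionP I : represents r I ->
    dec_question theta I <-> exists A, horn_solution k theta M time len x A.
  by move=> rI; exact: (horn_question rne rI).
split=> [/L'P[y [le_y Vy]]|[I [wfI /encoded_byP[r' rI rE] q]]].
  have [I rI] := valid_represents vr; exists I; split.
  - exact: (horn_wf theta3 le_theta_k rne gin fin rI).
  - by apply/encoded_byP; exists r.
  - by apply/(questionP I rI); apply: certificate_solution (le_y) _ => //; apply/accP.
have [decP _ _] := codec_raw.
(* Codes determine the raw data, so every instance with this code is represented by [r]. *)
have r'E : r' = r by have := decP r' [::]; rewrite cats0 -rE -[enc_raw r]cats0 decP => -[].
rewrite r'E in rI; have [A sol] := iffLR (questionP I rI) q.
have [y le_y acc] := solution_certificate theta3 le_theta_k sol.
by apply/L'P; exists y; split=> //; apply/accP.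
Qed.

Theorem theorem1 (k theta : nat) (htheta : 1 <= theta) (hk : theta <= k) :
  [/\ (theta = 1 -> 1 <= k -> in_P (DEC_SCTM k theta)),
      (theta = 2 -> 2 <= k -> in_P (DEC_SCTM k theta))
    & (3 <= theta -> theta <= k -> NP_hard (DEC_SCTM k theta))].
Proof.
split=> [-> _|-> _|theta3 le_theta_k].
- exact: DEC_SCTM1_in_P.
- exact: DEC_SCTM2_in_P.
- exact: DEC_SCTM_NP_hard.
Qed.
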